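(* If $$\lim_{n\to\infty} \int_{n}^{\infty} \left|1 + \sum_{k=1}^{n} \mu(k)\, \nu\!\left(\frac{x}{k}\right)\right|^2 x^{-2}\, dx = 0$$ (the limit being taken over positive integers $n$), then the Riemann Hypothesis is true, i.e. all non-trivial zeros of the Riemann zeta function $\zeta(s)$ lie on the line $\Re(s) = \frac{1}{2}$.
   Context: $\mu$ denotes the usual Möbius function. For real $t$, $\{t\}$ denotes the fractional part of $t$, and the function $\nu$ is defined by $\nu(t) = \{t/2\} + 1/2 - \{t/2 + 1/2\}$. *)

(* Defs.v *)
From Stdlib Require Import Reals.
From mathcomp Require Import ssreflect ssrbool eqtype ssrnat seq prime.
From Coquelicot Require Import Coquelicot.
Local Open Scope R_scope.

(* [primes n] is duplicate-free, so its size is the number of distinct prime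
   divisors of n. *)
Definition mobius (n : nat) : R :=
  if (0 < n)%N && all (fun p => logn p n == 1%N) (primes n)
  then (-1) ^ size (primes n) else 0.

Definition nu (t : R) : R :=
  frac_part (t / 2) + 1 / 2 - frac_part (t / 2 + 1 / 2).

Definition Cexp (z : C) : C :=
  (exp (Re z) * cos (Im z), exp (Re z) * sin (Im z)).

(* Dirichlet series on Re s > 1, together with complex differentiability (the
   scalar field of [ex_derive] is C) on the connected open set C \ {1}: by
   the identity theorem this determines zeta everywhere except at its pole 1,
   where the value of the total function zeta is arbitrary. *)
Definition is_riemann_zeta (zeta : C -> C) : Prop :=
  (forall s : C, 1 < Re s ->
     is_series (V := C_NormedModule)
       (fun n : nat => Cexp (- s * RtoC (ln (INR n.+1)))%C) (zeta s)) /\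
  (forall s : C, s <> RtoC 1 ->
     ex_derive (K := C_AbsRing) (V := C_NormedModule) zeta s).

Definition trivial_zero (s : C) : Prop :=
  exists m : nat, s = RtoC (- 2 * INR m.+1).

Definition RiemannHypothesis : Prop :=
  forall zeta : C -> C, is_riemann_zeta zeta ->
  forall s : C, s <> RtoC 1 -> zeta s = RtoC 0 -> ~ trivial_zero s ->
  Re s = 1 / 2.

(* Main.v *)
Require Import Defs.
From Stdlib Require Import Reals ZArith Lra Lia Classical ClassicalEpsilon.
From HB Require Import structures.
From mathcomp Require Import ssreflect.
From mathcomp Require ssrfun ssrbool eqtype ssrnat seq div prime bigop.
From Coquelicot Require Import Coquelicot.
Open Scope R_scope.

(** Why the statement holds.

    The function nu is the indicator of the reals whose integer part is odd,
    so that [F_n(x) = 1 + sum_(k <= n) mu(k) nu(x/k)] only depends on the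
    integer part of x.  As [sum_(d | j) mu(d) = 0] for [j > 1], it is 2 for
    [1 <= x < 2] and 0 for [2 <= x < n] ([step_value_small]).  Let
    [eta(s) = 1 - 2^-s + 3^-s - ...], which is [(1 - 2^(1-s)) zeta(s)].
    Summing [F_n(m) (m^-s - (m+1)^-s)] over all m, that is, taking [s] times
    the Mellin transform of [F_n], gives for [Re s > 0]

      [sum_(m >= n) F_n(m) (m^-s - (m+1)^-s)
         = eta(s) sum_(k <= n) mu(k) k^-s - (1 - 2^(1-s))]

    ([tail_limit]).  When [Re s > 1/2] the left side is bounded through the
    Cauchy-Schwarz inequality by the square root of the integral of the
    hypothesis ([tail_sum_bound]), so it tends to 0.  At a zero of zeta the
    right side is [-(1 - 2^(1-s))] for every n, hence [2^(1-s) = 1].  This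
    last possibility is excluded by comparing the identity at [s] and at
    [s + h], dividing by h and letting h tend to 0.  Thus zeta has no zero
    with real part above 1/2 ([zeta_nonzero_right]).

    Zeros with real part below 1/2 are carried to the right by the functional
    equation [2 cos(pi w/2) zeta(w) = (1/Gamma)(w) (2 pi)^w zeta(1-w)]: a zero
    [1-w] on the left forces [cos(pi w/2) = 0], so that [1-w] is a trivial
    zero or 0 ([zeros_left_half_plane]), and [zeta(0) <> 0]
    ([zeta_0_neq_0]).

    The functional equation is first obtained for real [0 < s < 1] by a
    discrete argument.  Let chi be the even function mod 4 with values 0, 1, -2, 1: it
    is its own discrete Fourier transform up to a factor.  Let [a_j] be the
    coefficients of [(1-z)^(-s)].  Picking the multiples of N in
    [sum a_j z^j] with the weights chi, and letting z go to 1, yields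

      [2N sum_n chi(n) a_(nN) = sum_(k < 4N) chi(k) (1 - e^(2 pi i k/4N))^(-s)]

    ([boundary_identity]).  Since [a_N ~ N^(s-1) / Gamma(s)], multiplying by
    [N^(1-s)] and letting N tend to infinity turns the left side into
    [sum chi(n) n^(s-1)] and the right side into [sum chi(k) k^(-s)], up to
    explicit factors ([real_functional_equation]).  As chi gives the Dirichlet
    series [(1 - 2^-s) eta(s)], this is the functional equation of zeta.

    Analytic continuation rests on one lemma, [identity_rectangle]: a function
    on a rectangle that is a uniform limit of complex differentiable functions
    and is 0 on one side is 0 at the middle of the opposite side.  It follows
    from Goursat's theorem for the product with [exp (n cosh z)], a weight of
    modulus 1 on two sides of the rectangle which concentrates at the middle
    of the third.  The limits eta and 1/Gamma enter directly through the
    partial sums and products that converge to them. *)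

(** * Complex differentiability at a point *)

(** Differentiability at the single point [p]; holomorphy on a set is expressed
    pointwise. *)
Definition holo_at (f : C -> C) (p : C) : Prop :=
  exists l : C, forall eps, 0 < eps -> exists d, 0 < d /\
    forall z, Cmod (z - p) < d ->
      Cmod (f z - f p - l * (z - p)) <= eps * Cmod (z - p).

Definition cont_at (f : C -> C) (p : C) : Prop :=
  forall eps, 0 < eps -> exists d, 0 < d /\
    forall z, Cmod (z - p) < d -> Cmod (f z - f p) < eps.

Lemma Cmod_sub_sym (a b : C) : Cmod (a - b) = Cmod (b - a).
Proof. rewrite -Cmod_opp; congr Cmod; ring. Qed.

Lemma Cmod_triangle_sub (a b c : C) : Cmod (a - c) <= Cmod (a - b) + Cmod (b - c).
Proof.
replace (a - c)%C with ((a - b) + (b - c))%C by ring; exact: Cmod_triangle.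
Qed.

Lemma Cmod_sub_le (a b : C) : Cmod (a - b) <= Cmod a + Cmod b.
Proof. by rewrite -(Cmod_opp b); apply: Cmod_triangle. Qed.

Lemma Cmod_le_sub (a b : C) : Cmod a <= Cmod (a - b) + Cmod b.
Proof.
by move: (Cmod_triangle (a - b) b); replace (a - b + b)%C with a by ring.
Qed.

Lemma Cmod_Re_le (z : C) : Rabs (Re z) <= Cmod z.
Proof. exact: re_le_Cmod. Qed.

Lemma Cmod_Im_le (z : C) : Rabs (Im z) <= Cmod z.
Proof.
apply: Rle_trans (Rmax_Cmod z); exact: Rmax_r.
Qed.

Lemma Cmod_le_ReIm (z : C) : Cmod z <= Rabs (Re z) + Rabs (Im z).
Proof.
case: z => x y; rewrite /Cmod /=.
rewrite -(sqrt_Rsqr (Rabs x + Rabs y)); last by move: (Rabs_pos x) (Rabs_pos y); lra.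
apply: sqrt_le_1_alt; rewrite /Rsqr.
have := Rabs_pos x; have := Rabs_pos y.
have -> : x * (x * 1) = Rabs x * Rabs x by rewrite -Rabs_mult Rabs_pos_eq; nra.
have -> : y * (y * 1) = Rabs y * Rabs y by rewrite -Rabs_mult Rabs_pos_eq; nra.
nra.
Qed.

Lemma Cmult_cancel_l (k a b : C) : k <> 0%C -> (k * a = k * b)%C -> a = b.
Proof.
by move=> Hk H; transitivity (/ k * (k * a))%C; [|rewrite H]; field.
Qed.

Lemma holo_cont f p : holo_at f p -> cont_at f p.
Proof.
case=> l Hl eps He; case: (Hl 1 Rlt_0_1) => d [Hd H].
have Hc := Cmod_ge_0 l.
exists (Rmin d (eps / (Cmod l + 2))); split.
  by apply: Rmin_pos => //; apply: Rdiv_lt_0_compat; lra.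
move=> z Hz.
have H1 : Cmod (z - p) < d by apply: Rlt_le_trans Hz _; apply: Rmin_l.
have H2 : Cmod (z - p) < eps / (Cmod l + 2) by apply: Rlt_le_trans Hz _; apply: Rmin_r.
have H3 := H z H1.
have := Cmod_le_sub (f z - f p) (l * (z - p)); rewrite Cmod_mult => H4.
apply: Rle_lt_trans (_ : (Cmod l + 2) * Cmod (z - p) < _).
  by move: (Cmod_ge_0 (z - p)); nra.
have -> : eps = (Cmod l + 2) * (eps / (Cmod l + 2)) by field; lra.
by apply: Rmult_lt_compat_l => //; lra.
Qed.

(** The form in which the analyticity of zeta is given. *)
Lemma ex_derive_holo_at (f : C -> C) (p : C) :
  ex_derive (K := C_AbsRing) (V := C_NormedModule) f p -> holo_at f p.
Proof.
case=> l [_ Hl]; exists l => eps He.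
have Hp : is_filter_lim (locally (T := AbsRing_UniformSpace C_AbsRing) p) p by [].
case: (Hl p Hp (mkposreal _ He)) => d Hd.
exists d; split; first exact: cond_pos.
move=> z Hz; have := Hd z Hz.
by rewrite (Cmult_comm l).
Qed.

Lemma holo_const c p : holo_at (fun _ => c) p.
Proof.
exists 0%C => eps He; exists 1; split; [lra|move=> z _].
replace (c - c - 0 * (z - p))%C with (RtoC 0) by ring.
rewrite Cmod_0; move: (Cmod_ge_0 (z - p)); nra.
Qed.

Lemma holo_id p : holo_at (fun z => z) p.
Proof.
exists 1%C => eps He; exists 1; split; [lra|move=> z _].
replace (z - p - 1 * (z - p))%C with (RtoC 0) by ring.
rewrite Cmod_0; move: (Cmod_ge_0 (z - p)); nra.
Qed.

Lemma holo_plus f g p : holo_at f p -> holo_at g p -> holo_at (fun z => f z + g z)%C p.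
Proof.
case=> l Hl [m Hm]; exists (l + m)%C => eps He.
have He2 : 0 < eps / 2 by lra.
case: (Hl _ He2) => d [Hd H]; case: (Hm _ He2) => d' [Hd' H'].
exists (Rmin d d'); split; first exact: Rmin_pos.
move=> z Hz.
have H1 := H z (Rlt_le_trans _ _ _ Hz (Rmin_l _ _)).
have H2 := H' z (Rlt_le_trans _ _ _ Hz (Rmin_r _ _)).
replace (f z + g z - (f p + g p) - (l + m) * (z - p))%C
  with ((f z - f p - l * (z - p)) + (g z - g p - m * (z - p)))%C by ring.
apply: Rle_trans (Cmod_triangle _ _) _; lra.
Qed.

Lemma holo_mult f g p : holo_at f p -> holo_at g p -> holo_at (fun z => f z * g z)%C p.
Proof.
move=> Hf Hg; have Cg := holo_cont _ _ Hg.
case: Hf => l Hl; case: Hg => m Hm; exists (l * g p + f p * m)%C => eps He.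
have A1 := Cmod_ge_0 l; have A2 := Cmod_ge_0 (g p); have A3 := Cmod_ge_0 (f p).
set K := Cmod l + Cmod (g p) + Cmod (f p) + 1.
have HK : 0 < K by rewrite /K; lra.
have He2 : 0 < eps / (3 * K) by apply: Rdiv_lt_0_compat; lra.
case: (Hl _ He2) => d [Hd H]; case: (Hm _ He2) => d' [Hd' H'].
have He3 : 0 < Rmin 1 (eps / (3 * K)) by apply: Rmin_pos; lra.
case: (Cg _ He3) => d2 [Hd2 H2].
exists (Rmin (Rmin d d') d2); split; first by apply: Rmin_pos => //; apply: Rmin_pos.
move=> z Hz.
have Z1 := Rlt_le_trans _ _ _ Hz (Rmin_l _ _).
have {}H := H z (Rlt_le_trans _ _ _ Z1 (Rmin_l _ _)).
have {}H' := H' z (Rlt_le_trans _ _ _ Z1 (Rmin_r _ _)).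
have {}H2 := H2 z (Rlt_le_trans _ _ _ Hz (Rmin_r _ _)).
have G1 := Rlt_le_trans _ _ _ H2 (Rmin_l _ _).
have G2 := Rlt_le_trans _ _ _ H2 (Rmin_r _ _).
replace (f z * g z - f p * g p - (l * g p + f p * m) * (z - p))%C
  with ((f z - f p - l * (z - p)) * g z + (f p * (g z - g p - m * (z - p))
        + l * (z - p) * (g z - g p)))%C by ring.
apply: Rle_trans (Cmod_triangle _ _) _; rewrite Cmod_mult.
have B1 := Cmod_triangle (f p * (g z - g p - m * (z - p))) (l * (z - p) * (g z - g p)).
rewrite !Cmod_mult in B1.
have B2 : Cmod (g z) <= K.
  by move: (Cmod_le_sub (g z) (g p)); rewrite /K; lra.
move: (Cmod_ge_0 (z - p)) (Cmod_ge_0 (g z)) (Cmod_ge_0 (g z - g p)) B1 B2 H H' G2 He2.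
set e := eps / (3 * K).
have -> : eps = 3 * (K * e) by rewrite /e; field; lra.
set w := Cmod (z - p); move: (Cmod_ge_0 (f z - f p - l * (z - p))).
move: (Cmod_ge_0 (g z - g p - m * (z - p))).
move: (Cmod (f z - _ - _)) (Cmod (g z - _ - _)) (Cmod (g z - g p)) (Cmod (g z)) => a b c q.
move=> Ha Hb W Q Cc B1 B2 H3 H4 G2' E.
have lK : Cmod l <= K by rewrite /K; lra.
have fK : Cmod (f p) <= K by rewrite /K; lra.
have Y1 : Cmod (f p) * b <= K * (e * w).
  by apply: Rmult_le_compat => //; lra.
have Y2 : Cmod l * w * c <= K * w * e.
  by apply: Rmult_le_compat; [nra|lra|apply: Rmult_le_compat_r; lra|lra].
have Y3 : a * q <= (e * w) * K.
  by apply: Rmult_le_compat; lra.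
lra.
Qed.

Lemma holo_comp f g p : holo_at f (g p) -> holo_at g p -> holo_at (fun z => f (g z)) p.
Proof.
move=> [l Hl] Hg; have Cg := holo_cont _ _ Hg.
case: Hg => m Hm; exists (l * m)%C => eps He.
have A1 := Cmod_ge_0 l; have A2 := Cmod_ge_0 m.
set K := Cmod l + Cmod m + 1.
have HK : 0 < K by rewrite /K; lra.
have He2 : 0 < eps / (2 * K) by apply: Rdiv_lt_0_compat; lra.
case: (Hl _ He2) => d [Hd H].
have He3 : 0 < Rmin 1 (eps / (2 * K)) by apply: Rmin_pos; lra.
case: (Hm _ He3) => d' [Hd' H']; case: (Cg _ Hd) => d2 [Hd2 H2].
exists (Rmin d' d2); split; first exact: Rmin_pos.
move=> z Hz.
have {}H' := H' z (Rlt_le_trans _ _ _ Hz (Rmin_l _ _)).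
have {}H2 := H2 z (Rlt_le_trans _ _ _ Hz (Rmin_r _ _)).
have {}H := H _ H2.
replace (f (g z) - f (g p) - l * m * (z - p))%C
  with ((f (g z) - f (g p) - l * (g z - g p)) + l * (g z - g p - m * (z - p)))%C by ring.
apply: Rle_trans (Cmod_triangle _ _) _; rewrite Cmod_mult.
have B := Cmod_le_sub (g z - g p) (m * (z - p)); rewrite Cmod_mult in B.
have W := Cmod_ge_0 (z - p).
have M1 := Rmin_l 1 (eps / (2 * K)); have M2 := Rmin_r 1 (eps / (2 * K)).
move: (Cmod_ge_0 (g z - g p - m * (z - p))) H' B H W He2 M1 M2 He3.
set e := eps / (2 * K); set e' := Rmin 1 e.
have -> : eps = 2 * (K * e) by rewrite /e; field; lra.
move: (Cmod (g z - g p - _)) (Cmod (g z - g p)) (Cmod (z - p)) (Cmod (f _ - _ - _)) => a b w c.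
move=> Ha H' B H W E M1 M2 E'.
have Y1 : a <= w by nra.
have Y2 : b <= K * w by rewrite /K; nra.
have Y3 : Cmod l * a <= K * (e * w).
  by apply: Rmult_le_compat; rewrite /K; try lra; nra.
have Y4 : c <= e * (K * w) by apply: Rle_trans H _; apply: Rmult_le_compat_l; lra.
lra.
Qed.

Lemma holo_ext f g p : (forall z, f z = g z) -> holo_at f p -> holo_at g p.
Proof.
move=> E [l H]; exists l => eps He; case: (H eps He) => d [Hd H'].
by exists d; split=> // z Hz; rewrite -!E; apply: H'.
Qed.

Lemma holo_opp f p : holo_at f p -> holo_at (fun z => - f z)%C p.
Proof.
move=> H; apply: holo_ext (holo_mult _ _ _ (holo_const (-(1))%C p) H).
by move=> z /=; ring.
Qed.

Lemma holo_minus f g p : holo_at f p -> holo_at g p -> holo_at (fun z => f z - g z)%C p.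
Proof. by move=> Hf Hg; apply: holo_plus => //; apply: holo_opp. Qed.

(** * Bisection of the unit square *)

Section Bisection.
Variable P : R -> R -> R -> Prop.

(** The state is a square, given by its lower left corner and its side; the step
    selects a quarter on which [P] fails, if there is one. *)
Definition bisect_step (q : R * R * R) : R * R * R :=
  let '(x, y, t) := q in let h := t / 2 in
  match excluded_middle_informative (P x y h),
    excluded_middle_informative (P (x + h) y h),
    excluded_middle_informative (P x (y + h) h) with
  | right _, _, _ => (x, y, h)
  | left _, right _, _ => (x + h, y, h)
  | left _, left _, right _ => (x, y + h, h)
  | left _, left _, left _ => (x + h, y + h, h)
  end.

Fixpoint bisect_seq (n : nat) : R * R * R :=
  match n with 0%nat => (0, 0, 1) | S m => bisect_step (bisect_seq m) end.

Lemma nested_point (u t : nat -> R) :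
  (forall n, u n <= u (S n)) -> (forall n, u (S n) + t (S n) <= u n + t n) ->
  (forall n, 0 <= t n) -> exists x, forall n, u n <= x <= u n + t n.
Proof.
move=> Hu Ht Hp.
have Um : forall n k, u n <= u (n + k)%nat.
  move=> n; elim=> [|k IH]; first by rewrite Nat.add_0_r; lra.
  by rewrite Nat.add_succ_r; apply: Rle_trans IH (Hu _).
have Tm : forall n k, u (n + k)%nat + t (n + k)%nat <= u n + t n.
  move=> n; elim=> [|k IH]; first by rewrite Nat.add_0_r; lra.
  by rewrite Nat.add_succ_r; apply: Rle_trans (Ht _) IH.
have UT : forall n m, u m <= u n + t n.
  move=> n m; case: (Nat.le_ge_cases n m) => H.
    have -> : m = (n + (m - n))%nat by lia.
    by move: (Tm n (m - n)%nat) (Hp (n + (m - n))%nat); lra.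
  have E : n = (m + (n - m))%nat by lia.
  by move: (Um m (n - m)%nat) (Hp n); rewrite -E; lra.
have [x [H1 H2]] : {x | is_lub (fun v => exists n, v = u n) x}.
  apply: completeness; last by exists (u 0%nat); exists 0%nat.
  by exists (u 0%nat + t 0%nat) => v [n ->]; apply: UT.
exists x => n; split; first by apply: H1; exists n.
by apply: H2 => v [m ->]; apply: UT.
Qed.

(** Compactness of the unit square in the form used by Goursat's argument: a property
    of squares that passes from four quarters to their union and holds for small
    squares around every point holds for the whole square, since otherwise repeated
    bisection leads to a point whose small neighbouring squares all fail. *)
Lemma bisection_principle :
  (forall x y t, 0 < t -> P x y (t / 2) -> P (x + t / 2) y (t / 2) ->
     P x (y + t / 2) (t / 2) -> P (x + t / 2) (y + t / 2) (t / 2) -> P x y t) ->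
  (forall X Y, 0 <= X <= 1 -> 0 <= Y <= 1 -> exists d, 0 < d /\
     forall x y t, 0 < t < d -> x <= X <= x + t -> y <= Y <= y + t ->
       0 <= x -> x + t <= 1 -> 0 <= y -> y + t <= 1 -> P x y t) ->
  P 0 0 1.
Proof.
move=> Hsum Hloc; apply: NNPP => HN.
pose X n := fst (fst (bisect_seq n)); pose Y n := snd (fst (bisect_seq n)).
pose T n := snd (bisect_seq n).
have step n : X n <= X (S n) /\ X (S n) + T (S n) <= X n + T n /\
              Y n <= Y (S n) /\ Y (S n) + T (S n) <= Y n + T n /\
              T (S n) = T n / 2 \/ T n < 0.
  rewrite /X /Y /T /=; case: (bisect_seq n) => [[x y] t] /=.
  case: (Rlt_le_dec t 0) => Ht; [by right|left].
  by repeat (case: excluded_middle_informative => ? /=); lra.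
have TE n : T n = (/ 2) ^ n.
  elim: n => [//|n IH]; have -> : T (S n) = T n / 2.
    rewrite /T /=; case: (bisect_seq n) => [[x y] t] /=.
    by repeat (case: excluded_middle_informative => ? /=).
  by rewrite IH /=; field.
have Tp n : 0 < T n by rewrite TE; apply: pow_lt; lra.
have {}step n : X n <= X (S n) /\ X (S n) + T (S n) <= X n + T n /\
              Y n <= Y (S n) /\ Y (S n) + T (S n) <= Y n + T n.
  by case: (step n) => [|H]; [tauto|move: (Tp n); lra].
have NP n : ~ P (X n) (Y n) (T n).
  elim: n => [//|n IH] H; apply: IH; have Hp := Tp n.
  move: Hp H; rewrite /X /Y /T /=; case: (bisect_seq n) => [[x y] t] /= Hp.
  case: excluded_middle_informative => [H1|H1 //=].
  case: excluded_middle_informative => [H2|H2 //=].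
  case: excluded_middle_informative => [H3|H3 //=] H4.
  exact: Hsum.
have [x Hx] : exists x, forall n, X n <= x <= X n + T n.
  by apply: nested_point => n; case: (step n) => ? []; try lra; move: (Tp n); lra.
have [y Hy] : exists y, forall n, Y n <= y <= Y n + T n.
  apply: nested_point => n; case: (step n) => ? [? []]; try lra; move: (Tp n); lra.
have Xb n : 0 <= X n /\ X n + T n <= 1 /\ 0 <= Y n /\ Y n + T n <= 1.
  elim: n => [|n IH]; first by rewrite /X /Y /T /=; lra.
  by move: (step n); lra.
have x01 : 0 <= x <= 1 by move: (Hx 0%nat) (Xb 0%nat); lra.
have y01 : 0 <= y <= 1 by move: (Hy 0%nat) (Xb 0%nat); lra.
case: (Hloc x y x01 y01) => d [Hd H].
have [n Hn] : exists n, (/ 2) ^ n < d.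
  have L : Rabs (/ 2) < 1 by rewrite Rabs_pos_eq; lra.
  case: (pow_lt_1_zero _ L d Hd) => n Hn; exists n.
  by apply: Rle_lt_trans (Rle_abs _) (Hn n (le_n _)).
apply: (NP n); apply: H; rewrite -?TE in Hn => //; try by move: (Xb n); tauto.
Qed.

End Bisection.

(** * Integrals along segments *)

Notation CInt f a b := (RInt (V := C_R_CompleteNormedModule) f a b).

(** [ring] on complex numbers that are typed as elements of a normed module. *)
Ltac Cring := match goal with |- @eq _ ?a ?b => change (@eq C a b) end;
  rewrite ?RtoC_opp; ring.

Lemma scal_C (r : R) (z : C) : scal r (z : C_R_NormedModule) = (r * z)%C.
Proof.
rewrite /scal /= /prod_scal /scal /= /mult /=.
by apply: injective_projections => /=; ring.
Qed.

Definition line (a b : C) (t : R) : C := (a + t * (b - a))%C.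

(** The direction [b - a] is part of the integrand, so that the four sides of a
    contour can be added without orientation factors. *)
Definition seg (f : C -> C) (a b : C) : C :=
  CInt (fun t => (f (line a b t) * (b - a))%C) 0 1.

(** Boundary of the parallelogram with vertices [p], [p+u], [p+u+v], [p+v]. *)
Definition contour (f : C -> C) (p u v : C) : C :=
  (seg f p (p + u) + seg f (p + u) (p + u + v)
   + seg f (p + u + v) (p + v) + seg f (p + v) p)%C.

Definition cont_on_seg (f : C -> C) (a b : C) : Prop :=
  forall t, 0 <= t <= 1 -> cont_at f (line a b t).

Lemma continuous_curve (g : R -> C) (t : R) :
  (forall eps, 0 < eps -> exists d, 0 < d /\
     forall s, Rabs (s - t) < d -> Cmod (g s - g t) < eps) ->
  continuous (g : R -> C_R_NormedModule) t.
Proof.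
move=> H; apply/filterlim_locally => eps.
case: (H eps (cond_pos eps)) => d [Hd Hs].
exists (mkposreal d Hd) => s Hb.
apply: (norm_compat1 (V := C_R_NormedModule)).
by rewrite -Cmod_norm; apply: Hs.
Qed.

Lemma line_sub a b s t : (line a b s - line a b t = RtoC (s - t) * (b - a))%C.
Proof. rewrite /line RtoC_minus; ring. Qed.

Lemma continuous_line f a b t : cont_at f (line a b t) ->
  continuous (fun s => (f (line a b s) * (b - a))%C : C_R_NormedModule) t.
Proof.
move=> H; apply: continuous_curve => eps He.
have M := Cmod_ge_0 (b - a).
have He2 : 0 < eps / (Cmod (b - a) + 1) by apply: Rdiv_lt_0_compat; lra.
case: (H _ He2) => d [Hd Hc].
exists (d / (Cmod (b - a) + 1)); split; first by apply: Rdiv_lt_0_compat; lra.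
move=> s Hs.
have Hl : Cmod (line a b s - line a b t) < d.
  rewrite line_sub Cmod_mult Cmod_R.
  have -> : d = d / (Cmod (b - a) + 1) * (Cmod (b - a) + 1) by field; lra.
  move: Hs (Rabs_pos (s - t)); set q := d / _; set r := Rabs _ => Hs Hr; nra.
have {}Hc := Hc _ Hl.
have -> : (f (line a b s) * (b - a) - f (line a b t) * (b - a)
          = (f (line a b s) - f (line a b t)) * (b - a))%C by ring.
rewrite Cmod_mult.
have -> : eps = eps / (Cmod (b - a) + 1) * (Cmod (b - a) + 1) by field; lra.
move: Hc (Cmod_ge_0 (f (line a b s) - f (line a b t))).
set q := eps / _; set r := Cmod (f _ - _) => Hs' Hr; nra.
Qed.

Lemma ex_seg f a b : cont_on_seg f a b ->
  ex_RInt (V := C_R_NormedModule) (fun t => (f (line a b t) * (b - a))%C) 0 1.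
Proof.
move=> H; apply: (ex_RInt_continuous (V := C_R_CompleteNormedModule)) => t.
rewrite Rmin_left ?Rmax_right; try lra; move=> Ht.
by apply: continuous_line; apply: H.
Qed.

Lemma is_seg f a b : cont_on_seg f a b ->
  is_RInt (V := C_R_NormedModule) (fun t => (f (line a b t) * (b - a))%C) 0 1 (seg f a b).
Proof. by move=> H; apply: (RInt_correct (V := C_R_CompleteNormedModule)); apply: ex_seg. Qed.

Lemma seg_unique f a b l :
  is_RInt (V := C_R_NormedModule) (fun t => (f (line a b t) * (b - a))%C) 0 1 l ->
  seg f a b = l.
Proof. exact: (is_RInt_unique (V := C_R_CompleteNormedModule)). Qed.

Lemma seg_ext f g a b : (forall t, 0 <= t <= 1 -> f (line a b t) = g (line a b t)) ->
  seg f a b = seg g a b.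
Proof.
move=> H; apply: (RInt_ext (V := C_R_CompleteNormedModule)) => t; rewrite Rmin_left ?Rmax_right; try lra.
by move=> Ht; rewrite H //; lra.
Qed.

Lemma seg_plus f g a b : cont_on_seg f a b -> cont_on_seg g a b ->
  seg (fun z => f z + g z)%C a b = (seg f a b + seg g a b)%C.
Proof.
move=> Hf Hg; apply: seg_unique.
have := is_RInt_plus (V := C_R_NormedModule) _ _ _ _ _ _ (is_seg _ _ _ Hf) (is_seg _ _ _ Hg).
apply: (is_RInt_ext (V := C_R_NormedModule)) => t _.
by rewrite -[plus _ _]/(Cplus _ _); Cring.
Qed.

Lemma seg_bound f a b M : cont_on_seg f a b ->
  (forall t, 0 <= t <= 1 -> Cmod (f (line a b t)) <= M) ->
  Cmod (seg f a b) <= M * Cmod (b - a).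
Proof.
move=> Hf HM; rewrite Cmod_norm.
have -> : M * Cmod (b - a) = (1 - 0) * (M * Cmod (b - a)) by ring.
apply: (norm_RInt_le_const (V := C_R_NormedModule)) (is_seg _ _ _ Hf); first lra.
move=> t Ht; rewrite -Cmod_norm Cmod_mult.
by apply: Rmult_le_compat_r; [apply: Cmod_ge_0|apply: HM].
Qed.

Lemma line_swap a b t : line b a t = line a b (1 - t).
Proof. rewrite /line RtoC_minus; ring. Qed.

Lemma seg_swap f a b : cont_on_seg f a b -> seg f b a = (- seg f a b)%C.
Proof.
move=> Hf; apply: seg_unique.
have H := is_RInt_swap _ _ _ _ (is_seg _ _ _ Hf).
have := is_RInt_comp_lin (V := C_R_NormedModule) (fun t => (f (line a b t) * (b - a))%C) (-1) 1 0 1 (- seg f a b)%C.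
have -> : -1 * 0 + 1 = 1 by ring. have -> : -1 * 1 + 1 = 0 by ring.
move=> /(_ H); apply: (is_RInt_ext (V := C_R_NormedModule)) => t _.
have -> : -1 * t + 1 = 1 - t by ring.
rewrite -line_swap scal_C; have -> : -1 = Ropp 1 by lra.
Cring.
Qed.

Lemma seg_split f a b : cont_on_seg f a b ->
  seg f a b = (seg f a ((a + b) / 2) + seg f ((a + b) / 2) b)%C.
Proof.
move=> Hf; set m := ((a + b) / 2)%C.
have two : RtoC 2 <> 0%C by move=> /RtoC_inj; lra.
have L1 t : line a m t = line a b (/ 2 * t + 0).
  rewrite /line /m Rplus_0_r RtoC_mult RtoC_inv; last by move=> //; lra.
  by field.
have L2 t : line m b t = line a b (/ 2 * t + / 2).
  rewrite /line /m RtoC_plus RtoC_mult RtoC_inv; last by move=> //; lra.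
  by field.
have D1 : (m - a = RtoC (/2) * (b - a))%C.
  by rewrite /m RtoC_inv; [field|lra].
have D2 : (b - m = RtoC (/2) * (b - a))%C.
  by rewrite /m RtoC_inv; [field|lra].
set g := (fun t => (f (line a b t) * (b - a))%C).
have E1 : ex_RInt (V := C_R_NormedModule) g 0 (/ 2).
  by apply: (ex_RInt_Chasles_1 (V := C_R_CompleteNormedModule)) (ex_seg _ _ _ Hf); lra.
have E2 : ex_RInt (V := C_R_NormedModule) g (/ 2) 1.
  by apply: (ex_RInt_Chasles_2 (V := C_R_CompleteNormedModule)) (ex_seg _ _ _ Hf); lra.
rewrite {1}/seg -(RInt_Chasles (V := C_R_CompleteNormedModule) g 0 (/2) 1) //.
congr Cplus; symmetry; apply: seg_unique.
- have := is_RInt_comp_lin (V := C_R_NormedModule) g (/ 2) 0 0 1 (CInt g 0 (/ 2)).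
  have -> : / 2 * 0 + 0 = 0 by ring. have -> : / 2 * 1 + 0 = / 2 by ring.
  move=> /(_ (RInt_correct (V := C_R_CompleteNormedModule) _ _ _ E1)).
  apply: (is_RInt_ext (V := C_R_NormedModule)) => t _; rewrite L1 D1 /g.
  by rewrite scal_C; Cring.
- have := is_RInt_comp_lin (V := C_R_NormedModule) g (/ 2) (/ 2) 0 1 (CInt g (/ 2) 1).
  have -> : / 2 * 0 + / 2 = / 2 by ring. have -> : / 2 * 1 + / 2 = 1 by field.
  move=> /(_ (RInt_correct (V := C_R_CompleteNormedModule) _ _ _ E2)).
  apply: (is_RInt_ext (V := C_R_NormedModule)) => t _; rewrite L2 D2 /g.
  by rewrite scal_C; Cring.
Qed.

Lemma RtoC_2 : RtoC 2 = (1 + 1)%C.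
Proof. rewrite -RtoC_plus; congr RtoC; ring. Qed.

(** The trapezoidal rule is exact on affine functions. *)
Lemma seg_affine A B a b :
  seg (fun z => A + B * z)%C a b = ((A + B * ((a + b) / 2)) * (b - a))%C.
Proof.
apply: seg_unique.
set P := ((A + B * a) * (b - a))%C; set Q := (B * (b - a) * (b - a))%C.
have Hreal p q : is_RInt (V := R_NormedModule) (fun t => p + t * q) 0 1 (p + q / 2).
  have -> : p + q / 2 = minus (p * 1 + q * 1 ^ 2 / 2) (p * 0 + q * 0 ^ 2 / 2).
    by rewrite /minus /plus /opp /=; field.
  apply: (is_RInt_derive (V := R_CompleteNormedModule) (fun t => p * t + q * t ^ 2 / 2)) => x _.
    by auto_derive => //; field.
  apply: (ex_derive_continuous (V := R_NormedModule)); by auto_derive.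
have -> : ((A + B * ((a + b) / 2)) * (b - a))%C = (Re P + Re Q / 2, Im P + Im Q / 2).
  have -> : (Re P + Re Q / 2, Im P + Im Q / 2) = (P + Q * RtoC (/ 2)%R)%C :> C.
    by apply: injective_projections => /=; rewrite /Re /Im; field.
  rewrite RtoC_inv; last lra; rewrite /P /Q; field.
apply: (is_RInt_ext (V := C_R_NormedModule) (fun t => (Re P + t * Re Q, Im P + t * Im Q))).
  move=> t _.
  have -> : (Re P + t * Re Q, Im P + t * Im Q) = (P + t * Q)%C :> C.
    by apply: injective_projections => /=; rewrite /Re /Im; ring.
  by rewrite /line /P /Q; Cring.
have H := is_RInt_fct_extend_pair (U := R_NormedModule) (V := R_NormedModule)
  (fun t => (Re P + t * Re Q, Im P + t * Im Q)) 0 1 _ _ (Hreal (Re P) (Re Q)) (Hreal (Im P) (Im Q)).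
exact H.
Qed.

Lemma contour_affine A B p u v : contour (fun z => A + B * z)%C p u v = 0%C.
Proof.
rewrite /contour !seg_affine; field.
Qed.

(** * Goursat's theorem for parallelograms *)

Definition pgram (p u v : C) (z : C) : Prop :=
  exists X Y, 0 <= X <= 1 /\ 0 <= Y <= 1 /\ z = (p + X * u + Y * v)%C.

Lemma pgram_line p u v a b t : pgram p u v a -> pgram p u v b -> 0 <= t <= 1 ->
  pgram p u v (line a b t).
Proof.
move=> [X [Y [HX [HY ->]]]] [X' [Y' [HX' [HY' ->]]]] Ht.
exists (X + t * (X' - X)), (Y + t * (Y' - Y)); split; first by nra.
split; first by nra.
rewrite /line !(RtoC_plus, RtoC_mult, RtoC_minus); ring.
Qed.

Lemma pgram_seg f p u v a b : (forall z, pgram p u v z -> cont_at f z) ->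
  pgram p u v a -> pgram p u v b -> cont_on_seg f a b.
Proof. by move=> H Ha Hb t Ht; apply: H; apply: pgram_line. Qed.

Lemma pgram_corners p u v : pgram p u v p /\ pgram p u v (p + u)%C /\
  pgram p u v (p + u + v)%C /\ pgram p u v (p + v)%C.
Proof.
split; first by exists 0, 0; split; [lra|split; [lra|ring]].
split; first by exists 1, 0; split; [lra|split; [lra|ring]].
split; first by exists 1, 1; split; [lra|split; [lra|ring]].
by exists 0, 1; split; [lra|split; [lra|ring]].
Qed.

Lemma seg_split_at f a b m : cont_on_seg f a b -> m = ((a + b) / 2)%C ->
  seg f a b = (seg f a m + seg f m b)%C.
Proof. by move=> H ->; apply: seg_split. Qed.

(** The inner sides of the four quarters are traversed twice, in opposite
    directions. *)
Lemma contour_quarter f p h k :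
  (forall z, pgram p (h + h) (k + k) z -> cont_at f z) ->
  contour f p (h + h) (k + k) =
  (contour f p h k + contour f (p + h) h k + contour f (p + k) h k
   + contour f (p + h + k) h k)%C.
Proof.
move=> H.
have two : RtoC 2 <> 0%C by move=> /RtoC_inj; lra.
have half : (RtoC (/ 2) + RtoC (/ 2) = 1)%C.
  rewrite -RtoC_plus; congr RtoC; field.
have G X Y z : 0 <= X <= 1 -> 0 <= Y <= 1 -> z = (p + X * (h + h) + Y * (k + k))%C ->
  pgram p (h + h) (k + k) z by move=> HX HY ->; exists X, Y.
have hh (w : C) : (RtoC (/ 2) * (w + w) = w)%C.
  replace (RtoC (/ 2) * (w + w))%C with ((RtoC (/ 2) + RtoC (/ 2)) * w)%C by ring.
  rewrite half; ring.
have I : 0 <= / 2 <= 1 by lra. have O : 0 <= 0 <= 1 by lra. have J : 0 <= 1 <= 1 by lra.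
have G00 : pgram p (h + h) (k + k) p by apply: (G 0 0) => //; ring.
have G10 : pgram p (h + h) (k + k) (p + h)%C by apply: (G (/2) 0) => //; rewrite hh; ring.
have G20 : pgram p (h + h) (k + k) (p + h + h)%C by apply: (G 1 0) => //; ring.
have G01 : pgram p (h + h) (k + k) (p + k)%C by apply: (G 0 (/2)) => //; rewrite hh; ring.
have G11 : pgram p (h + h) (k + k) (p + h + k)%C by apply: (G (/2) (/2)) => //; rewrite !hh.
have G21 : pgram p (h + h) (k + k) (p + h + h + k)%C by apply: (G 1 (/2)) => //; rewrite hh; ring.
have G02 : pgram p (h + h) (k + k) (p + k + k)%C by apply: (G 0 1) => //; ring.
have G12 : pgram p (h + h) (k + k) (p + h + k + k)%C by apply: (G (/2) 1) => //; rewrite hh; ring.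
have G22 : pgram p (h + h) (k + k) (p + h + h + k + k)%C by apply: (G 1 1) => //; ring.
rewrite /contour.
have -> : (p + (h + h) = p + h + h)%C by ring.
have -> : (p + h + h + (k + k) = p + h + h + k + k)%C by ring.
have -> : (p + (k + k) = p + k + k)%C by ring.
have -> : (p + k + h = p + h + k)%C by ring.
have -> : (p + h + k + h = p + h + h + k)%C by ring.
have S := fun a b => pgram_seg f p (h + h) (k + k) a b H.
rewrite (seg_split_at f p (p + h + h) (p + h)); [|exact: S|by field].
rewrite (seg_split_at f (p + h + h) (p + h + h + k + k) (p + h + h + k)); [|exact: S|by field].
rewrite (seg_split_at f (p + h + h + k + k) (p + k + k) (p + h + k + k)); [|exact: S|by field].
rewrite (seg_split_at f (p + k + k) p (p + k)); [|exact: S|by field].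
rewrite (seg_swap f (p + h + k) (p + h)); last exact: S.
rewrite (seg_swap f (p + h + k) (p + k)); last exact: S.
rewrite (seg_swap f (p + h + k) (p + h + h + k)); last exact: S.
rewrite (seg_swap f (p + h + k) (p + h + k + k)); last exact: S.
ring.
Qed.

Lemma contour_plus f g p u v :
  (forall z, pgram p u v z -> cont_at f z) -> (forall z, pgram p u v z -> cont_at g z) ->
  contour (fun z => f z + g z)%C p u v = (contour f p u v + contour g p u v)%C.
Proof.
move=> Hf Hg; case: (pgram_corners p u v) => A [B [C D]].
have Sf := fun a b => pgram_seg f p u v a b Hf.
have Sg := fun a b => pgram_seg g p u v a b Hg.
rewrite /contour !seg_plus; try (by [apply: Sf|apply: Sg]).
ring.
Qed.

Lemma contour_bound f p u v M :
  (forall z, pgram p u v z -> cont_at f z) ->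
  (forall z, pgram p u v z -> Cmod (f z) <= M) ->
  Cmod (contour f p u v) <= M * (2 * (Cmod u + Cmod v)).
Proof.
move=> Hf HM; case: (pgram_corners p u v) => A [B [C D]].
have S a b : pgram p u v a -> pgram p u v b -> Cmod (seg f a b) <= M * Cmod (b - a).
  move=> Ha Hb; apply: seg_bound; first exact: (pgram_seg f p u v).
  by move=> t Ht; apply: HM; apply: pgram_line.
have S1 := S _ _ A B; have S2 := S _ _ B C; have S3 := S _ _ C D; have S4 := S _ _ D A.
replace (p + u - p)%C with u in S1 by ring.
replace (p + u + v - (p + u))%C with v in S2 by ring.
replace (p + v - (p + u + v))%C with (- u)%C in S3 by ring.
replace (p - (p + v))%C with (- v)%C in S4 by ring.
rewrite !Cmod_opp in S3 S4.
rewrite /contour; apply: Rle_trans (Cmod_triangle _ _) _.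
have := Cmod_triangle (seg f p (p + u) + seg f (p + u) (p + u + v)) (seg f (p + u + v) (p + v)).
have := Cmod_triangle (seg f p (p + u)) (seg f (p + u) (p + u + v)).
lra.
Qed.

(** By bisection it is enough to bound the contour integral by [eps] times the area on
    small squares of the parameter domain. There the function is its affine
    approximation, whose contour integral is 0, plus an error [e |z - c|]; length
    times error is of the order of the area. *)
Lemma Goursat f p u v : (forall z, pgram p u v z -> holo_at f z) ->
  contour f p u v = 0%C.
Proof.
move=> Hf; apply: Cmod_eq_0.
have Cf z : pgram p u v z -> cont_at f z by move=> Hz; apply: holo_cont; apply: Hf.
suff K eps : 0 < eps -> Cmod (contour f p u v) <= eps.
  case: (Cmod_ge_0 (contour f p u v)) => // H.
  by have := K (Cmod (contour f p u v) / 2); lra.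
move=> He.
have sub x y t z : 0 < t -> 0 <= x -> x + t <= 1 -> 0 <= y -> y + t <= 1 ->
  pgram (p + x * u + y * v) (t * u) (t * v) z -> pgram p u v z.
  move=> Ht Hx Hxt Hy Hyt [X [Y [HX [HY ->]]]]; exists (x + X * t), (y + Y * t).
  split; first by nra. split; first by nra.
  rewrite !(RtoC_plus, RtoC_mult); ring.
pose P x y t := 0 <= x -> x + t <= 1 -> 0 <= y -> y + t <= 1 ->
  Cmod (contour f (p + x * u + y * v) (t * u) (t * v)) <= eps * t ^ 2.
suff : P 0 0 1.
  rewrite /P => /(_ ltac:(lra) ltac:(lra) ltac:(lra) ltac:(lra)).
  replace (p + 0 * u + 0 * v)%C with p by ring.
  by rewrite !Cmult_1_l; lra.
apply: bisection_principle.
- move=> x y t Ht P1 P2 P3 P4 Hx Hxt Hy Hyt.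
  have {}P1 := P1 ltac:(lra) ltac:(lra) ltac:(lra) ltac:(lra).
  have {}P2 := P2 ltac:(lra) ltac:(lra) ltac:(lra) ltac:(lra).
  have {}P3 := P3 ltac:(lra) ltac:(lra) ltac:(lra) ltac:(lra).
  have {}P4 := P4 ltac:(lra) ltac:(lra) ltac:(lra) ltac:(lra).
  have tt (w : C) : (t * w = RtoC (t / 2) * w + RtoC (t / 2) * w)%C.
    replace (t * w)%C with (RtoC (t / 2 + t / 2) * w)%C; first by rewrite RtoC_plus; ring.
    by congr Cmult; congr RtoC; field.
  rewrite !tt contour_quarter -?tt; last first.
    by move=> z Hz; apply: Cf; apply: (sub x y t).
  have e1 : (p + (x + t / 2)%R * u + y * v = p + x * u + y * v + (t / 2)%R * u)%C.
    rewrite RtoC_plus; ring.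
  have e2 : (p + x * u + (y + t / 2)%R * v = p + x * u + y * v + (t / 2)%R * v)%C.
    rewrite RtoC_plus; ring.
  have e3 : (p + (x + t / 2)%R * u + (y + t / 2)%R * v = p + x * u + y * v + (t / 2)%R * u + (t / 2)%R * v)%C.
    rewrite !RtoC_plus; ring.
  rewrite e1 in P2; rewrite e2 in P3; rewrite e3 in P4.
  apply: Rle_trans (Cmod_triangle _ _) _.
  apply: Rle_trans (Rplus_le_compat_r _ _ _ (Cmod_triangle _ _)) _.
  apply: Rle_trans (Rplus_le_compat_r _ _ _ (Rplus_le_compat_r _ _ _ (Cmod_triangle _ _))) _.
  lra.
- move=> X Y HX HY; set c := (p + X * u + Y * v)%C.
  have [l Hl] : holo_at f c by apply: Hf; exists X, Y.
  set S := Cmod u + Cmod v.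
  have HS : 0 <= S by rewrite /S; move: (Cmod_ge_0 u) (Cmod_ge_0 v); lra.
  (* the perimeter [2 t S] times the error [e t S] has to be at most [eps t^2] *)
  set e := eps / (2 * S ^ 2 + 1).
  have D : 0 < 2 * S ^ 2 + 1 by nra.
  have He' : 0 < e by apply: Rdiv_lt_0_compat.
  case: (Hl e He') => d [Hd H].
  exists (d / (S + 1)); split; first by apply: Rdiv_lt_0_compat; lra.
  move=> x y t [Ht Htd] Hx' Hy' Hx Hxt Hy Hyt _ _ _ _.
  set q := (p + x * u + y * v)%C.
  have Hsub z : pgram q (t * u) (t * v) z -> cont_at f z.
    by move=> Hz; apply: Cf; apply: (sub x y t).
  have Hdist z : pgram q (t * u) (t * v) z -> Cmod (z - c) <= t * S.
    move=> [X' [Y' [HX' [HY' ->]]]].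
    replace (q + X' * (t * u) + Y' * (t * v) - c)%C
      with (RtoC (x - X + X' * t) * u + RtoC (y - Y + Y' * t) * v)%C; last first.
      rewrite /q /c !(RtoC_plus, RtoC_mult, RtoC_minus); ring.
    apply: Rle_trans (Cmod_triangle _ _) _; rewrite !Cmod_mult !Cmod_R /S.
    have A1 : Rabs (x - X + X' * t) <= t by apply: Rabs_le; nra.
    have A2 : Rabs (y - Y + Y' * t) <= t by apply: Rabs_le; nra.
    move: (Cmod_ge_0 u) (Cmod_ge_0 v); nra.
  have Hsmall : t * S < d.
    have -> : d = d / (S + 1) * (S + 1) by field; lra.
    move: Htd Ht; set w := d / _; nra.
  pose r z := (f z - f c - l * (z - c))%C.
  have Er z : f z = (r z + ((f c - l * c) + l * z))%C by rewrite /r; ring.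
  have aff z : holo_at (fun z => (f c - l * c) + l * z)%C z.
    by apply: holo_plus; [apply: holo_const|apply: holo_mult; [apply: holo_const|apply: holo_id]].
  have Cr z : pgram q (t * u) (t * v) z -> cont_at r z.
    move=> Hz; apply: holo_cont; apply: holo_minus; first apply: holo_minus.
    - by apply: Hf; apply: (sub x y t).
    - exact: holo_const.
    - apply: holo_mult; first exact: holo_const.
      by apply: holo_minus; [apply: holo_id|apply: holo_const].
  have -> : contour f q (t * u) (t * v) = contour r q (t * u) (t * v).
    have -> : contour f q (t * u) (t * v) =
      contour (fun z => r z + ((f c - l * c) + l * z))%C q (t * u) (t * v).
      by rewrite /contour; congr (_ + _ + _ + _)%C; apply: seg_ext => s _; apply: Er.
    rewrite contour_plus ?contour_affine; [by ring|exact: Cr|].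
    by move=> z _; apply: holo_cont; apply: aff.
  apply: Rle_trans (contour_bound r q (t * u) (t * v) (e * (t * S)) Cr _) _.
    move=> z Hz; apply: Rle_trans (H z _) _; first by apply: Rle_lt_trans (Hdist z Hz) _.
    by apply: Rmult_le_compat_l; [lra|apply: Hdist].
  rewrite !Cmod_mult !Cmod_R Rabs_pos_eq; last lra.
  have -> : e * (t * S) * (2 * (t * Cmod u + t * Cmod v)) = (e * (2 * S ^ 2)) * t ^ 2.
    rewrite /S; ring.
  have -> : eps = e * (2 * S ^ 2 + 1) by rewrite /e; field; lra.
  apply: Rmult_le_compat_r; [nra|]; apply: Rmult_le_compat_l; lra.
Qed.

(** Again by bisection: boundedness passes from quarters to the whole and is local by
    continuity. *)
Lemma bounded_on_pgram f p u v : (forall z, pgram p u v z -> cont_at f z) ->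
  exists M, 0 <= M /\ forall z, pgram p u v z -> Cmod (f z) <= M.
Proof.
move=> Hf.
pose P x y t := 0 <= x -> x + t <= 1 -> 0 <= y -> y + t <= 1 ->
  exists M, forall X Y, x <= X <= x + t -> y <= Y <= y + t -> Cmod (f (p + X * u + Y * v)%C) <= M.
suff : P 0 0 1.
  move=> /(_ ltac:(lra) ltac:(lra) ltac:(lra) ltac:(lra)) [M HM].
  exists M; split; last first.
    by move=> z [X [Y [HX [HY ->]]]]; apply: HM; lra.
  apply: Rle_trans (Cmod_ge_0 _) (HM 0 0 _ _); lra.
apply: bisection_principle.
- move=> x y t Ht P1 P2 P3 P4 Hx Hxt Hy Hyt.
  have [M1 {}P1] := P1 ltac:(lra) ltac:(lra) ltac:(lra) ltac:(lra).
  have [M2 {}P2] := P2 ltac:(lra) ltac:(lra) ltac:(lra) ltac:(lra).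
  have [M3 {}P3] := P3 ltac:(lra) ltac:(lra) ltac:(lra) ltac:(lra).
  have [M4 {}P4] := P4 ltac:(lra) ltac:(lra) ltac:(lra) ltac:(lra).
  exists (Rmax (Rmax M1 M2) (Rmax M3 M4)) => X Y HX HY.
  have A1 := Rmax_l M1 M2; have A2 := Rmax_r M1 M2; have A3 := Rmax_l M3 M4; have A4 := Rmax_r M3 M4.
  have B1 := Rmax_l (Rmax M1 M2) (Rmax M3 M4); have B2 := Rmax_r (Rmax M1 M2) (Rmax M3 M4).
  case: (Rle_lt_dec X (x + t / 2)) => H1; case: (Rle_lt_dec Y (y + t / 2)) => H2.
  + have := P1 X Y; lra.
  + have := P3 X Y; lra.
  + have := P2 X Y; lra.
  + have := P4 X Y; lra.
- move=> X Y HX HY; set c := (p + X * u + Y * v)%C.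
  have Hc : cont_at f c by apply: Hf; exists X, Y.
  case: (Hc 1 Rlt_0_1) => d [Hd H].
  set S := Cmod u + Cmod v.
  have HS : 0 <= S by rewrite /S; move: (Cmod_ge_0 u) (Cmod_ge_0 v); lra.
  exists (d / (S + 1)); split; first by apply: Rdiv_lt_0_compat; lra.
  move=> x y t [Ht Htd] Hx' Hy' _ _ _ _ _ _ _ _.
  exists (Cmod (f c) + 1) => X' Y' HX' HY'.
  apply: Rle_trans (Cmod_le_sub _ (f c)) _.
  suff : Cmod (f (p + X' * u + Y' * v)%C - f c) < 1 by lra.
  apply: H.
  replace (p + X' * u + Y' * v - c)%C with (RtoC (X' - X) * u + RtoC (Y' - Y) * v)%C; last first.
    rewrite /c !RtoC_minus; ring.
  apply: Rle_lt_trans (Cmod_triangle _ _) _; rewrite !Cmod_mult !Cmod_R.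
  have A1 : Rabs (X' - X) <= t by apply: Rabs_le; lra.
  have A2 : Rabs (Y' - Y) <= t by apply: Rabs_le; lra.
  have -> : d = d / (S + 1) * (S + 1) by field; lra.
  apply: Rle_lt_trans (_ : t * S < _).
    rewrite /S; move: (Cmod_ge_0 u) (Cmod_ge_0 v); nra.
  move: Htd Ht; set w := d / _; nra.
Qed.

(** * The complex exponential *)

Lemma Cexp_plus a b : Cexp (a + b) = (Cexp a * Cexp b)%C.
Proof.
rewrite /Cexp /Re /Im /=; apply: injective_projections => /=; rewrite exp_plus.
  rewrite cos_plus; ring.
rewrite sin_plus; ring.
Qed.

Lemma Cexp_RtoC x : Cexp (RtoC x) = RtoC (exp x).
Proof. rewrite /Cexp /= cos_0 sin_0 /RtoC; congr pair; ring. Qed.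

Lemma Cexp_0 : Cexp 0 = 1%C.
Proof. by rewrite Cexp_RtoC exp_0. Qed.

Lemma Cmod_Cexp z : Cmod (Cexp z) = exp (Re z).
Proof.
rewrite /Cmod /Cexp /=.
have -> : exp (Re z) * cos (Im z) * (exp (Re z) * cos (Im z) * 1) +
   exp (Re z) * sin (Im z) * (exp (Re z) * sin (Im z) * 1) = Rsqr (exp (Re z)).
  have := sin2_cos2 (Im z); rewrite /Rsqr => H.
  transitivity (exp (Re z) * exp (Re z) * (sin (Im z) * sin (Im z) + cos (Im z) * cos (Im z))).
    ring.
  rewrite H; ring.
by rewrite sqrt_Rsqr //; apply: Rlt_le; apply: exp_pos.
Qed.

(** Fundamental theorem of calculus for [t |-> exp (a + t b)]; every estimate on
    exponentials below comes from bounding this integrand. *)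
Lemma is_RInt_Cexp (a b : C) :
  is_RInt (V := C_R_NormedModule) (fun t => (b * Cexp (a + RtoC t * b))%C) 0 1
    (Cexp (a + b) - Cexp a)%C.
Proof.
set g := (fun t => (b * Cexp (a + RtoC t * b))%C).
case: a b @g => a1 a2 [b1 b2] g.
pose g1 t := exp (a1 + t * b1) * cos (a2 + t * b2).
pose g2 t := exp (a1 + t * b1) * sin (a2 + t * b2).
have H1 : is_RInt (V := R_NormedModule) (fun t => b1 * g1 t - b2 * g2 t) 0 1 (g1 1 - g1 0).
  apply: (is_RInt_derive (V := R_CompleteNormedModule) g1) => x _.
    by rewrite /g1 /g2; auto_derive => //; ring.
  apply: (ex_derive_continuous (V := R_NormedModule)); by rewrite /g1 /g2; auto_derive.
have H2 : is_RInt (V := R_NormedModule) (fun t => b1 * g2 t + b2 * g1 t) 0 1 (g2 1 - g2 0).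
  apply: (is_RInt_derive (V := R_CompleteNormedModule) g2) => x _.
    by rewrite /g1 /g2; auto_derive => //; ring.
  apply: (ex_derive_continuous (V := R_NormedModule)); by rewrite /g1 /g2; auto_derive.
have H := is_RInt_fct_extend_pair (U := R_NormedModule) (V := R_NormedModule)
  (fun t => (b1 * g1 t - b2 * g2 t, b1 * g2 t + b2 * g1 t)) 0 1 _ _ H1 H2.
have -> : (Cexp ((a1, a2) + (b1, b2)) - Cexp (a1, a2))%C = (g1 1 - g1 0, g2 1 - g2 0).
  rewrite /Cexp /g1 /g2 /=; apply: injective_projections => /=; by rewrite !Rmult_1_l !Rmult_0_l !Rplus_0_r.
apply: (is_RInt_ext (V := C_R_NormedModule)) H => t _.
rewrite /g /Cexp /g1 /g2 /=; apply: injective_projections => /=;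
by rewrite !Rmult_0_l ?Rminus_0_r ?Rplus_0_r.
Qed.

Lemma Cexp_diff_bound (a b : C) (m : R) : Re a <= m -> Re (a + b)%C <= m ->
  Cmod (Cexp (a + b) - Cexp a) <= Cmod b * exp m.
Proof.
move=> H1 H2; rewrite Cmod_norm.
have -> : Cmod b * exp m = (1 - 0) * (Cmod b * exp m) by ring.
apply: (norm_RInt_le_const (V := C_R_NormedModule)) (is_RInt_Cexp a b); first lra.
move=> t Ht; rewrite -Cmod_norm Cmod_mult Cmod_Cexp.
apply: Rmult_le_compat_l; first exact: Cmod_ge_0.
have : Re (a + t * b)%C <= m.
  have -> : Re (a + t * b)%C = Re a + t * Re b by rewrite /Re /=; ring.
  have E : Re (a + b)%C = Re a + Re b by [].
  rewrite E in H2; nra.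
by case=> [/exp_increasing|->]; lra.
Qed.

Lemma Cexp_taylor1 (h : C) : Cmod (Cexp h - 1) <= Cmod h * exp (Cmod h).
Proof.
have := Cexp_diff_bound 0 h (Cmod h); rewrite Cexp_0 Cplus_0_l; apply.
  by apply: Cmod_ge_0.
by apply: Rle_trans (Rle_abs _) (Cmod_Re_le _).
Qed.

(** [exp h - 1 - h] is the integral of [h (exp (t h) - 1)] for t from 0 to 1. *)
Lemma Cexp_taylor2 (h : C) : Cmod (Cexp h - 1 - h) <= (Cmod h) ^ 2 * exp (Cmod h).
Proof.
rewrite Cmod_norm.
have -> : Cmod h ^ 2 * exp (Cmod h) = (1 - 0) * (Cmod h ^ 2 * exp (Cmod h)) by ring.
have H := is_RInt_Cexp 0 h; rewrite Cexp_0 Cplus_0_l in H.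
have H' := is_RInt_const (V := C_R_NormedModule) 0 1 h.
have Q : is_RInt (V := C_R_NormedModule) (fun t => (h * (Cexp (t * h) - 1))%C) 0 1
    (Cexp h - 1 - h)%C.
  have Q := is_RInt_minus (V := C_R_NormedModule) _ _ _ _ _ _ H H'.
  have El : minus (G := C_R_NormedModule) (Cexp h - 1)%C (scal (1 - 0) (h : C_R_NormedModule))
      = (Cexp h - 1 - h)%C.
    rewrite scal_C; change (Cexp h - 1 - RtoC (1 - 0) * h = Cexp h - 1 - h)%C.
    by rewrite RtoC_minus; ring.
  rewrite -El; apply: (is_RInt_ext (V := C_R_NormedModule)) Q => t _.
  change (h * Cexp (0 + t * h) - h = h * (Cexp (t * h) - 1))%C.
  by rewrite Cplus_0_l; ring.
apply: (norm_RInt_le_const (V := C_R_NormedModule)) Q; first lra.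
move=> t Ht.
rewrite -Cmod_norm Cmod_mult.
have := Cexp_taylor1 (t * h)%C; rewrite Cmod_mult Cmod_R Rabs_pos_eq; last lra.
have M := Cmod_ge_0 h; set w := Cmod h in M *.
have E : exp (t * w) <= exp w.
  have : t * w <= w by nra.
  by case=> [/exp_increasing|->]; lra.
have := exp_pos w; have := exp_pos (t * w) => E1 E2 H3.
have : t * w * exp (t * w) <= w * exp w by apply: Rmult_le_compat; nra.
move=> H4; have -> : w ^ 2 * exp w = w * (w * exp w) by ring.
by apply: Rmult_le_compat_l; lra.
Qed.

Lemma holo_Cexp p : holo_at Cexp p.
Proof.
exists (Cexp p) => eps He.
set K := exp (Re p) * exp 1.
have HK : 0 < K by rewrite /K; apply: Rmult_lt_0_compat; apply: exp_pos.
exists (Rmin 1 (eps / K)); split.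
  by apply: Rmin_pos; [lra|apply: Rdiv_lt_0_compat].
move=> z Hz; set h := (z - p)%C in Hz *.
have H1 := Rlt_le_trans _ _ _ Hz (Rmin_l _ _).
have H2 := Rlt_le_trans _ _ _ Hz (Rmin_r _ _).
have -> : (Cexp z - Cexp p - Cexp p * h = Cexp p * (Cexp h - 1 - h))%C.
  have -> : z = (p + h)%C by rewrite /h; ring.
  rewrite Cexp_plus; ring.
rewrite Cmod_mult Cmod_Cexp.
have M := Cmod_ge_0 h.
have T := Cexp_taylor2 h.
have E : exp (Cmod h) < exp 1 by apply: exp_increasing.
have P := exp_pos (Re p).
have H3 : Cmod h * K <= eps.
  have -> : eps = eps / K * K by field; lra.
  by apply: Rmult_le_compat_r; lra.
apply: Rle_trans (_ : exp (Re p) * (Cmod h ^ 2 * exp 1) <= _).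
  by apply: Rmult_le_compat_l; [lra|apply: Rle_trans T _; apply: Rmult_le_compat_l; [nra|lra]].
have -> : exp (Re p) * (Cmod h ^ 2 * exp 1) = (Cmod h * K) * Cmod h by rewrite /K; ring.
by apply: Rmult_le_compat_r.
Qed.

(** * Uniqueness for uniform limits of holomorphic functions *)

(** [F] is a uniform limit on [S] of functions that are differentiable at the points
    of [S]. *)
Definition approx_holo (F : C -> C) (S : C -> Prop) : Prop :=
  forall eps, 0 < eps -> exists G, (forall z, S z -> holo_at G z) /\
    forall z, S z -> Cmod (G z - F z) <= eps.

(** [exp (n cosh z)]. On the lines [Im z = pi/2] and [Im z = -pi/2] the hyperbolic
    cosine is imaginary, so the weight has modulus 1 there whatever the real part; on
    the imaginary axis it is [exp (n cos y)], real and peaked at 0. *)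
Definition weight (n : R) (z : C) : C := Cexp (n * ((Cexp z + Cexp (- z)) / 2)).

Lemma holo_weight n z : holo_at (weight n) z.
Proof.
apply: (holo_comp Cexp); first exact: holo_Cexp.
apply: holo_mult; first exact: holo_const.
apply: holo_mult; last exact: holo_const.
apply: holo_plus; first exact: holo_Cexp.
apply: (holo_comp Cexp); first exact: holo_Cexp.
by apply: holo_opp; apply: holo_id.
Qed.

Lemma weight_exponent n x y : ((RtoC n * ((Cexp (x, y) + Cexp (- (x, y))) / 2))%C =
  (n * ((exp x + exp (- x)) / 2 * cos y), n * ((exp x - exp (- x)) / 2 * sin y))).
Proof.
rewrite /Cexp /= cos_neg sin_neg.
have -> : (forall z : C, z / 2 = z * RtoC (/ 2))%C by move=> z; rewrite RtoC_inv; [|lra].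
by apply: injective_projections => /=; field.
Qed.

Lemma Cmod_weight n x y : Cmod (weight n (x, y)) = exp (n * ((exp x + exp (- x)) / 2 * cos y)).
Proof. by rewrite /weight Cmod_Cexp weight_exponent. Qed.

Lemma weight_imag n y : weight n (0, y) = RtoC (exp (n * cos y)).
Proof.
rewrite /weight weight_exponent Ropp_0 exp_0.
have -> : (n * ((1 + 1) / 2 * cos y), n * ((1 - 1) / 2 * sin y)) = RtoC (n * cos y).
  by rewrite /RtoC; congr pair; field.
by rewrite Cexp_RtoC.
Qed.

(** Integrate [G * weight n] over the boundary, [G] being a holomorphic approximation
    of [F]. The horizontal sides contribute a bounded amount because the weight has
    modulus 1, the right side contributes little because [G] is close to 0 there (the
    approximation is chosen after n). On the left side [Re G >= 1/2 - K sin^2 y], and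
    since [(cos y - n sin^2 y) exp (n cos y)] is the derivative of [sin y exp (n cos
    y)], the integral grows at least like n/2. Goursat's theorem makes the total
    0. *)
Lemma no_holomorphic_bump (F : C -> C) (L : R) : 0 < L ->
  approx_holo F (pgram (0, - (PI / 2)) L (0, PI)) ->
  (forall y, - (PI / 2) <= y <= PI / 2 -> F (L, y) = 0%C) -> F 0%C = 1%C -> False.
Proof.
move=> HL HF F0 F1; set S := pgram _ _ _ in HF.
have Pi := PI_RGT_0.
have SE x y : 0 <= x <= L -> - (PI / 2) <= y <= PI / 2 -> S (x, y).
  move=> Hx Hy; exists (x / L), ((y + PI / 2) / PI).
  have E : 0 < / L by apply: Rinv_0_lt_compat.
  have E' : 0 < / PI by apply: Rinv_0_lt_compat.
  split; first by split; [apply: Rdiv_le_0_compat; lra|apply/Rle_div_l; lra].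
  split; first by split; [apply: Rdiv_le_0_compat; lra|apply/Rle_div_l; lra].
  by apply: injective_projections => /=; field; lra.
have ES z : S z -> exists x y, z = (x, y) /\ 0 <= x <= L /\ - (PI / 2) <= y <= PI / 2.
  move=> [X [Y [HX [HY ->]]]]; exists (X * L), (- (PI / 2) + Y * PI); split; last by nra.
  by apply: injective_projections => /=; ring.
have S0 : S 0%C by apply: SE; lra.
have [G0 [H0 A0]] := HF (1 / 8) ltac:(lra).
have [M [M0 HM]] : exists M, 0 <= M /\ forall z, S z -> Cmod (F z) <= M.
  have [M [M0 HM]] := bounded_on_pgram G0 _ _ _ (fun z Hz => holo_cont _ _ (H0 z Hz)).
  exists (M + 1); split; first lra.
  move=> z Hz; move: (HM z Hz) (A0 z Hz) (Cmod_le_sub (F z) (G0 z)).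
  rewrite Cmod_sub_sym; lra.
have [d Hd [Hd1 Hnear]] : exists2 d, 0 < d & d <= 1 /\
    forall y, Rabs y < d -> - (PI / 2) <= y <= PI / 2 -> Cmod (F (0, y) - 1) <= 3 / 8.
  have [d [Hd Hc]] := holo_cont _ _ (H0 _ S0) (1 / 8) ltac:(lra).
  exists (Rmin d 1); first by apply: Rmin_pos; lra.
  split; first exact: Rmin_r.
  move=> y Hy Hy2.
  have D : Cmod ((0, y) - 0) < d.
    apply: Rle_lt_trans (Cmod_le_ReIm _) _; rewrite /= Ropp_0 !Rplus_0_r Rabs_R0 Rplus_0_l.
    by apply: Rlt_le_trans Hy (Rmin_l _ _).
  have {}Hc := Hc _ D; have S1 : S (0, y) by apply: SE; lra.
  have := A0 _ S1; have := A0 _ S0; rewrite F1 => B1 B2.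
  have T1 := Cmod_triangle_sub (F (0, y)) (G0 (0, y)) 1.
  have T2 := Cmod_triangle_sub (G0 (0, y)) (G0 0%C) 1.
  rewrite (Cmod_sub_sym (F _) (G0 _)) in T1; lra.
have Hd2 : 0 < sin (d / 2) by apply: sin_gt_0; move: PI2_1 ; lra.
(* [K sin^2 y] is at least [M + 1] as soon as [|y| >= d], where only [|F| <= M] is known *)
set K := (M + 1) / (sin (d / 2)) ^ 2.
have HK : 0 <= K by apply: Rdiv_le_0_compat; [lra|apply: pow_lt].
have Hlow y : - (PI / 2) <= y <= PI / 2 -> 5 / 8 - K * (sin y) ^ 2 <= Re (F (0, y)).
  move=> Hy; case: (Rlt_le_dec (Rabs y) d) => Hyd.
    have H := Hnear y Hyd Hy; have := Cmod_Re_le (F (0, y) - 1)%C.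
    have -> : Re (F (0, y) - 1)%C = Re (F (0, y)) - 1 by [].
    move=> H'; have := Rabs_def2 (Re (F (0, y)) - 1) (1/2) ltac:(lra).
    have : Rabs (Re (F (0, y)) - 1) <= 3 / 8 by lra.
    move=> /Rabs_le_between; have : 0 <= K * sin y ^ 2 by apply: Rmult_le_pos => //; apply: pow2_ge_0.
    lra.
  have Hs : (sin (d / 2)) ^ 2 <= (sin y) ^ 2.
    have Hs1 : sin (d / 2) <= sin (Rabs y).
      have Ha : Rabs y <= PI / 2 by apply: Rabs_le.
      by apply: sin_incr_1; move: PI2_1; lra.
    have -> : sin y ^ 2 = sin (Rabs y) ^ 2.
      by rewrite /Rabs; case: Rcase_abs => _ //; rewrite sin_neg; ring.
    by apply: pow_incr; lra.
  have E : K * sin (d / 2) ^ 2 = M + 1 by rewrite /K; field; lra.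
  have : M + 1 <= K * sin y ^ 2 by rewrite -E; apply: Rmult_le_compat_l.
  have := HM (0, y) (SE 0 y ltac:(lra) Hy); have := Cmod_Re_le (F (0, y)).
  move=> A B; have : Rabs (Re (F (0, y))) <= M by lra.
  move=> /Rabs_le_between; lra.
(* n is chosen so that the growth n/2 beats the horizontal sides and [n/4 >= K] *)
set n := 4 * K + 4 * L * (M + 1) + 4.
have Hn : 0 <= n by rewrite /n; nra.
set B := exp (n * exp L).
have HB : 0 < B by apply: exp_pos.
set eps := Rmin (1 / 8) (/ (PI * B)).
have HPB : 0 < PI * B by apply: Rmult_lt_0_compat.
have He : 0 < eps by apply: Rmin_pos; [lra|apply: Rinv_0_lt_compat].
have [G [HG AG]] := HF eps He.
have He1 : eps <= 1 / 8 by apply: Rmin_l.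
have He2 : eps * (PI * B) <= 1.
  have : eps <= / (PI * B) by apply: Rmin_r.
  move=> /(Rmult_le_compat_r (PI * B) _ _ (Rlt_le _ _ HPB)); rewrite Rinv_l; lra.
pose f z := (G z * weight n z)%C.
have Hf z : S z -> holo_at f z.
  by move=> Hz; apply: holo_mult; [apply: HG|apply: holo_weight].
have Cf z : S z -> cont_at f z by move=> Hz; apply: holo_cont; apply: Hf.
have GM z : S z -> Cmod (G z) <= M + 1.
  by move=> Hz; move: (AG z Hz) (HM z Hz) (Cmod_le_sub (G z) (F z)); lra.
have Z := Goursat f _ _ _ Hf; rewrite /contour in Z.
case: (pgram_corners (0, - (PI / 2)) L (0, PI)) => c1 [c2 [c3 c4]].
have Cs a b : S a -> S b -> cont_on_seg f a b by move=> Ha Hb; apply: (pgram_seg f _ _ _ a b Cf).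
set p := (0, - (PI / 2)) : C in Z c1 c2 c3 c4.
(* the horizontal sides, where the weight has modulus 1 *)
have Hbot : Cmod (seg f p (p + L)) <= (M + 1) * L.
  have E : Cmod (p + L - p)%C = L.
    replace (p + L - p)%C with (RtoC L) by ring. by rewrite Cmod_R Rabs_pos_eq //; lra.
  rewrite -[X in _ <= _ * X]E; apply: seg_bound; first by apply: Cs.
  move=> t Ht; rewrite Cmod_mult.
  have -> : line p (p + L) t = (t * L, - (PI / 2)).
    by rewrite /line /p; apply: injective_projections => /=; ring.
  rewrite Cmod_weight cos_neg cos_PI2 !Rmult_0_r exp_0 Rmult_1_r.
  by apply: GM; apply: SE; nra.
have Htop : Cmod (seg f (p + L + (0, PI)) (p + (0, PI))) <= (M + 1) * L.
  have E : Cmod (p + (0, PI) - (p + L + (0, PI)))%C = L.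
    replace (p + (0, PI) - (p + L + (0, PI)))%C with (RtoC (- L)) by (rewrite RtoC_opp; ring).
    by rewrite Cmod_R Rabs_Ropp Rabs_pos_eq //; lra.
  rewrite -[X in _ <= _ * X]E; apply: seg_bound; first by apply: Cs.
  move=> t Ht; rewrite Cmod_mult.
  have -> : line (p + L + (0, PI)) (p + (0, PI)) t = ((1 - t) * L, PI / 2).
    by rewrite /line /p; apply: injective_projections => /=; field.
  rewrite Cmod_weight cos_PI2 !Rmult_0_r exp_0 Rmult_1_r.
  by apply: GM; apply: SE; nra.
(* the right side, where [G] is within [eps] of 0 and [B] bounds the weight *)
have Hright : Cmod (seg f (p + L) (p + L + (0, PI))) <= 1.
  apply: Rle_trans He2; have -> : eps * (PI * B) = (eps * B) * PI by ring.
  have E : Cmod (p + L + (0, PI) - (p + L))%C = PI.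
    have -> : (p + L + (0, PI) - (p + L))%C = (0, PI).
      by apply: injective_projections => /=; ring.
    rewrite /Cmod /=; have -> : 0 * (0 * 1) + PI * (PI * 1) = Rsqr PI by rewrite /Rsqr; ring.
    by rewrite sqrt_Rsqr //; lra.
  rewrite -[X in _ <= _ * X]E; apply: seg_bound; first by apply: Cs.
  move=> t Ht; rewrite Cmod_mult.
  have -> : line (p + L) (p + L + (0, PI)) t = (L, - (PI / 2) + t * PI).
    by rewrite /line /p; apply: injective_projections => /=; ring.
  set y := - (PI / 2) + t * PI.
  have Hy : - (PI / 2) <= y <= PI / 2 by rewrite /y; nra.
  have := AG (L, y) (SE L y ltac:(lra) Hy); rewrite F0 //.
  replace (G (L, y) - 0)%C with (G (L, y)) by ring.
  move=> H1; apply: Rmult_le_compat => //; try exact: Cmod_ge_0.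
  rewrite Cmod_weight /B.
  have : n * ((exp L + exp (- L)) / 2 * cos y) <= n * exp L.
    apply: Rmult_le_compat_l => //.
    have E1 : exp (- L) < exp L by apply: exp_increasing; lra.
    have := exp_pos L; have := exp_pos (- L); case: (COS_bound y); nra.
  by case=> [/exp_increasing|->]; lra.
have Cleft := Cs (p + (0, PI))%C p c4 c1.
have Hleft : Cmod (seg f (p + (0, PI)) p) <= 2 * ((M + 1) * L) + 1.
  have -> : seg f (p + (0, PI)) p = (- (seg f p (p + L) + seg f (p + L) (p + L + (0, PI)) +
      seg f (p + L + (0, PI)) (p + (0, PI))))%C.
    move: Z; set a := seg f p _; set b := seg f (p + L) _; set c := seg f (p + L + _) _.
    move=> Z; rewrite -[seg _ _ _]Cplus_0_l -{1}(Cplus_opp_r (a + b + c)%C).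
    transitivity ((a + b + c + seg f (p + (0, PI)) p) + - (a + b + c))%C; first by ring.
    by rewrite Z; ring.
  rewrite Cmod_opp; apply: Rle_trans (Cmod_triangle _ _) _.
  apply: Rle_trans (Rplus_le_compat_r _ _ _ (Cmod_triangle _ _)) _; lra.
have Hint := is_seg _ _ _ Cleft.
have Him := is_RInt_fct_extend_snd (U := R_NormedModule) (V := R_NormedModule) _ _ _ _ Hint.
pose th t := PI / 2 - t * PI.
pose Phi t := PI / 4 * t - n / 4 * sin (th t) - 1 / 4 * (sin (th t) * exp (n * cos (th t))).
pose phi t := PI / 4 + n / 4 * (PI * cos (th t)) +
   PI / 4 * ((cos (th t) - n * sin (th t) ^ 2) * exp (n * cos (th t))).
(* [phi = Phi'] is the lower bound for the integrand on the left side *)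
have Hphi : is_RInt (V := R_NormedModule) phi 0 1 (Phi 1 - Phi 0).
  apply: (is_RInt_derive (V := R_CompleteNormedModule) Phi) => x _.
    rewrite /Phi /phi /th; auto_derive => //; rewrite -/(Rminus (PI / 2) (x * PI)); field.
  apply: (ex_derive_continuous (V := R_NormedModule)); by rewrite /phi /th; auto_derive.
have Hle : Phi 1 - Phi 0 <= - snd (seg f (p + (0, PI)) p).
  apply: (is_RInt_le phi _ 0 1 _ _ Rle_0_1 Hphi (is_RInt_opp (V := R_NormedModule) _ _ _ _ Him)).
  move=> t Ht.
  have -> : line (p + (0, PI)) p t = (0, th t).
    by rewrite /line /p /th; apply: injective_projections => /=; field.
  have Hth : - (PI / 2) <= th t <= PI / 2 by rewrite /th; nra.
  have E (w : C) (e : R) : - snd (w * RtoC e * (p - (p + (0, PI))))%C = PI * (Re w * e).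
    by rewrite /p /Re /=; field.
  rewrite /f weight_imag.
  change (phi t <= - snd (G (0, th t) * RtoC (exp (n * cos (th t))) * (p - (p + (0, PI))))%C).
  rewrite E.
  have Hc : 0 <= cos (th t) by apply: cos_ge_0; lra.
  have Hex := exp_ineq1_le (n * cos (th t)); have Hexp := exp_pos (n * cos (th t)).
  have HGl : 1 / 2 - n / 4 * sin (th t) ^ 2 <= Re (G (0, th t)).
    have H1 := Hlow _ Hth; have H2 := AG (0, th t) (SE 0 (th t) ltac:(lra) Hth).
    have := Cmod_Re_le (G (0, th t) - F (0, th t))%C.
    have -> : Re (G (0, th t) - F (0, th t))%C = Re (G (0, th t)) - Re (F (0, th t)) by [].
    move=> H3; have : Rabs (Re (G (0, th t)) - Re (F (0, th t))) <= 1 / 8 by lra.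
    move=> /Rabs_le_between H4; have := pow2_ge_0 (sin (th t)) => H5.
    have : K * sin (th t) ^ 2 <= n / 4 * sin (th t) ^ 2 by apply: Rmult_le_compat_r => //; rewrite /n; nra.
    lra.
  rewrite /phi; have Hc1 := COS_bound (th t).
  have Q : 1 / 4 + n / 4 * cos (th t) + 1 / 4 * ((cos (th t) - n * sin (th t) ^ 2) * exp (n * cos (th t)))
      <= Re (G (0, th t)) * exp (n * cos (th t)).
    apply: Rle_trans (Rmult_le_compat_r _ _ _ (Rlt_le _ _ Hexp) HGl).
    move: Hex Hexp; set ex := exp _; set c := cos _ in Hc Hc1 *; set s := sin _ ^ 2; nra.
  apply: Rle_trans (Rmult_le_compat_l PI _ _ (Rlt_le _ _ Pi) Q); right; field.
have Hb : - snd (seg f (p + (0, PI)) p) <= Cmod (seg f (p + (0, PI)) p).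
  apply: Rle_trans (Rle_abs _) _; rewrite Rabs_Ropp; exact (Cmod_Im_le (seg f (p + (0, PI)) p)).
have E1 : th 1 = - (PI / 2) by rewrite /th; field.
have E0 : th 0 = PI / 2 by rewrite /th; field.
rewrite /Phi E1 E0 sin_neg sin_PI2 cos_neg cos_PI2 Rmult_0_r exp_0 in Hle.
rewrite /n in Hle; nra.
Qed.

(** Scaled form of the preceding lemma: the rectangle starts at [p], extends in the
    direction [c], and may be arbitrarily long compared with its width. *)
Lemma identity_rectangle (F : C -> C) (p c : C) (L : R) : 0 < L ->
  approx_holo F (fun z => exists x y, 0 <= x <= L /\ -1 <= y <= 1 /\ z = (p + c * (x, y))%C) ->
  (forall y, -1 <= y <= 1 -> F (p + c * (L, y))%C = 0%C) -> F p = 0%C.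
Proof.
move=> HL HF H0; apply: NNPP => Hp.
have Pi := PI_RGT_0.
(* from the width pi of [no_holomorphic_bump] to the width 2 of the rectangle *)
set k := 2 / PI.
have Hk : 0 < k by apply: Rdiv_lt_0_compat; lra.
have kP : k * (PI / 2) = 1 by rewrite /k; field; lra.
have Hmod : 0 < Cmod (F p) by apply/Cmod_gt_0.
pose phi z := (p + c * (k * z))%C.
have hphi z : holo_at phi z.
  apply: holo_plus; first exact: holo_const.
  apply: holo_mult; first exact: holo_const.
  by apply: holo_mult; [apply: holo_const|apply: holo_id].
apply: (no_holomorphic_bump (fun z => F (phi z) / F p)%C (L / k)).
- exact: Rdiv_lt_0_compat.
- move=> eps He; have He' : 0 < eps * Cmod (F p) by apply: Rmult_lt_0_compat.
  have [G [HG AG]] := HF _ He'.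
  have Hin z : pgram (0, - (PI / 2)) (RtoC (L / k)) (0, PI) z ->
     exists x y, 0 <= x <= L /\ -1 <= y <= 1 /\ phi z = (p + c * (x, y))%C.
    move=> [X [Y [HX [HY ->]]]]; exists (X * L), (-1 + 2 * Y); split; first by nra.
    split; first by nra.
    rewrite /phi; congr (_ + _ * _)%C.
    by apply: injective_projections => /=; rewrite /k; field; lra.
  exists (fun z => G (phi z) / F p)%C; split.
    move=> z Hz; apply: holo_mult; last exact: holo_const.
    by apply: (holo_comp G) => //; apply: HG; apply: Hin.
  move=> z Hz.
  have -> : (G (phi z) / F p - F (phi z) / F p = (G (phi z) - F (phi z)) / F p)%C by field.
  rewrite Cmod_div //.
  apply/Rle_div_l => //; apply: AG; exact: Hin.
- move=> y Hy; have -> : phi (L / k, y) = (p + c * (L, (k * y)%R))%C.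
    rewrite /phi; congr (_ + _ * _)%C.
    by apply: injective_projections => /=; rewrite /k; field; lra.
  rewrite H0; last by nra.
  by field.
- have -> : phi 0%C = p by rewrite /phi; ring.
  by field.
Qed.

(** * Limits and finite sums *)

Definition Ccvg (u : nat -> C) (l : C) : Prop := is_lim_seq (fun n => Cmod (u n - l)) 0.

Lemma Ccvg_bound u l (e : nat -> R) : is_lim_seq e 0 ->
  (forall n, Cmod (u n - l) <= e n) -> Ccvg u l.
Proof.
move=> He H; apply: (is_lim_seq_le_le (fun _ => 0)) He; last exact: is_lim_seq_const.
by move=> n; split; [apply: Cmod_ge_0|apply: H].
Qed.

Lemma Ccvg_ext u v l : (forall n, u n = v n) -> Ccvg u l -> Ccvg v l.
Proof. by move=> E; apply: is_lim_seq_ext => n; rewrite E. Qed.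

Lemma Ccvg_const c : Ccvg (fun _ => c) c.
Proof.
apply: (is_lim_seq_ext (fun _ => 0)); last exact: is_lim_seq_const.
by move=> n; replace (c - c)%C with (RtoC 0) by ring; rewrite Cmod_0.
Qed.

Lemma is_lim_seq_0_plus u v : is_lim_seq u 0 -> is_lim_seq v 0 ->
  is_lim_seq (fun n => u n + v n) 0.
Proof.
by move=> Hu Hv; have := is_lim_seq_plus' _ _ _ _ Hu Hv; rewrite Rplus_0_r.
Qed.

Lemma lim_scal (c : R) (u : nat -> R) (l : R) :
  is_lim_seq u l -> is_lim_seq (fun n => c * u n) (c * l).
Proof. by move=> H; apply: (is_lim_seq_scal_l u c l). Qed.

Lemma Ccvg_plus u v l m : Ccvg u l -> Ccvg v m -> Ccvg (fun n => u n + v n)%C (l + m)%C.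
Proof.
move=> Hu Hv; apply: Ccvg_bound (is_lim_seq_0_plus _ _ Hu Hv) _ => n.
replace (u n + v n - (l + m))%C with ((u n - l) + (v n - m))%C by ring.
exact: Cmod_triangle.
Qed.

Lemma Ccvg_scal c u l : Ccvg u l -> Ccvg (fun n => c * u n)%C (c * l)%C.
Proof.
move=> Hu; have H := is_lim_seq_scal_l _ (Cmod c) _ Hu.
rewrite /= Rmult_0_r in H; apply: Ccvg_bound H _ => n.
by rewrite -Cmod_mult; right; congr Cmod; ring.
Qed.

Lemma Ccvg_opp u l : Ccvg u l -> Ccvg (fun n => - u n)%C (- l)%C.
Proof.
move=> H; have := Ccvg_scal (- (1))%C _ _ H.
replace (- (1) * l)%C with (- l)%C by ring.
by apply: Ccvg_ext => n; ring.
Qed.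

Lemma Ccvg_minus u v l m : Ccvg u l -> Ccvg v m -> Ccvg (fun n => u n - v n)%C (l - m)%C.
Proof. by move=> Hu Hv; apply: Ccvg_plus => //; apply: Ccvg_opp. Qed.

Lemma Ccvg_le u l M : Ccvg u l -> (forall n, Cmod (u n) <= M) -> Cmod l <= M.
Proof.
move=> Hu HM.
suff : Rbar_le (Cmod l - M) 0 by move=> /=; lra.
apply: (is_lim_seq_le (fun _ => Cmod l - M)) Hu; last exact: is_lim_seq_const.
by move=> n; move: (HM n) (Cmod_le_sub l (u n)); rewrite Cmod_sub_sym; lra.
Qed.

Lemma Ccvg_unique u l m : Ccvg u l -> Ccvg u m -> l = m.
Proof.
move=> Hl Hm; have H := Ccvg_minus _ _ _ _ Hl Hm.
have : Cmod (l - m) <= 0.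
  apply: Ccvg_le H _ => n; replace (u n - u n)%C with (RtoC 0) by ring.
  by rewrite Cmod_0; lra.
move=> H0; have E : (l - m)%C = 0%C by apply: Cmod_eq_0; move: (Cmod_ge_0 (l - m)); lra.
by replace l with ((l - m) + m)%C by ring; rewrite E; ring.
Qed.

Lemma Ccvg_subseq u l (phi : nat -> nat) : (forall n, (n <= phi n)%nat) ->
  Ccvg u l -> Ccvg (fun n => u (phi n)) l.
Proof.
move=> Hphi Hu; apply: (is_lim_seq_subseq (fun n => Cmod (u n - l))) => //.
move=> P [N HN]; exists N => n Hn; apply: HN; exact: Nat.le_trans Hn (Hphi n).
Qed.

(** A total limit operator, meaningful for convergent sequences only. *)
Definition Clim (u : nat -> C) : C :=
  (real (Lim_seq (fun n => Re (u n))), real (Lim_seq (fun n => Im (u n)))).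

Lemma Cauchy_lim (u e : nat -> R) : is_lim_seq e 0 ->
  (forall n m, (n <= m)%nat -> Rabs (u m - u n) <= e n) ->
  is_lim_seq u (real (Lim_seq u)).
Proof.
move=> He H; apply: Lim_seq_correct'; apply/ex_lim_seq_cauchy_corr => eps.
have Heps : 0 < eps / 2 by move: (cond_pos eps); lra.
have [N HN] : exists N, forall n, (N <= n)%nat -> Rabs (e n) < eps / 2.
  have [N HN] := proj2 (is_lim_seq_spec _ _) He (mkposreal _ Heps).
  by exists N => n Hn; have := HN n Hn; rewrite /= Rminus_0_r.
exists N => n m Hn Hm.
have H1 := H N n Hn; have H2 := H N m Hm; have H3 := HN N (le_n _).
have T : Rabs (u n - u m) <= Rabs (u n - u N) + Rabs (u m - u N).
  have -> : u n - u m = (u n - u N) - (u m - u N) by ring.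
  by apply: Rle_trans (Rabs_triang _ _) _; rewrite Rabs_Ropp; lra.
have := Rle_abs (e N); lra.
Qed.

(** The explicit rate [e] is kept in the conclusion because uniform convergence on
    compact sets is read off from it. *)
Lemma Clim_Cauchy (u : nat -> C) (e : nat -> R) : is_lim_seq e 0 ->
  (forall n m, (n <= m)%nat -> Cmod (u m - u n) <= e n) ->
  Ccvg u (Clim u) /\ forall n, Cmod (u n - Clim u) <= e n.
Proof.
move=> He H.
have Hr : is_lim_seq (fun n => Re (u n)) (Re (Clim u)).
  by apply: (Cauchy_lim _ e) => // n m Hn; apply: Rle_trans (Cmod_Re_le (u m - u n)%C) (H _ _ Hn).
have Hi : is_lim_seq (fun n => Im (u n)) (Im (Clim u)).
  by apply: (Cauchy_lim _ e) => // n m Hn; apply: Rle_trans (Cmod_Im_le (u m - u n)%C) (H _ _ Hn).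
have Hc : Ccvg u (Clim u).
  have A w l : is_lim_seq w (Finite l) -> is_lim_seq (fun n => Rabs (w n - l)) 0.
    move=> Hw; have := is_lim_seq_minus' _ _ _ _ Hw (is_lim_seq_const l).
    by rewrite Rminus_diag => /is_lim_seq_abs /=; rewrite Rabs_R0.
  apply: Ccvg_bound (is_lim_seq_0_plus _ _ (A _ _ Hr) (A _ _ Hi)) _ => n.
  exact: Cmod_le_ReIm.
split=> // n.
apply: (Ccvg_le (fun m => u n - u (n + m)%nat)%C).
  apply: Ccvg_minus; first exact: Ccvg_const.
  by apply: (Ccvg_subseq u _ (fun m => (n + m)%nat)) => // m; lia.
by move=> m; rewrite Cmod_sub_sym; apply: H; lia.
Qed.

Lemma Ccvg_real (u : nat -> R) (l : C) : Ccvg (fun n => RtoC (u n)) l ->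
  l = RtoC (Re l) /\ is_lim_seq u (Re l).
Proof.
move=> H.
have HR : is_lim_seq u (Re l).
  apply/is_lim_seq_spec => eps; have [N HN] := proj2 (is_lim_seq_spec _ _) H eps.
  exists N => n Hn; have {}HN := HN n Hn; rewrite Rminus_0_r Rabs_pos_eq in HN; last exact: Cmod_ge_0.
  by apply: Rle_lt_trans (Cmod_Re_le (RtoC (u n) - l)%C) HN.
split=> //; apply: Ccvg_unique H _.
apply: (is_lim_seq_ext (fun n => Rabs (u n - Re l))).
  by move=> n; rewrite -RtoC_minus Cmod_R.
have := is_lim_seq_minus' _ _ _ _ HR (is_lim_seq_const (Re l)).
by rewrite Rminus_diag => /is_lim_seq_abs /=; rewrite Rabs_R0.
Qed.

Fixpoint Csum (f : nat -> C) (n : nat) : C :=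
  match n with 0%nat => 0%C | S m => (Csum f m + f m)%C end.

Lemma Csum_ext f g n : (forall i, (i < n)%nat -> f i = g i) -> Csum f n = Csum g n.
Proof.
elim: n => [//|n IH] H /=; rewrite IH ?H //; try lia.
by move=> i Hi; apply: H; lia.
Qed.

Fixpoint Rsum (f : nat -> R) (n : nat) : R :=
  match n with 0%nat => 0 | S m => Rsum f m + f m end.

Lemma Rsum_ext f g n : (forall i, (i < n)%nat -> f i = g i) -> Rsum f n = Rsum g n.
Proof.
elim: n => [//|n IH] H; cbn [Rsum]; rewrite IH ?H //; try lia.
by move=> i Hi; apply: H; lia.
Qed.

Lemma Rsum_plus f g n : Rsum (fun i => f i + g i) n = Rsum f n + Rsum g n.
Proof. by elim: n => [|n IH]; cbn [Rsum]; [ring|rewrite IH; ring]. Qed.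

Lemma Rsum_scal c f n : Rsum (fun i => c * f i) n = c * Rsum f n.
Proof. by elim: n => [|n IH]; cbn [Rsum]; [ring|rewrite IH; ring]. Qed.

Lemma Rsum_0 n : Rsum (fun _ => 0) n = 0.
Proof. by elim: n => [|n IH] //; cbn [Rsum]; rewrite IH; ring. Qed.

Lemma Rsum_swap (f : nat -> nat -> R) a b :
  Rsum (fun i => Rsum (fun j => f i j) b) a = Rsum (fun j => Rsum (fun i => f i j) a) b.
Proof.
elim: a => [|a IH]; cbn [Rsum]; first by rewrite Rsum_0.
by rewrite IH Rsum_plus.
Qed.

Lemma Rsum_app f a b : Rsum f (a + b) = Rsum f a + Rsum (fun i => f (a + i)%nat) b.
Proof.
elim: b => [|b IH]; cbn [Rsum]; first by rewrite Nat.add_0_r; ring.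
by rewrite -plus_n_Sm; cbn [Rsum]; rewrite IH; ring.
Qed.

Lemma Rsum_rev f n : Rsum (fun i => f (n - 1 - i)%nat) n = Rsum f n.
Proof.
elim: n f => [//|n IH] f.
transitivity (f n + Rsum (fun i => f (n - 1 - i)%nat) n); last by rewrite IH; cbn [Rsum]; ring.
etransitivity; first exact: (Rsum_app (fun i => f (S n - 1 - i)%nat) 1 n).
cbn [Rsum]; rewrite Rplus_0_l; congr Rplus; first by congr f; lia.
by apply: Rsum_ext => i Hi; congr f; lia.
Qed.

Lemma Rsum_multiples f N m : (1 <= N)%nat -> (forall j, ~ Nat.divide N j -> f j = 0) ->
  Rsum f (m * N) = Rsum (fun n => f (n * N)%nat) m.
Proof.
move=> HN Hf; elim: m => [//|m IH]; cbn [Rsum].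
have -> : (S m * N = m * N + S (N - 1))%nat by lia.
rewrite Rsum_app IH; congr Rplus.
have -> : S (N - 1) = (1 + (N - 1))%nat by lia.
rewrite Rsum_app; cbn [Rsum]; rewrite Nat.add_0_r.
rewrite (Rsum_ext _ (fun _ => 0)) ?Rsum_0; first by ring.
move=> i Hi; apply: Hf => - [k Hk].
case: (Nat.le_gt_cases k m) => H.
  by have := Nat.mul_le_mono_r k m N H; lia.
by have := Nat.mul_le_mono_r (S m) k N ltac:(lia); lia.
Qed.

Lemma Cmod_Csum_le f g n : (forall i, (i < n)%nat -> Cmod (f i) <= g i) ->
  Cmod (Csum f n) <= Rsum g n.
Proof.
elim: n => [|n IH] H /=; first by rewrite Cmod_0; lra.
apply: Rle_trans (Cmod_triangle _ _) _; apply: Rplus_le_compat; last by apply: H; lia.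
by apply: IH => i Hi; apply: H; lia.
Qed.

Lemma Csum_shift f n k : (Csum f (n + k) - Csum f n)%C = Csum (fun i => f (n + i)%nat) k.
Proof.
elim: k => [|k IH] /=; first by rewrite Nat.add_0_r; ring.
by rewrite -plus_n_Sm /= -IH; ring.
Qed.

Lemma Csum_app f a b : Csum f (a + b) = (Csum f a + Csum (fun i => f (a + i)%nat) b)%C.
Proof. rewrite -Csum_shift; ring. Qed.

Lemma Csum_scal c f n : Csum (fun i => c * f i)%C n = (c * Csum f n)%C.
Proof. by elim: n => [|n IH] /=; [ring|rewrite IH; ring]. Qed.

Lemma Csum_plus f g n : Csum (fun i => f i + g i)%C n = (Csum f n + Csum g n)%C.
Proof. by elim: n => [|n IH] /=; [ring|rewrite IH; ring]. Qed.

Lemma Csum_0 n : Csum (fun _ => 0%C) n = 0%C.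
Proof. by elim: n => [|n IH] //=; rewrite IH; ring. Qed.

Lemma Csum_swap (f : nat -> nat -> C) a b :
  Csum (fun i => Csum (fun j => f i j) b) a = Csum (fun j => Csum (fun i => f i j) a) b.
Proof.
elim: a => [|a IH] /=; first by rewrite Csum_0.
by rewrite IH Csum_plus.
Qed.

Lemma RtoC_Rsum f n : RtoC (Rsum f n) = Csum (fun i => RtoC (f i)) n.
Proof. by elim: n => [|n IH] //=; rewrite RtoC_plus IH. Qed.

Lemma is_lim_Rsum (u : nat -> nat -> R) (l : nat -> R) n :
  (forall i, (i < n)%nat -> is_lim_seq (fun p => u p i) (l i)) ->
  is_lim_seq (fun p => Rsum (u p) n) (Rsum l n).
Proof.
elim: n => [|n IH] H; cbn [Rsum]; first exact: is_lim_seq_const.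
apply: is_lim_seq_plus'; last by apply: H; lia.
by apply: IH => i Hi; apply: H; lia.
Qed.

Lemma Ccvg_Csum (u : nat -> nat -> C) (l : nat -> C) n :
  (forall i, (i < n)%nat -> Ccvg (fun J => u J i) (l i)) ->
  Ccvg (fun J => Csum (u J) n) (Csum l n).
Proof.
elim: n => [|n IH] H /=; first exact: Ccvg_const.
by apply: Ccvg_plus; [apply: IH => i Hi; apply: H; lia|apply: H; lia].
Qed.

Lemma is_series_Ccvg (f : nat -> C) l : is_series (V := C_NormedModule) f l -> Ccvg (Csum f) l.
Proof.
move=> H; apply/is_lim_seq_incr_1.
have E n : sum_n (G := C_AbelianMonoid) f n = Csum f (S n).
  elim: n => [|n IH]; first by rewrite sum_O /= Cplus_0_l.
  by rewrite sum_Sn IH.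
apply/is_lim_seq_spec => eps.
have Hs : 0 < eps by apply: cond_pos.
have := proj1 (filterlim_locally_ball_norm _ _) H eps.
move=> [N HN]; exists N => n Hn; have := HN n Hn.
rewrite /ball_norm E Rminus_0_r Rabs_pos_eq; last exact: Cmod_ge_0.
by [].
Qed.

(** * Powers of integers and the alternating zeta function *)

(** [n^(-s)], with the exponential of the statement. *)
Definition npow (n : nat) (s : C) : C := Cexp (- s * RtoC (ln (INR n))).

Lemma INR_S_pos n : 0 < INR (S n).
Proof. by apply: lt_0_INR; lia. Qed.

Lemma inv_lim : is_lim_seq (fun n => / INR (S n)) 0.
Proof.
have -> : Finite 0 = Rbar_inv p_infty by [].
apply: is_lim_seq_inv => //.
exact: (proj1 (is_lim_seq_incr_1 INR p_infty) is_lim_seq_INR).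
Qed.

Lemma npow_1 s : npow 1 s = 1%C.
Proof. by rewrite /npow /= ln_1 Cmult_0_r Cexp_0. Qed.

Lemma npow_mult a b s : (0 < a)%nat -> (0 < b)%nat ->
  npow (a * b) s = (npow a s * npow b s)%C.
Proof.
move=> Ha Hb; rewrite /npow mult_INR ln_mult; try (by apply: lt_0_INR).
by rewrite -Cexp_plus RtoC_plus; congr Cexp; ring.
Qed.

Lemma npow_plus n s t : npow n (s + t) = (npow n s * npow n t)%C.
Proof. rewrite /npow -Cexp_plus; congr Cexp; ring. Qed.

Lemma npow_real n x : npow n (RtoC x) = RtoC (Rpower (INR n) (- x)).
Proof.
rewrite /npow /Rpower -Cexp_RtoC; congr Cexp.
rewrite RtoC_mult RtoC_opp; ring.
Qed.

Lemma Cmod_npow n s : Cmod (npow n s) = Rpower (INR n) (- Re s).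
Proof. rewrite /npow Cmod_Cexp /Rpower; congr exp; rewrite /Re /=; ring. Qed.

Lemma holo_npow n s : holo_at (npow n) s.
Proof.
apply: (holo_comp Cexp); first exact: holo_Cexp.
apply: holo_mult; last exact: holo_const.
by apply: holo_opp; apply: holo_id.
Qed.

Lemma ln_succ_bounds n : / INR (S (S n)) <= ln (INR (S (S n))) - ln (INR (S n)) <= / INR (S n).
Proof.
have Hp := INR_S_pos n; have Hq := INR_S_pos (S n).
have E : INR (S (S n)) = INR (S n) + 1 by rewrite (S_INR (S n)).
have B x : 0 < x -> ln x <= x - 1.
  move=> Hx; have := exp_ineq1_le (ln x); rewrite exp_ln //; lra.
split.
  have := B (INR (S n) / INR (S (S n))) (Rdiv_lt_0_compat _ _ Hp Hq).
  rewrite ln_div // E => H.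
  have : INR (S n) / (INR (S n) + 1) - 1 = - / (INR (S n) + 1) by field; lra.
  lra.
have := B (INR (S (S n)) / INR (S n)) (Rdiv_lt_0_compat _ _ Hq Hp).
rewrite ln_div // E => H.
have : (INR (S n) + 1) / INR (S n) - 1 = / INR (S n) by field; lra.
lra.
Qed.

Lemma Rpower_minus_1 x a : 0 < x -> Rpower x (a - 1) = Rpower x a * / x.
Proof. by move=> Hx; rewrite Rpower_plus Rpower_Ropp Rpower_1. Qed.

(** Comparison of [sum m^(-d-1)] with a telescoping sum, from [exp x >= 1 + x] and [ln
    ((m+1)/m) >= 1/(m+1)]. *)
Lemma Rpower_telescope d n : 0 < d ->
  d * Rpower (INR (S (S n))) (- d - 1) <= Rpower (INR (S n)) (- d) - Rpower (INR (S (S n))) (- d).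
Proof.
move=> Hd; have [H _] := ln_succ_bounds n; have Hq := INR_S_pos (S n).
have -> : Rpower (INR (S (S n))) (- d - 1) = Rpower (INR (S (S n))) (- d) * / INR (S (S n)).
  exact: Rpower_minus_1.
have -> : Rpower (INR (S n)) (- d) = Rpower (INR (S (S n))) (- d) *
      exp (d * (ln (INR (S (S n))) - ln (INR (S n)))).
  rewrite /Rpower -exp_plus; congr exp; ring.
have := exp_ineq1_le (d * (ln (INR (S (S n))) - ln (INR (S n)))).
have P : 0 < Rpower (INR (S (S n))) (- d) by apply: exp_pos.
set e := exp _; set r := Rpower _ _ in P *; set i := / _ in H *; set L := _ - _ in H * => He.
have : d * i <= d * L by apply: Rmult_le_compat_l; lra.
nra.
Qed.

Lemma Rpower_tail d a k : 0 < d ->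
  Rsum (fun i => Rpower (INR (S (S (a + i)))) (- d - 1)) k <= Rpower (INR (S a)) (- d) / d.
Proof.
move=> Hd; apply/Rle_div_r => //.
suff : Rsum (fun i => Rpower (INR (S (S (a + i)))) (- d - 1)) k * d <=
   Rpower (INR (S a)) (- d) - Rpower (INR (S (a + k))) (- d).
  by move=> H; apply: Rle_trans H _; have P : 0 < Rpower (INR (S (a + k))) (- d); [exact: exp_pos|lra].
elim: k => [|k IH]; cbn [Rsum]; first by rewrite Nat.add_0_r; lra.
have := Rpower_telescope d (a + k) Hd; rewrite -!plus_n_Sm; lra.
Qed.

Lemma Rpower_incr_base x y a : 0 < x -> x <= y -> 0 <= a -> Rpower y (- a) <= Rpower x (- a).
Proof.
move=> Hx Hxy Ha; rewrite /Rpower.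
have : ln x <= ln y by apply: ln_le.
move=> H; have : - a * ln y <= - a * ln x by nra.
by case=> [/exp_increasing|->]; lra.
Qed.

(** [m^(-s) - (m+1)^(-s)] is the integral of [s exp (-s u)] for u from [ln m] to [ln
    (m+1)], an interval of length at most 1/m. *)
Lemma npow_diff_bound n s : 0 <= Re s ->
  Cmod (npow (S n) s - npow (S (S n)) s) <= Cmod s * Rpower (INR (S n)) (- Re s - 1).
Proof.
move=> Hs; have [H1 H2] := ln_succ_bounds n; have Hp := INR_S_pos n.
have Hp2 := INR_S_pos (S n).
set L := ln (INR (S (S n))) - ln (INR (S n)) in H1 H2.
have HL : 0 <= L by move: (Rinv_0_lt_compat _ Hp2); lra.
have E : (- s * RtoC (ln (INR (S n))) = - s * RtoC (ln (INR (S (S n)))) + s * RtoC L)%C.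
  rewrite /L RtoC_minus; ring.
rewrite /npow {1}E.
apply: Rle_trans (Cexp_diff_bound _ _ (- Re s * ln (INR (S n))) _ _) _.
- have -> : Re (- s * RtoC (ln (INR (S (S n)))))%C = - Re s * ln (INR (S (S n))).
    by rewrite /Re /=; ring.
  have : ln (INR (S n)) <= ln (INR (S (S n))) by rewrite /L in HL; lra.
  nra.
- rewrite -E; right; rewrite /Re /=; ring.
rewrite Cmod_mult Cmod_R Rabs_pos_eq // Rmult_assoc.
apply: Rmult_le_compat_l; first exact: Cmod_ge_0.
rewrite Rpower_minus_1 // Rmult_comm.
apply: Rmult_le_compat_l H2; exact: Rlt_le (exp_pos _).
Qed.

(** Partial sums of [1 - 2^(-s) + 3^(-s) - ...] by pairs, which converge for [Re s >
    0]. *)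
Definition eta_part (M : nat) (s : C) : C :=
  Csum (fun j => npow (2 * j + 1) s - npow (2 * j + 2) s)%C M.

Definition eta (s : C) : C := Clim (fun M => eta_part M s).

Lemma eta_part_Cauchy s n m : 0 < Re s -> (n <= m)%nat ->
  Cmod (eta_part (S m) s - eta_part (S n) s) <= Cmod s * (Rpower (INR (S n)) (- Re s) / Re s).
Proof.
move=> Hs Hnm; have -> : S m = (S n + (m - n))%nat by lia.
rewrite /eta_part Csum_shift.
apply: Rle_trans (Cmod_Csum_le _ (fun i => Cmod s * Rpower (INR (S (S (n + i)))) (- Re s - 1)) _ _) _.
  move=> i _.
  have -> : (2 * (S n + i) + 2 = S (2 * (S n + i) + 1))%nat by lia.
  have -> : (2 * (S n + i) + 1 = S (2 * (S n + i)))%nat by lia.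
  apply: Rle_trans (npow_diff_bound _ _ (Rlt_le _ _ Hs)) _.
  apply: Rmult_le_compat_l; first exact: Cmod_ge_0.
  have -> : - Re s - 1 = - (Re s + 1) by ring.
  apply: Rpower_incr_base; [exact: INR_S_pos| |lra].
  by apply: le_INR; lia.
have -> k : Rsum (fun i => Cmod s * Rpower (INR (S (S (n + i)))) (- Re s - 1)) k =
   Cmod s * Rsum (fun i => Rpower (INR (S (S (n + i)))) (- Re s - 1)) k.
  by elim: k => [|k IH]; cbn [Rsum]; [ring|rewrite IH; ring].
by apply: Rmult_le_compat_l; [exact: Cmod_ge_0|exact: Rpower_tail].
Qed.

Lemma Rpower_lim_0 d : 0 < d -> is_lim_seq (fun n => Rpower (INR (S n)) (- d)) 0.
Proof.
move=> Hd.
apply: (is_lim_seq_le_le (fun _ => 0) _ (fun n => / (1 + d * ln (INR (S n))))).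
- move=> n; split; first exact: Rlt_le (exp_pos _).
  rewrite Rpower_Ropp.
  have Hl : 0 <= ln (INR (S n)).
    by rewrite -ln_1; apply: ln_le; [lra|rewrite S_INR; move: (pos_INR n); lra].
  apply: Rinv_le_contravar; first by nra.
  rewrite /Rpower; exact: exp_ineq1_le.
- exact: is_lim_seq_const.
- have -> : Finite 0 = Rbar_inv p_infty by [].
  apply: is_lim_seq_inv => //.
  apply: (is_lim_seq_plus _ _ 1 p_infty) => //; first exact: is_lim_seq_const.
  have -> : p_infty = Rbar_mult d p_infty.
    by rewrite /= ; case: Rle_dec => [H|]; [case: Rle_lt_or_eq_dec => //|]; lra.
  apply: is_lim_seq_scal_l.
  apply: (is_lim_comp_seq ln _ p_infty p_infty); first exact: is_lim_ln_p.
    by exists 0%nat.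
  exact: (proj1 (is_lim_seq_incr_1 INR p_infty) is_lim_seq_INR).
Qed.

Lemma eta_spec s : 0 < Re s -> Ccvg (fun M => eta_part M s) (eta s) /\
  forall n, Cmod (eta_part (S n) s - eta s) <= Cmod s * (Rpower (INR (S n)) (- Re s) / Re s).
Proof.
move=> Hs.
have He : is_lim_seq (fun n => Cmod s * (Rpower (INR (S n)) (- Re s) / Re s)) 0.
  have := is_lim_seq_scal_l _ (Cmod s / Re s) _ (Rpower_lim_0 _ Hs).
  rewrite /= Rmult_0_r; apply: is_lim_seq_ext => n; field; lra.
have [A B] := Clim_Cauchy (fun n => eta_part (S n) s) _ He
   (fun n m Hnm => eta_part_Cauchy s n m Hs Hnm).
have E : Clim (fun n => eta_part (S n) s) = eta s.
  by rewrite /Clim /eta /Clim; congr pair;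
    rewrite (Lim_seq_incr_1 (fun n => _ (eta_part n s))).
rewrite E in A B; split=> //.
by apply/is_lim_seq_incr_1.
Qed.

(** Subtracting twice the even terms from all terms produces the alternating
    signs. *)
Lemma eta_part_zeta s M : eta_part M s =
  (Csum (fun n => npow (S n) s) (2 * M) - 2 * npow 2 s * Csum (fun n => npow (S n) s) M)%C.
Proof.
elim: M => [|M IH]; first by rewrite /eta_part /=; ring.
have -> : (2 * S M = S (S (2 * M)))%nat by lia.
rewrite /eta_part /= -/(eta_part M s) IH.
have -> : (M + (M + 0) + 1 = S (2 * M))%nat by lia.
have -> : (M + (M + 0) + 2 = 2 * S M)%nat by lia.
have -> : (S (S (M + (M + 0))) = 2 * S M)%nat by lia.
rewrite npow_mult; try lia; rewrite RtoC_2 /=; ring.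
Qed.

Lemma eta_zeta_Re_gt1 zeta s : is_riemann_zeta zeta -> 1 < Re s ->
  eta s = ((1 - 2 * npow 2 s) * zeta s)%C.
Proof.
move=> [Hz _] Hs; have Hc := is_series_Ccvg _ _ (Hz s Hs).
have [A _] := eta_spec s ltac:(lra).
apply: Ccvg_unique A _.
apply: (Ccvg_ext (fun M => Csum (fun n => npow (S n) s) (2 * M) -
   2 * npow 2 s * Csum (fun n => npow (S n) s) M)%C); first by move=> M; rewrite eta_part_zeta.
replace ((1 - 2 * npow 2 s) * zeta s)%C with (zeta s - 2 * npow 2 s * zeta s)%C by ring.
apply: Ccvg_minus; last exact: Ccvg_scal.
by apply: (Ccvg_subseq _ _ (fun M => 2 * M)%nat) Hc => n; lia.
Qed.

(** * Uniqueness on the right half plane *)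

(** Rectangle with the side through [p] centred at [p]; [c] gives direction and
    scale. *)
Definition rect (p c : C) (L : R) (z : C) : Prop :=
  exists x y, 0 <= x <= L /\ -1 <= y <= 1 /\ z = (p + c * (x, y))%C.

(** Uniform approximability on the compact rectangles of the half plane that avoid 1.
    The margin [d] is explicit because the rates of convergence degenerate at the
    boundary. *)
Definition approx_half_plane (F : C -> C) : Prop :=
  forall p c L d, 0 < L -> 0 < d ->
    (forall x y, 0 <= x <= L -> -1 <= y <= 1 -> d <= Re (p + c * (x, y))%C /\
       d <= Cmod (p + c * (x, y) - 1)) ->
    approx_holo F (rect p c L).

Lemma rect_bound p c L x y : 0 <= x <= L -> -1 <= y <= 1 ->
  Cmod (p + c * (x, y)) <= Cmod p + Cmod c * (L + 1).
Proof.
move=> Hx Hy; apply: Rle_trans (Cmod_triangle _ _) _; rewrite Cmod_mult.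
apply: Rplus_le_compat_l; apply: Rmult_le_compat_l; first exact: Cmod_ge_0.
apply: Rle_trans (Cmod_le_ReIm _) _ => /=.
have A1 : Rabs x <= L by apply: Rabs_le; lra.
have A2 : Rabs y <= 1 by apply: Rabs_le; lra.
lra.
Qed.

Lemma Re_rect_h p h x y : Re (p + RtoC h * (x, y))%C = Re p + h * x.
Proof. by rewrite /Re /=; ring. Qed.

Lemma Im_rect_h p h x y : Im (p + RtoC h * (x, y))%C = Im p + h * y.
Proof. by rewrite /Im /=; ring. Qed.

Lemma Re_rect_v p h x y : Re (p + (0, h) * (x, y))%C = Re p - h * y.
Proof. by rewrite /Re /=; ring. Qed.

Lemma Im_rect_v p h x y : Im (p + (0, h) * (x, y))%C = Im p + h * x.
Proof. by rewrite /Im /=; ring. Qed.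

Lemma Cmod_sub1_Im z : Rabs (Im z) <= Cmod (z - 1).
Proof.
have -> : Im z = Im (z - 1)%C by rewrite /Im /=; ring.
exact: Cmod_Im_le.
Qed.

Lemma Cmod_sub1_Re z : Rabs (Re z - 1) <= Cmod (z - 1).
Proof.
have -> : Re z - 1 = Re (z - 1)%C by rewrite /Re /=; ring.
exact: Cmod_Re_le.
Qed.

(** A small rectangle above the real point has its opposite side in the region where
    [F] is known to vanish. *)
Lemma identity_real F p : approx_half_plane F ->
  (forall s, 0 < Re s -> Im s <> 0 -> F s = 0%C) ->
  0 < Re p -> p <> 1%C -> F p = 0%C.
Proof.
move=> HF H0 Hp Hp1; case: (Req_dec (Im p) 0) => [E|]; last exact: H0.
have HR : Re p <> 1 by move=> HR; apply: Hp1; apply: injective_projections.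
set h := Rmin (Re p) (Rabs (Re p - 1)) / 2.
have Hr : 0 < Rabs (Re p - 1) by apply: Rabs_pos_lt; lra.
have Hh : 0 < h by apply: Rdiv_lt_0_compat; [apply: Rmin_pos|lra].
have h1 : 2 * h <= Re p by rewrite /h; move: (Rmin_l (Re p) (Rabs (Re p - 1))); lra.
have h2 : 2 * h <= Rabs (Re p - 1) by rewrite /h; move: (Rmin_r (Re p) (Rabs (Re p - 1))); lra.
apply: (identity_rectangle F p (0, h) 1 Rlt_0_1).
- apply: (HF p _ _ h) => //; try lra.
  move=> x y Hx Hy; rewrite Re_rect_v; split; first by nra.
  apply: Rle_trans (Cmod_sub1_Re _); rewrite Re_rect_v.
  move: h2; rewrite /Rabs; case: Rcase_abs => ?; case: Rcase_abs => ?; nra.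
- move=> y Hy; apply: H0; first by rewrite Re_rect_v; nra.
  by rewrite Im_rect_v E; lra.
Qed.

(** A non-real point is joined to the half plane [Re s > 1] by a thin horizontal
    rectangle that avoids 1. *)
Lemma identity_from_right F : approx_half_plane F -> (forall s, 1 < Re s -> F s = 0%C) ->
  forall p, 0 < Re p -> p <> 1%C -> F p = 0%C.
Proof.
move=> HF H0 p; apply: (identity_real F) => // {}p Hp Hi.
set h := Rabs (Im p) / 2.
have Hr : 0 < Rabs (Im p) by apply: Rabs_pos_lt.
have Hh : 0 < h by rewrite /h; lra.
apply: (identity_rectangle F p h (1 / h)); first by apply: Rdiv_lt_0_compat; lra.
- apply: (HF p _ _ (Rmin h (Re p))).
    by apply: Rdiv_lt_0_compat; lra.
    exact: Rmin_pos.
  move=> x y Hx Hy; rewrite Re_rect_h; split; first by apply: Rle_trans (Rmin_r _ _) _; nra.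
  apply: Rle_trans (Rmin_l _ _) _; apply: Rle_trans (Cmod_sub1_Im _); rewrite Im_rect_h.
  rewrite /h; move: Hr; rewrite /Rabs; case: Rcase_abs => ?; case: Rcase_abs => ?; nra.
- move=> y Hy; apply: H0; rewrite Re_rect_h.
  have -> : h * (1 / h) = 1 by field; lra.
  lra.
Qed.

(** Vertical rectangles carry the zeros on (0, 1) to the whole critical strip,
    horizontal ones then carry them to the right. *)
Lemma identity_from_interval F : approx_half_plane F ->
  (forall x, 0 < x < 1 -> F (RtoC x) = 0%C) ->
  forall p, 0 < Re p -> p <> 1%C -> F p = 0%C.
Proof.
move=> HF H0.
have Hstrip p : 0 < Re p < 1 -> Im p <> 0 -> F p = 0%C.
  move=> Hp Hi.
  set h := Rmin (Re p) (1 - Re p) / 2.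
  have Hh : 0 < h by apply: Rdiv_lt_0_compat; [apply: Rmin_pos; lra|lra].
  have h1 : 2 * h <= Re p by rewrite /h; move: (Rmin_l (Re p) (1 - Re p)); lra.
  have h2 : 2 * h <= 1 - Re p by rewrite /h; move: (Rmin_r (Re p) (1 - Re p)); lra.
  clearbody h; set e := sign (- Im p).
  have [e1 e2] : e * Rabs (Im p) = - Im p /\ Rabs e = 1.
    rewrite /e; case: (Rlt_le_dec (Im p) 0) => Hs.
      by rewrite sign_eq_1 ?(Rabs_left (Im p)) //; rewrite ?Rabs_R1; lra.
    rewrite sign_eq_m1 ?(Rabs_pos_eq (Im p)) //; last lra.
    by split; [ring|rewrite Rabs_Ropp Rabs_R1].
  have e3 : -1 <= e <= 1 by move: (Rle_abs e) (Rle_abs (- e)); rewrite Rabs_Ropp; lra.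
  clearbody e.
  have Q y : -1 <= y <= 1 -> - h <= e * h * y <= h.
    move=> Hy; apply/Rabs_le_between; rewrite !Rabs_mult e2 (Rabs_pos_eq h); last lra.
    have : Rabs y <= 1 by apply: Rabs_le.
    by move: (Rabs_pos y); nra.
  apply: (identity_rectangle F p (0, e * h) (Rabs (Im p) / h)).
    by apply: Rdiv_lt_0_compat => //; apply: Rabs_pos_lt.
  - apply: (HF p _ _ h) => //.
      by apply: Rdiv_lt_0_compat => //; apply: Rabs_pos_lt.
    move=> x y Hx /Q Hy; rewrite Re_rect_v; split; first lra.
    apply: Rle_trans (Cmod_sub1_Re _); rewrite Re_rect_v Rabs_left; lra.
  - move=> y /Q Hy.
    have -> : (p + (0, (e * h)%R) * ((Rabs (Im p) / h)%R, y))%C = RtoC (Re p - e * h * y).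
      apply: injective_projections; first exact: (Re_rect_v p (e * h)).
      have := Im_rect_v p (e * h) (Rabs (Im p) / h) y; rewrite /Im => ->.
      have -> : e * h * (Rabs (snd p) / h) = e * Rabs (snd p) by field; lra.
      by move: e1; rewrite /Im /= => ->; ring.
    by apply: H0; lra.
move=> p; apply: (identity_real F) => // {}p Hp Hi.
case: (Rlt_le_dec (Re p) 1) => H1; first by apply: Hstrip.
set h := Rabs (Im p) / 2.
have Hr : 0 < Rabs (Im p) by apply: Rabs_pos_lt.
have Hh : 0 < h by rewrite /h; lra.
have hL : - h * ((Re p - 1 / 2) / h) = 1 / 2 - Re p by field; lra.
have Im0 y : -1 <= y <= 1 -> h <= Rabs (Im p + - h * y).
  move=> Hy; rewrite /h; move: Hr; rewrite /Rabs; case: Rcase_abs => ?; case: Rcase_abs => ?; nra.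
apply: (identity_rectangle F p (- h)%R ((Re p - 1 / 2) / h)); first by apply: Rdiv_lt_0_compat; lra.
- apply: (HF p _ _ (Rmin h (1 / 2))).
    by apply: Rdiv_lt_0_compat; lra.
    by apply: Rmin_pos; lra.
  move=> x y Hx Hy; rewrite Re_rect_h; split; first by apply: Rle_trans (Rmin_r _ _) _; nra.
  apply: Rle_trans (Rmin_l _ _) _; apply: Rle_trans (Cmod_sub1_Im _); rewrite Im_rect_h.
  exact: Im0.
- move=> y Hy; apply: Hstrip; first by rewrite Re_rect_h hL; lra.
  by rewrite Im_rect_h => E; have := Im0 y Hy; rewrite E Rabs_R0; lra.
Qed.

(** The only shape of function to which uniqueness is applied: [L] is eta or 1/Gamma,
    given as a limit, and [A] and [B] involve zeta. *)
Lemma approx_half_plane_minus_mult (A B L : C -> C) (Ln : nat -> C -> C) :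
  (forall s, 0 < Re s -> s <> 1%C -> holo_at A s) ->
  (forall s, 0 < Re s -> s <> 1%C -> holo_at B s) ->
  (forall n s, 0 < Re s -> holo_at (Ln n) s) ->
  (forall d R eps, 0 < d -> 0 < eps -> exists n, forall s, d <= Re s -> Cmod s <= R ->
     Cmod (Ln n s - L s) <= eps) ->
  approx_half_plane (fun s => A s - L s * B s)%C.
Proof.
move=> HA HB HL Hu p c l d Hl Hd Hrect eps He.
have Hin z : rect p c l z -> d <= Re z /\ d <= Cmod (z - 1).
  by move=> [x [y [Hx [Hy ->]]]]; apply: Hrect.
have Hdom z : rect p c l z -> 0 < Re z /\ z <> 1%C.
  move=> /Hin [H1 H2]; split; first lra.
  by move=> E; move: H2; rewrite E; replace (1 - 1)%C with (RtoC 0) by ring; rewrite Cmod_0; lra.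
have Hp z : pgram (p + c * (0, -1)) (c * (l, 0)) (c * (0, 2)) z -> rect p c l z.
  move=> [X [Y [HX [HY ->]]]]; exists (X * l), (-1 + 2 * Y); split; first by nra.
  split; first by nra.
  by apply: injective_projections => /=; ring.
have Hp' z : rect p c l z -> pgram (p + c * (0, -1)) (c * (l, 0)) (c * (0, 2)) z.
  move=> [x [y [Hx [Hy ->]]]]; exists (x / l), ((y + 1) / 2).
  have E : 0 < / l by apply: Rinv_0_lt_compat.
  split; first by split; [apply: Rdiv_le_0_compat; lra|apply/Rle_div_l; lra].
  split; first by lra.
  by apply: injective_projections => /=; field; lra.
have [M [M0 HM]] := bounded_on_pgram B _ _ _ (fun z Hz => holo_cont _ _
   (HB z (proj1 (Hdom z (Hp z Hz))) (proj2 (Hdom z (Hp z Hz))))).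
have He' : 0 < eps / (M + 1) by apply: Rdiv_lt_0_compat; lra.
have [n Hn] := Hu d (Cmod p + Cmod c * (l + 1)) _ Hd He'.
exists (fun s => A s - Ln n s * B s)%C; split.
  move=> z Hz; have [H1 H2] := Hdom z Hz.
  apply: holo_minus; first exact: HA.
  by apply: holo_mult; [apply: HL|apply: HB].
move=> z Hz.
replace (A z - Ln n z * B z - (A z - L z * B z))%C with (- ((Ln n z - L z) * B z))%C by ring.
rewrite Cmod_opp Cmod_mult.
have H1 : Cmod (Ln n z - L z) <= eps / (M + 1).
  apply: Hn; first by case: (Hin z Hz).
  by case: Hz => [x [y [Hx [Hy ->]]]]; apply: rect_bound.
have -> : eps = eps / (M + 1) * (M + 1) by field; lra.
apply: Rmult_le_compat => //; try exact: Cmod_ge_0.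
by apply: Rle_trans (HM z (Hp' z Hz)) _; lra.
Qed.

(** * The alternating zeta function continues zeta *)

Lemma eta_part_holo n s : holo_at (eta_part n) s.
Proof.
elim: n => [|n IH]; first exact: holo_const.
apply: holo_plus => //; apply: holo_minus; exact: holo_npow.
Qed.

Lemma eta_part_unif d B eps : 0 < d -> 0 < eps -> exists n, forall s, d <= Re s -> Cmod s <= B ->
  Cmod (eta_part n s - eta s) <= eps.
Proof.
move=> Hd He.
have [n Hn] : exists n, Rabs B * (Rpower (INR (S n)) (- d) / d) < eps.
  have H : is_lim_seq (fun n => Rabs B * (Rpower (INR (S n)) (- d) / d)) 0.
    have := is_lim_seq_scal_l _ (Rabs B / d) _ (Rpower_lim_0 _ Hd).
    rewrite /= Rmult_0_r; apply: is_lim_seq_ext => n; field; lra.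
  have [N HN] := proj2 (is_lim_seq_spec _ _) H (mkposreal _ He).
  exists N; have := HN N (le_n _); rewrite /= Rminus_0_r => H'.
  exact: Rle_lt_trans (Rle_abs _) H'.
exists (S n) => s Hs HB; have [_ H] := eta_spec s ltac:(lra).
apply: Rle_trans (H n) _; apply: Rle_trans (Rlt_le _ _ Hn).
have P : 0 < Rpower (INR (S n)) (- Re s) by apply: exp_pos.
have P' : 0 < Rpower (INR (S n)) (- d) by apply: exp_pos.
apply: Rmult_le_compat; first exact: Cmod_ge_0.
- by apply: Rdiv_le_0_compat; lra.
- exact: Rle_trans HB (Rle_abs _).
apply: Rmult_le_compat; try lra.
- by apply: Rlt_le; apply: Rinv_0_lt_compat; lra.
- rewrite /Rpower; have L : 0 <= ln (INR (S n)).
    by rewrite -ln_1; apply: ln_le; [lra|rewrite S_INR; move: (pos_INR n); lra].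
  have : - Re s * ln (INR (S n)) <= - d * ln (INR (S n)) by nra.
  by case=> [/exp_increasing|->]; lra.
- by apply: Rinv_le_contravar.
Qed.

(** Both sides agree for [Re s > 1] by rearrangement of absolutely convergent series;
    the rest is uniqueness. *)
Lemma eta_zeta zeta s : is_riemann_zeta zeta -> 0 < Re s -> s <> 1%C ->
  eta s = ((1 - 2 * npow 2 s) * zeta s)%C.
Proof.
move=> Hz Hs Hs1.
suff : ((1 - 2 * npow 2 s) * zeta s - eta s * 1)%C = 0%C.
  move=> H; replace (eta s) with ((1 - 2 * npow 2 s) * zeta s
     - ((1 - 2 * npow 2 s) * zeta s - eta s * 1))%C by ring.
  by rewrite H; ring.
apply: (identity_from_right (fun s => (1 - 2 * npow 2 s) * zeta s - eta s * 1)%C) => //.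
- apply: (approx_half_plane_minus_mult _ _ _ eta_part).
  + move=> z _ Hz1; apply: holo_mult.
      apply: holo_minus; first exact: holo_const.
      by apply: holo_mult; [apply: holo_const|apply: holo_npow].
    by apply: ex_derive_holo_at; apply: (proj2 Hz).
  + by move=> z _ _; apply: holo_const.
  + by move=> n z _; apply: eta_part_holo.
  + by move=> d B eps; apply: eta_part_unif.
- by move=> z Hz1; rewrite (eta_zeta_Re_gt1 zeta) //; ring.
Qed.

(** * Sums of the Moebius function and the step function *)

Module MobiusSums.
Import ssrfun ssrbool eqtype ssrnat seq div prime bigop.

Lemma Rplus_associative : associative Rplus. Proof. by move=> x y z; ring. Qed.

Lemma Rplus_commutative : commutative Rplus. Proof. by move=> x y; ring. Qed.

Lemma Rplus_left_id : left_id 0 Rplus. Proof. by move=> x; ring. Qed.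

HB.instance Definition _ := Monoid.isComLaw.Build R 0 Rplus
  Rplus_associative Rplus_commutative Rplus_left_id.

Local Open Scope nat_scope.

Lemma mobius_prime_mul p j : prime p -> 0 < j -> ~~ (p %| j) ->
  mobius (p * j) = (- mobius j)%R.
Proof.
move=> Hp Hj Hpj; have p0 := prime_gt0 Hp.
have mem : perm_eq (primes (p * j)) (p :: primes j).
  apply: uniq_perm; first exact: primes_uniq.
    by rewrite /= primes_uniq mem_primes Hp Hj (negbTE Hpj).
  by move=> q; rewrite primesM // inE primes_prime // inE.
have lp q : logn q (p * j) = (p == q) + logn q j by rewrite lognM // (logn_prime q Hp) eq_sym.
rewrite /mobius muln_gt0 p0 Hj /= (perm_size mem) (perm_all _ mem) /= lp eqxx.
have l0 : logn p j = 0 by apply/eqP; rewrite -leqn0 leqNgt logn_gt0 mem_primes Hp Hj.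
rewrite l0 /=.
have -> : all (fun p0 => logn p0 (p * j) == 1) (primes j) = all (fun p0 => logn p0 j == 1) (primes j).
  apply: eq_in_all => q Hq; rewrite lp.
  suff -> : (p == q) = false by [].
  by apply/negP => /eqP E; move: Hq; rewrite -E mem_primes (negbTE Hpj) !andbF.
by case: (all _ _); [ring|rewrite Ropp_0].
Qed.

(** A square factor gives an exponent of at least 2 in the factorization. *)
Lemma mobius_square p k : prime p -> p * p %| k -> mobius k = 0%R.
Proof.
move=> Hp Hk; rewrite /mobius; case: posnP => [//|k0] /=.
case: allP => // H; exfalso.
have pk : p %| k by apply: dvdn_trans Hk; apply: dvdn_mulr.
have := H p; rewrite mem_primes Hp k0 pk => /(_ isT) /eqP E.
by move: Hk; rewrite mulnn pfactor_dvdn // E.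
Qed.

(** With p the least prime factor of m, the divisors divisible by [p^2] contribute 0,
    and those of the form [p j] with p not dividing j cancel against j. *)
Lemma sum_mobius_divisors m : 0 < m ->
  \big[Rplus/0%R]_(k <- divisors m) mobius k = (if (m == 1)%N then 1 else 0)%R.
Proof.
move=> m0; case: eqP => [->|/eqP m1].
  have -> : divisors 1 = [:: 1] by []. rewrite big_seq1 /mobius /=; ring.
have m2 : 1 < m by rewrite ltn_neqAle eq_sym m1.
set p := pdiv m; have Hp : prime p by apply: pdiv_prime.
have pm : p %| m by apply: pdiv_dvd.
set A := [seq j <- divisors m | ~~ (p %| j)].
rewrite (bigID (fun k => p %| k)) /= -[X in Rplus _ X]big_filter -/A.
rewrite (bigID (fun k => p * p %| k)) /=.
rewrite big1; last by move=> k /andP [_ H]; apply: mobius_square H.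
rewrite -big_filter.
have E : perm_eq [seq i <- divisors m | (p %| i) && ~~ (p * p %| i)] [seq p * j | j <- A].
  apply: uniq_perm; first by rewrite filter_uniq // divisors_uniq.
    rewrite map_inj_uniq ?filter_uniq ?divisors_uniq // => a b /eqP.
    by rewrite eqn_pmul2l ?prime_gt0 // => /eqP.
  move=> k; rewrite mem_filter -dvdn_divisors //; apply/idP/mapP.
    move=> /andP [/andP [/dvdnP [j ->] H2] H3]; exists j; last by rewrite mulnC.
    rewrite mem_filter -dvdn_divisors //; apply/andP; split.
      by move: H2; rewrite (mulnC j) dvdn_pmul2l // prime_gt0.
    by apply: dvdn_trans H3; apply: dvdn_mulr.
  move=> [j]; rewrite mem_filter -dvdn_divisors // => /andP [H1 H2] ->.
  rewrite dvdn_mulr // dvdn_pmul2l ?prime_gt0 // H1 /=.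
  by rewrite Gauss_dvd ?pm // prime_coprime.
rewrite (perm_big _ E) big_map /= Rplus_left_id.
rewrite (eq_big_seq (fun j => Ropp (mobius j))).
  by rewrite -(big_endo Ropp); [exact: Rplus_opp_l|move=> x y; exact: Ropp_plus_distr|exact: Ropp_0].
move=> j; rewrite mem_filter -dvdn_divisors // => /andP [H1 H2].
by apply: mobius_prime_mul => //; apply: dvdn_gt0 H2.
Qed.

Lemma sum_n_m_big (f : nat -> R) n :
  sum_n_m (G := R_AbelianMonoid) f 1 n = \big[Rplus/0%R]_(1 <= k < n.+1) f k.
Proof.
elim: n => [|n IH]; first by rewrite big_nil sum_n_m_zero.
by rewrite sum_n_Sm; [rewrite IH [RHS]big_nat_recr|apply/leP].
Qed.

Lemma sum_mobius_dvd n m : 0 < m -> m <= n ->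
  sum_n_m (fun k => if k %| m then mobius k else 0%R) 1 n = (if (m == 1)%N then 1 else 0)%R.
Proof.
move=> m0 mn; rewrite sum_n_m_big -(sum_mobius_divisors m) // -big_mkcond /= -big_filter.
apply: perm_big; apply: uniq_perm; first by rewrite filter_uniq // iota_uniq.
  exact: divisors_uniq.
move=> k; rewrite mem_filter -dvdn_divisors // mem_index_iota.
case H: (k %| m) => //=.
by rewrite (dvdn_gt0 m0 H) ltnS (leq_trans (dvdn_leq m0 H) mn).
Qed.

Lemma sum_n_m_Rplus (u v : nat -> R) a b :
  sum_n_m (fun k => u k + v k)%R a b = (sum_n_m u a b + sum_n_m v a b)%R.
Proof. exact: (sum_n_m_plus (G := R_AbelianMonoid)). Qed.

Lemma sum_n_m_Rscal (c : R) (u : nat -> R) a b :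
  sum_n_m (fun k => c * u k)%R a b = (c * sum_n_m u a b)%R.
Proof. exact: (sum_n_m_scal_l (K := R_Ring) (V := R_ModuleSpace)). Qed.

(** Induction on m: the increment of [floor (m/k)] is the indicator of [k | m+1]. *)
Lemma sum_mobius_floor n m : m <= n ->
  sum_n_m (fun k => mobius k * INR (m %/ k))%R 1 n = (if (m == 0)%N then 0 else 1)%R.
Proof.
elim: m => [|m IH] mn.
  rewrite /= -[RHS](sum_n_m_const_zero (G := R_AbelianMonoid) 1 n).
  by apply: sum_n_m_ext => k; rewrite div0n /= Rmult_0_r.
have -> : sum_n_m (fun k => mobius k * INR (m.+1 %/ k))%R 1 n =
  (sum_n_m (fun k => mobius k * INR (m %/ k))%R 1 n +
   sum_n_m (fun k => if k %| m.+1 then mobius k else 0%R) 1 n)%R.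
  rewrite -sum_n_m_Rplus; apply: sum_n_m_ext_loc => k [/leP k0 _].
  rewrite divnS // plus_INR; case: (k %| m.+1) => /=; ring.
rewrite IH ?(ltnW mn) // sum_mobius_dvd //; case: m mn {IH} => [|m] mn /=; ring.
Qed.

(** [nu t = q mod 2] for the integer part q, in the additive form [q - 2 floor (q/2)]
    that suits the sums over k. *)
Lemma nu_floor (t : R) (q : nat) : (INR q <= t < INR q + 1)%R ->
  nu t = (INR q - 2 * INR (q %/ 2))%R.
Proof.
move=> [H1 H2]; rewrite /nu /frac_part.
have -> : Int_part (t / 2) = Z.of_nat (q %/ 2).
  symmetry; apply: Int_part_spec; rewrite -INR_IZR_INZ.
  have := divn_eq q 2; have := ltn_pmod q (isT : 0 < 2); move: (q %% 2) => r Hr E.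
  have : (INR q = INR (q %/ 2) * 2 + INR r)%R by rewrite {1}E plus_INR mult_INR.
  have : (INR r <= 1)%R by apply: (le_INR _ 1); apply/leP.
  have := pos_INR r; lra.
have -> : Int_part (t / 2 + 1 / 2) = (Z.of_nat q - Z.of_nat (q %/ 2))%Z.
  symmetry; apply: Int_part_spec; rewrite minus_IZR -!INR_IZR_INZ.
  have := divn_eq q 2; have := ltn_pmod q (isT : 0 < 2); move: (q %% 2) => r Hr E.
  have : (INR q = INR (q %/ 2) * 2 + INR r)%R by rewrite {1}E plus_INR mult_INR.
  case: r Hr {E} => [|[|//]] _ /=; lra.
rewrite minus_IZR -!INR_IZR_INZ; lra.
Qed.

Lemma floor_div_bounds (x : R) m k : 0 < k -> (INR m <= x < INR m + 1)%R ->
  (INR (m %/ k) <= x / INR k < INR (m %/ k) + 1)%R.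
Proof.
move=> k0 [H1 H2]; have K : (0 < INR k)%R by apply: lt_0_INR; apply/leP.
have E : (INR m = INR (m %/ k) * INR k + INR (m %% k))%R.
  by rewrite {1}(divn_eq m k) plus_INR mult_INR.
have L : (INR (m %% k) + 1 <= INR k)%R.
  by rewrite -S_INR; apply: le_INR; apply/leP; apply: ltn_pmod.
have P := pos_INR (m %% k).
split; first by apply/Rle_div_r => //; lra.
by apply/Rlt_div_l => //; lra.
Qed.

Lemma nu_div (x : R) m k : 0 < k -> (INR m <= x < INR m + 1)%R ->
  nu (x / INR k) = (INR (m %/ k) - 2 * INR (m %/ 2 %/ k))%R.
Proof.
move=> k0 H; rewrite (nu_floor _ (m %/ k)); last exact: floor_div_bounds.
by rewrite -!divnMA mulnC.
Qed.

Local Close Scope nat_scope.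

(** Value for [m <= x < m+1] of the function in the integral. *)
Definition step_value (n m : nat) : R :=
  1 + sum_n_m (fun k => mobius k * nu (INR m / INR k)) 1 n.

Lemma step_function (n m : nat) (x : R) : INR m <= x < INR m + 1 ->
  1 + sum_n_m (fun k => mobius k * nu (x / INR k)) 1 n = step_value n m.
Proof.
move=> H; rewrite /step_value; congr Rplus; apply: sum_n_m_ext_loc => k [/leP k0 _].
by rewrite (nu_div x m) // (nu_div (INR m) m) //; lra.
Qed.

(** [sum mu(k) nu(m/k) = S(m) - 2 S(m/2)] where [S(m) = sum mu(k) floor (m/k)] is 1
    for [m >= 1] and 0 for [m = 0]. *)
Lemma step_value_small (n m : nat) : (1 <= m)%coq_nat -> (m <= n)%coq_nat ->
  step_value n m = if (m == 1)%N then 2 else 0.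
Proof.
move=> /leP m0 /leP mn; rewrite /step_value.
have -> : sum_n_m (fun k => mobius k * nu (INR m / INR k)) 1 n =
  sum_n_m (fun k => mobius k * INR (m %/ k)%N) 1 n +
  -2 * sum_n_m (fun k => mobius k * INR (m %/ 2 %/ k)%N) 1 n.
  rewrite -sum_n_m_Rscal -sum_n_m_Rplus; apply: sum_n_m_ext_loc => k [/leP k0 _].
  rewrite (nu_div _ m) //; last lra.
  by match goal with |- @eq _ ?a ?b => change (@eq R a b) end; ring.
rewrite !sum_mobius_floor //; last by apply: leq_trans (leq_div _ _) mn.
case: m m0 mn => [//|[|m]] _ _ /=; first lra.
have -> : (m.+2 %/ 2 == 0)%N = false by rewrite eqn0Ngt divn_gt0.
lra.
Qed.

End MobiusSums.
Import MobiusSums.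

(** * The integral of the hypothesis as a sum *)

Definition integrand (n : nat) (x : R) : R :=
  Rabs (1 + sum_n_m (fun k : nat => mobius k * nu (x / INR k)) 1 n) ^ 2 * / x ^ 2.

Lemma is_RInt_integrand_step n m : (1 <= m)%nat ->
  is_RInt (integrand n) (INR m) (INR (S m)) (step_value n m ^ 2 * (/ INR m - / INR (S m))).
Proof.
move=> Hm; have Hp : 0 < INR m by apply: lt_0_INR; lia.
have ES := S_INR m.
apply: (is_RInt_ext (fun x => step_value n m ^ 2 * / x ^ 2)).
  move=> x; rewrite Rmin_left ?Rmax_right; try lra; move=> Hx.
  rewrite /integrand (step_function n m); last lra.
  by rewrite pow2_abs.
have -> : step_value n m ^ 2 * (/ INR m - / INR (S m)) =
  minus (- (step_value n m ^ 2) * / INR (S m)) (- (step_value n m ^ 2) * / INR m).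
  by rewrite /minus /plus /opp /=; ring.
apply: (is_RInt_derive (V := R_CompleteNormedModule) (fun x => - (step_value n m ^ 2) * / x)) => x;
  rewrite Rmin_left ?Rmax_right; try lra; move=> Hx.
  by auto_derive; [lra|field; lra].
by apply: (ex_derive_continuous (V := R_NormedModule)); auto_derive; nra.
Qed.

(** Integral of the integrand from m to m+1. *)
Definition energy (n m : nat) : R := step_value n m ^ 2 * (/ INR m - / INR (S m)).

Lemma energy_ge_0 n m : (1 <= m)%nat -> 0 <= energy n m.
Proof.
move=> Hm; apply: Rmult_le_pos; first exact: pow2_ge_0.
have Hp : 0 < INR m by apply: lt_0_INR; lia.
have := Rinv_le_contravar (INR m) (INR (S m)) Hp; rewrite S_INR; lra.
Qed.

Lemma is_RInt_integrand n K : (1 <= n)%nat ->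
  is_RInt (integrand n) (INR n) (INR (n + K)) (Rsum (fun i => energy n (n + i)) K).
Proof.
move=> Hn; elim: K => [|K IH]; cbn [Rsum].
  by rewrite Nat.add_0_r; apply: (is_RInt_point (V := R_NormedModule)).
apply: (is_RInt_Chasles (V := R_NormedModule)) IH _.
by rewrite -plus_n_Sm; apply: is_RInt_integrand_step; lia.
Qed.

Lemma nu_bound t : Rabs (nu t) <= 2.
Proof.
rewrite /nu; have [A1 A2] := base_fp (t / 2); have [B1 B2] := base_fp (t / 2 + 1 / 2).
apply: Rabs_le; lra.
Qed.

Lemma sum_n_m_eq_Rsum (f : nat -> R) n :
  sum_n_m (G := R_AbelianMonoid) f 1 n = Rsum (fun i => f (S i)) n.
Proof.
elim: n => [|n IH]; first by rewrite sum_n_m_zero //.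
by rewrite sum_n_Sm ?IH //; lia.
Qed.

Lemma step_value_bounded n : exists B, forall m, Rabs (step_value n m) <= B.
Proof.
exists (1 + Rsum (fun i => Rabs (mobius (S i)) * 2) n) => m; rewrite /step_value sum_n_m_eq_Rsum.
apply: Rle_trans (Rabs_triang _ _) _; rewrite Rabs_R1; apply: Rplus_le_compat_l.
elim: n => [|k IH]; cbn [Rsum]; first by rewrite Rabs_R0; lra.
apply: Rle_trans (Rabs_triang _ _) _; apply: Rplus_le_compat => //.
by rewrite Rabs_mult; apply: Rmult_le_compat_l; [apply: Rabs_pos|apply: nu_bound].
Qed.

Lemma energy_sum_bounded n : (1 <= n)%nat -> exists M, forall K,
  Rsum (fun i => energy n (n + i)) K <= M.
Proof.
move=> Hn; have [B HB] := step_value_bounded n.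
exists (B ^ 2) => K.
have B0 : 0 <= B by apply: Rle_trans (Rabs_pos _) (HB 0%nat).
suff H : Rsum (fun i => energy n (n + i)) K <= B ^ 2 * (/ INR n - / INR (n + K)).
  apply: Rle_trans H _.
  have Hp : 1 <= INR n by apply: (le_INR 1).
  have Hq : 0 < INR (n + K) by apply: lt_0_INR; lia.
  have : / INR n <= 1 by rewrite -Rinv_1; apply: Rinv_le_contravar; lra.
  have : 0 < / INR (n + K) by apply: Rinv_0_lt_compat.
  have : 0 <= B ^ 2 by apply: pow2_ge_0.
  nra.
elim: K => [|K IH]; cbn [Rsum]; first by rewrite Nat.add_0_r; lra.
suff : energy n (n + K) <= B ^ 2 * (/ INR (n + K) - / INR (S (n + K))) by rewrite -plus_n_Sm; lra.
rewrite /energy; apply: Rmult_le_compat_r.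
  have Hp : 0 < INR (n + K) by apply: lt_0_INR; lia.
  have := Rinv_le_contravar (INR (n + K)) (INR (S (n + K))) Hp; rewrite S_INR; lra.
rewrite -(pow2_abs (step_value n _)); apply: pow_incr; split; [exact: Rabs_pos|exact: HB].
Qed.

Definition tail_integral (n : nat) : R :=
  RInt_gen (integrand n) (at_point (INR n)) (Rbar_locally p_infty).

(** The integrand is nonnegative, so its integral from n to b increases with b and is
    bounded. Hence the improper integral exists, and it is the supremum of these
    sums. *)
Lemma energy_sum_le_tail n K : (1 <= n)%nat ->
  Rsum (fun i => energy n (n + i)) K <= tail_integral n.
Proof.
move=> Hn; have [M HM] := energy_sum_bounded n Hn.
set S' := fun K => Rsum (fun i => energy n (n + i)) K.
have Hincr k : S' k <= S' (S k).
  by rewrite /S'; cbn [Rsum]; have := energy_ge_0 n (n + k) ltac:(lia); lra.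
have [L HL] : ex_finite_lim_seq S' by apply: (ex_finite_lim_seq_incr _ M).
have HSL k : S' k <= L by apply: is_lim_seq_incr_compare.
suff -> : tail_integral n = L by apply: HSL.
have Hpos x : 0 <= integrand n x.
  rewrite /integrand; apply: Rmult_le_pos; first by apply: pow_le; apply: Rabs_pos.
  case: (Req_dec x 0) => [->|Hx]; first by rewrite /= Rmult_0_l Rinv_0; lra.
  by apply: Rlt_le; apply: Rinv_0_lt_compat; apply: pow2_gt_0.
have big b : exists k, b <= INR (n + k).
  exists (Z.to_nat (up b)); rewrite plus_INR.
  have [U _] := archimed b; have P := pos_INR n.
  case: (Z.le_gt_cases 0 (up b)) => Hz.
    rewrite (INR_IZR_INZ (Z.to_nat _)) Z2Nat.id //; lra.
  have : IZR (up b) <= 0 by apply: IZR_le; lia.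
  have := pos_INR (Z.to_nat (up b)); lra.
have mono a b c : a <= b <= c -> ex_RInt (integrand n) a c ->
   ex_RInt (integrand n) a b /\ RInt (integrand n) a b <= RInt (integrand n) a c.
  move=> Hb Hex.
  have E1 : ex_RInt (integrand n) a b.
    by apply: (ex_RInt_Chasles_1 (V := R_CompleteNormedModule)) Hex.
  have E2 : ex_RInt (integrand n) b c.
    by apply: (ex_RInt_Chasles_2 (V := R_CompleteNormedModule)) Hex.
  split=> //; rewrite -(RInt_Chasles (integrand n) a b c) // /plus /=.
  have := RInt_ge_0 (integrand n) b c (proj2 Hb) E2 (fun x _ => Hpos x); lra.
have Eint k : RInt (integrand n) (INR n) (INR (n + k)) = S' k.
  by apply: is_RInt_unique; apply: is_RInt_integrand.
have Exint k : ex_RInt (integrand n) (INR n) (INR (n + k)).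
  by exists (S' k); apply: is_RInt_integrand.
suff HG : is_RInt_gen (integrand n) (at_point (INR n)) (Rbar_locally p_infty) L.
  exact (is_RInt_gen_unique (V := R_CompleteNormedModule) _ _ HG).
move=> P [eps HP].
have [k Hk] : exists k, L - eps < S' k.
  have [N HN] := proj2 (is_lim_seq_spec _ _) HL eps.
  exists N; have := HN N (le_n _) => /Rabs_def2 [_]; lra.
apply: (Filter_prod _ _ _ (fun a => a = INR n) (fun b => INR (n + k) < b)).
- by [].
- by exists (INR (n + k)).
move=> a b -> /= Hb.
have [k' Hk'] := big b.
have Hnk : INR n <= INR (n + k) by apply: le_INR; lia.
have [Eb Lb] := mono (INR n) b (INR (n + k')) ltac:(lra) (Exint k').
have [_ Lk] := mono (INR n) (INR (n + k)) b ltac:(lra) Eb.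
rewrite !Eint in Lb Lk.
exists (RInt (integrand n) (INR n) b); split; first exact: RInt_correct.
apply: HP; rewrite /ball /= /AbsRing_ball /abs /minus /plus /opp /=.
have HSk := HSL k'; have Heps := cond_pos eps.
by apply: Rabs_def1; lra.
Qed.

(** Cauchy-Schwarz, in the form [2 F w <= Lam F^2/(m (m+1)) + m (m+1) w^2/Lam] with a
    free parameter, which avoids square roots. The second sum converges because [m^2
    m^(-2 tau - 2)] is summable for [tau > 1/2]. *)
Lemma tail_sum_bound (a : nat) (w : nat -> C) (c tau Lam : R) (K : nat) :
  0 < Lam -> 0 <= c -> 1 / 2 < tau ->
  (forall m, Cmod (w (S m)) <= c * Rpower (INR (S m)) (- tau - 1)) ->
  Cmod (Csum (fun i => step_value (S (S a)) (S (S a) + i) * w (S (S a) + i)%nat)%C K) <=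
    (Lam * tail_integral (S (S a)) + 2 * c ^ 2 / (2 * tau - 1) / Lam) / 2.
Proof.
move=> HL Hc Ht Hw; set n := S (S a).
apply: Rle_trans (Cmod_Csum_le _ (fun i => (Lam * energy n (n + i) +
   2 * c ^ 2 / Lam * Rpower (INR (S (S (a + i)))) (- (2 * tau - 1) - 1)) / 2) _ _) _.
  move=> i _; rewrite Cmod_mult Cmod_R /energy -(pow2_abs (step_value n (n + i))).
  set F := Rabs _; have HF : 0 <= F by apply: Rabs_pos.
  have Hwi := Hw (S (a + i)); rewrite -[S (S (a + i))]/(n + i)%nat in Hwi *.
  set m := (n + i)%nat in Hwi *.
  have Hm : 1 <= INR m by apply: (le_INR 1); rewrite /m /n; lia.
  have HW := Cmod_ge_0 (w m); set W := Cmod (w m) in Hwi HW *.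
  set r := Rpower (INR m) (- tau - 1) in Hwi.
  have Hr : 0 < r by apply: exp_pos.
  have -> : Rpower (INR m) (- (2 * tau - 1) - 1) = r ^ 2 * INR m ^ 2.
    have -> : INR m ^ 2 = Rpower (INR m) (1 + 1) by rewrite Rpower_plus Rpower_1; [ring|lra].
    have -> : r ^ 2 = Rpower (INR m) (- tau - 1 + (- tau - 1)) by rewrite Rpower_plus -/r; ring.
    by rewrite -Rpower_plus; congr Rpower; ring.
  have E1 : / INR m - / INR (S m) = / (INR m * (INR m + 1)) by rewrite S_INR; field; lra.
  rewrite E1; set mm := INR m * (INR m + 1).
  have Hmm : 0 < mm by rewrite /mm; nra.
  have Hmm2 : mm <= 2 * INR m ^ 2 by rewrite /mm; nra.
  have HWc : W ^ 2 <= c ^ 2 * r ^ 2 by rewrite -Rpow_mult_distr; apply: pow_incr.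
  have AG : F * W <= (Lam * (F ^ 2 * / mm) + mm * W ^ 2 / Lam) / 2.
    have : 0 <= (Lam * F - mm * W) ^ 2 / (Lam * mm).
      by apply: Rdiv_le_0_compat; [apply: pow2_ge_0|apply: Rmult_lt_0_compat].
    have -> : (Lam * F - mm * W) ^ 2 / (Lam * mm) =
      (Lam * (F ^ 2 * / mm) + mm * W ^ 2 / Lam) - 2 * (F * W) by field; lra.
    lra.
  apply: Rle_trans AG _.
  suff : mm * W ^ 2 / Lam <= 2 * c ^ 2 / Lam * (r ^ 2 * INR m ^ 2) by lra.
  have -> : 2 * c ^ 2 / Lam * (r ^ 2 * INR m ^ 2) = (2 * INR m ^ 2) * (c ^ 2 * r ^ 2) / Lam by field; lra.
  apply: Rmult_le_compat_r; first by apply: Rlt_le; apply: Rinv_0_lt_compat.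
  by apply: Rmult_le_compat => //; [lra|apply: pow2_ge_0].
have -> k : Rsum (fun i => (Lam * energy n (n + i) +
   2 * c ^ 2 / Lam * Rpower (INR (S (S (a + i)))) (- (2 * tau - 1) - 1)) / 2) k =
  (Lam * Rsum (fun i => energy n (n + i)) k + 2 * c ^ 2 / Lam *
    Rsum (fun i => Rpower (INR (S (S (a + i)))) (- (2 * tau - 1) - 1)) k) / 2.
  by elim: k => [|k IH]; cbn [Rsum]; [field; lra|rewrite IH; field; lra].
have H1 := energy_sum_le_tail n K ltac:(rewrite /n; lia).
have H2 := Rpower_tail (2 * tau - 1) a K ltac:(lra).
have H3 : Rpower (INR (S a)) (- (2 * tau - 1)) <= 1.
  have E : Rpower (INR 1) (- (2 * tau - 1)) = 1.
    by rewrite /Rpower /= ln_1 Rmult_0_r exp_0.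
  rewrite -[X in _ <= X]E.
  by apply: Rpower_incr_base; [rewrite /=; lra|apply: le_INR; lia|lra].
have H4 : Rpower (INR (S a)) (- (2 * tau - 1)) / (2 * tau - 1) <= 1 / (2 * tau - 1).
  by apply: Rmult_le_compat_r => //; apply: Rlt_le; apply: Rinv_0_lt_compat; lra.
have H5 : 0 <= 2 * c ^ 2 / Lam by apply: Rdiv_le_0_compat => //; have := pow2_ge_0 c; lra.
have -> : 2 * c ^ 2 / (2 * tau - 1) / Lam = 2 * c ^ 2 / Lam * (1 / (2 * tau - 1)) by field; lra.
have := Rmult_le_compat_l _ _ _ H5 (Rle_trans _ _ _ H2 H4).
have := Rmult_le_compat_l _ _ _ (Rlt_le _ _ HL) H1.
lra.
Qed.

(** * The Dirichlet polynomial of the Moebius function times eta *)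

(** [m^(-s) - (m+1)^(-s)], which is [s] times the integral of [x^(-s-1)] from m to
    m+1. *)
Definition npow_step (s : C) (m : nat) : C := (npow m s - npow (S m) s)%C.

Lemma Csum_npow_step s a k : Csum (fun i => npow_step s (a + i)) k = (npow a s - npow (a + k) s)%C.
Proof.
elim: k => [|k IH] /=; first by rewrite Nat.add_0_r; ring.
by rewrite IH /npow_step -plus_n_Sm; ring.
Qed.

Lemma nu_even_block q k i : (i < k)%nat -> nu (INR (2 * k * q + i) / INR k) = 0.
Proof.
move=> Hi.
have K : 0 < INR k by apply: lt_0_INR; lia.
rewrite (nu_floor _ (2 * q)%nat).
  have -> : div.divn (2 * q) 2 = q by rewrite -[(2 * q)%nat]/(ssrnat.muln 2 q) div.mulKn.
  by rewrite mult_INR /=; ring.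
have -> : INR (2 * k * q + i) / INR k = INR (2 * q) + INR i / INR k.
  by rewrite !(plus_INR, mult_INR) /=; field; lra.
have I1 : 0 <= INR i / INR k by apply: Rdiv_le_0_compat => //; apply: pos_INR.
have I2 : INR i / INR k < 1 by apply/Rlt_div_l => //; rewrite Rmult_1_l; apply: lt_INR.
lra.
Qed.

Lemma nu_odd_block q k i : (i < k)%nat -> nu (INR (2 * k * q + k + i) / INR k) = 1.
Proof.
move=> Hi.
have K : 0 < INR k by apply: lt_0_INR; lia.
rewrite (nu_floor _ (2 * q + 1)%nat).
  have -> : div.divn (2 * q + 1) 2 = q.
    rewrite -[(2 * q + 1)%nat]/(ssrnat.addn (ssrnat.muln 2 q) 1).
    by rewrite ssrnat.mulnC div.divnMDl //= ssrnat.addn0.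
  by rewrite plus_INR mult_INR /=; ring.
have -> : INR (2 * k * q + k + i) / INR k = INR (2 * q + 1) + INR i / INR k.
  by rewrite !(plus_INR, mult_INR) /=; field; lra.
have I1 : 0 <= INR i / INR k by apply: Rdiv_le_0_compat => //; apply: pos_INR.
have I2 : INR i / INR k < 1 by apply/Rlt_div_l => //; rewrite Rmult_1_l; apply: lt_INR.
lra.
Qed.

(** On a period of length [2k] the value of [nu (m/k)] is 0 for the first k integers
    and 1 for the last k, so the sum telescopes to the odd-even pairs of eta. *)
Lemma nu_sum s k Q : (0 < k)%nat ->
  Csum (fun m => nu (INR m / INR k) * npow_step s m)%C (2 * k * Q) = (npow k s * eta_part Q s)%C.
Proof.
move=> Hk; elim: Q => [|Q IH]; first by rewrite Nat.mul_0_r /eta_part /=; ring.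
have -> : (2 * k * S Q = 2 * k * Q + (k + k))%nat by lia.
rewrite Csum_app IH Csum_app.
rewrite (Csum_ext _ (fun _ => 0%C) k); last first.
  by move=> i Hi; rewrite nu_even_block //; ring.
rewrite Csum_0 (Csum_ext _ (fun i => npow_step s (2 * k * Q + k + i)) k); last first.
  by move=> i Hi; rewrite Nat.add_assoc nu_odd_block //; ring.
rewrite Csum_npow_step /eta_part /=.
have -> : ((k + (k + 0)) * Q + k = k * (Q + (Q + 0) + 1))%nat by lia.
have -> : (k * (Q + (Q + 0) + 1) + k = k * (Q + (Q + 0) + 2))%nat by lia.
rewrite !npow_mult; try lia; ring.
Qed.

Definition mobius_part (n : nat) (s : C) : C :=
  Csum (fun i => mobius (S i) * npow (S i) s)%C n.

Lemma holo_mobius_part n s : holo_at (mobius_part n) s.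
Proof.
rewrite /mobius_part; elim: n => [|n IH]; first exact: holo_const.
apply: holo_plus => //; apply: holo_mult; [exact: holo_const|exact: holo_npow].
Qed.

Lemma fact_divides n k : (1 <= k <= n)%nat -> fact n = (k * (fact n / k))%nat.
Proof.
move=> Hk.
have [q Hq] : Nat.divide k (fact n).
  elim: n Hk => [|n IH] Hk; first lia.
  case: (Nat.eq_dec k (S n)) => [->|Hne]; first by exists (fact n); rewrite /=; lia.
  have [q Hq] := IH ltac:(lia); exists (S n * q)%nat; rewrite -[fact (S n)]/(S n * fact n)%nat Hq; lia.
by rewrite Hq Nat.div_mul; lia.
Qed.

(** Sum up to a common multiple of all the periods [2k], and use the known values of
    the step function below n. *)
Lemma finite_identity a s J :
  let n := S (S a) in let M := (2 * (S J * fact n))%nat in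
  Csum (fun i => step_value n (n + i) * npow_step s (n + i))%C (M - n) =
  (Csum (fun i => mobius (S i) * (npow (S i) s * eta_part (S J * (fact n / S i)) s)) n
   - npow M s - (1 - 2 * npow 2 s))%C.
Proof.
move=> n M.
have Hfact k : (k <= fact k)%nat.
  elim: k => [|k IH]; first by lia.
  have := lt_O_fact k; rewrite -[fact (S k)]/(S k * fact k)%nat; nia.
have HM : (n <= M)%nat by rewrite /M; move: (Hfact n); nia.
have L : Csum (fun m => step_value n m * npow_step s m)%C M =
  (npow 0 s - npow M s + Csum (fun i => mobius (S i) * (npow (S i) s * eta_part (S J * (fact n / S i)) s)) n)%C.
  transitivity (Csum (fun m => npow_step s (0 + m) +
      Csum (fun i => mobius (S i) * (nu (INR m / INR (S i)) * npow_step s m)) n)%C M).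
    apply: Csum_ext => m _; rewrite /step_value sum_n_m_eq_Rsum RtoC_plus RtoC_Rsum.
    rewrite Cmult_plus_distr_r Nat.add_0_l Cmult_1_l; congr Cplus.
    rewrite Cmult_comm -Csum_scal; apply: Csum_ext => i _; rewrite RtoC_mult; ring.
  rewrite Csum_plus Csum_npow_step Nat.add_0_l; congr Cplus.
  rewrite Csum_swap; apply: Csum_ext => i Hi.
  rewrite Csum_scal; congr Cmult.
  rewrite -nu_sum; last lia.
  congr Csum; rewrite /M {1}(fact_divides n (S i)); lia.
have R : Csum (fun m => step_value n m * npow_step s m)%C M =
  (npow 0 s - 1 + 2 * (1 - npow 2 s) + Csum (fun i => step_value n (n + i) * npow_step s (n + i)) (M - n))%C.
  have -> : M = (n + (M - n))%nat by lia.
  rewrite Csum_app; congr Cplus; last by congr Csum; lia.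
  rewrite -[n]/(2 + a)%nat Csum_app (Csum_ext _ (fun _ => 0%C) a); last first.
    by move=> i Hi; rewrite step_value_small /=; try lia; ring.
  rewrite Csum_0 /= -/(step_value n 0) (step_value_small (S (S a)) 1); try lia.
  have -> : step_value (S (S a)) 0 = 1.
    rewrite /step_value sum_n_m_eq_Rsum.
    have -> k : Rsum (fun i => mobius (S i) * nu (INR 0 / INR (S i))) k = 0.
      elim: k => [//|k IH]; cbn [Rsum]; rewrite IH.
      have -> : nu (INR 0 / INR (S k)) = 0.
        have := nu_even_block 0 (S k) 0 ltac:(lia).
        by have -> : (2 * S k * 0 + 0 = 0)%nat by lia.
      ring.
    ring.
  by rewrite /= /npow_step npow_1; ring.
rewrite L in R; move: R; set X := Csum _ (M - n); set Y := Csum _ n => R.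
have -> : X = (npow 0 s - npow M s + Y - (npow 0 s - 1 + 2 * (1 - npow 2 s)))%C by rewrite R; ring.
rewrite RtoC_2; ring.
Qed.

(** In [finite_identity] the partial sums of eta converge and [npow M s] tends to
    0. *)
Lemma tail_limit a s : 0 < Re s ->
  let n := S (S a) in
  Ccvg (fun J => Csum (fun i => step_value n (n + i) * npow_step s (n + i))%C
          (2 * (S J * fact n) - n))
    (eta s * mobius_part n s - (1 - 2 * npow 2 s))%C.
Proof.
move=> Hs n.
apply: (Ccvg_ext _ _ _ (fun J => eq_sym (finite_identity a s J))).
rewrite -/n; apply: Ccvg_minus; last exact: Ccvg_const.
have -> : (eta s * mobius_part n s = eta s * mobius_part n s - 0)%C by ring.
apply: Ccvg_minus.
  rewrite /mobius_part -Csum_scal; apply: Ccvg_Csum => i Hi.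
  have -> : (eta s * (mobius (S i) * npow (S i) s) = (mobius (S i) * npow (S i) s) * eta s)%C by ring.
  apply: (Ccvg_ext (fun J => (mobius (S i) * npow (S i) s) * eta_part (S J * (fact n / S i)) s)%C).
    by move=> J; ring.
  apply: Ccvg_scal.
  apply: (Ccvg_subseq (fun M => eta_part M s) _ (fun J => (S J * (fact n / S i))%nat)); last first.
    by case: (eta_spec s Hs).
  move=> J; have := fact_divides n (S i) ltac:(lia).
  have := lt_O_fact n; case: (fact n / S i)%nat => [|q]; nia.
apply: (is_lim_seq_ext (fun J => (fun k => Rpower (INR (S k)) (- Re s)) (2 * (S J * fact n) - 1)%nat)).
  move=> J; have -> (z : C) : (z - 0 = z)%C by ring.
  by rewrite Cmod_npow; congr Rpower; congr INR; have := lt_O_fact n; nia.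
apply: (is_lim_seq_subseq (fun k => Rpower (INR (S k)) (- Re s)) _
  (fun J => (2 * (S J * fact n) - 1)%nat)); last exact: Rpower_lim_0.
move=> P [N HN]; exists N => J HJ; apply: HN; have := lt_O_fact n; nia.
Qed.

(** * No zeros to the right of the critical line *)

(** The difference is the integral for u from [ln m] to [ln (m+1)] of [exp (-s u) (h
    e^(-hu) + s (e^(-hu) - 1))]. The factor u coming from [1 - e^(-hu) <= h u] is
    absorbed by lowering the exponent from [Re s] to [tau]. The bound is linear in
    h. *)
Lemma npow_step_shift_bound n s h tau : 0 <= tau -> tau < Re s -> 0 <= h ->
  Cmod (npow_step (s + RtoC h)%C (S n) - npow_step s (S n)) <=
    (h * (1 + Cmod s / (Re s - tau))) * Rpower (INR (S n)) (- tau - 1).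
Proof.
move=> Ht Hts Hh.
have [HL1 HL2] := ln_succ_bounds n; have Hp := INR_S_pos n; have Hp2 := INR_S_pos (S n).
set u := ln (INR (S n)) in HL1 HL2; set L := ln (INR (S (S n))) - u in HL1 HL2.
have HL : 0 <= L by move: (Rinv_0_lt_compat _ Hp2); lra.
have Hu : 0 <= u.
  by rewrite /u -ln_1; apply: ln_le; [lra|rewrite S_INR; move: (pos_INR n); lra].
have I1 := is_RInt_Cexp (- (s + h) * RtoC u) (- (s + h) * RtoC L).
have I2 := is_RInt_Cexp (- s * RtoC u) (- s * RtoC L).
have I3 := is_RInt_minus (V := C_R_NormedModule) _ _ _ _ _ _ I2 I1.
set e := Re s - tau.
have He : 0 < e by rewrite /e; lra.
have Q : Cmod (npow_step (s + h)%C (S n) - npow_step s (S n)) <=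
   (1 - 0) * (L * (exp (- tau * u) * (h * (1 + Cmod s / e)))).
  have E : (npow_step (s + h)%C (S n) - npow_step s (S n))%C =
     minus (G := C_R_NormedModule) (Cexp (- s * RtoC u + - s * RtoC L) - Cexp (- s * RtoC u))%C
       (Cexp (- (s + h) * RtoC u + - (s + h) * RtoC L) - Cexp (- (s + h) * RtoC u))%C :> C.
    change (npow_step (s + h)%C (S n) - npow_step s (S n) = (Cexp (- s * RtoC u + - s * RtoC L) - Cexp (- s * RtoC u))
       - (Cexp (- (s + h) * RtoC u + - (s + h) * RtoC L) - Cexp (- (s + h) * RtoC u)))%C.
    have EL : ln (INR (S (S n))) = u + L by rewrite /L; ring.
    rewrite /npow_step /npow -/u EL RtoC_plus.
    rewrite !Cmult_plus_distr_l; ring.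
  rewrite E Cmod_norm.
  apply: (norm_RInt_le_const (V := C_R_NormedModule)) I3; first lra.
  move=> t Htt; rewrite -Cmod_norm.
  set v := u + t * L.
  have Hv : u <= v by rewrite /v; nra.
  have -> : minus (G := C_R_NormedModule) (- s * RtoC L * Cexp (- s * RtoC u + t * (- s * RtoC L)))%C
       (- (s + h) * RtoC L * Cexp (- (s + h) * RtoC u + t * (- (s + h) * RtoC L)))%C =
     (RtoC L * (Cexp (- s * RtoC v) * (h * Cexp (RtoC (- h * v)) + s * (Cexp (RtoC (- h * v)) - 1))))%C.
    change (- s * RtoC L * Cexp (- s * RtoC u + t * (- s * RtoC L))
       - (- (s + h) * RtoC L * Cexp (- (s + h) * RtoC u + t * (- (s + h) * RtoC L))) =
      (RtoC L * (Cexp (- s * RtoC v) * (h * Cexp (RtoC (- h * v)%R) + s * (Cexp (RtoC (- h * v)%R) - 1)))))%C.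
    have -> : (- s * RtoC u + t * (- s * RtoC L) = - s * RtoC v)%C.
      rewrite /v RtoC_plus RtoC_mult; ring.
    have -> : (- (s + h) * RtoC u + t * (- (s + h) * RtoC L) = - s * RtoC v + RtoC (- h * v)%R)%C.
      rewrite /v RtoC_mult RtoC_plus RtoC_mult RtoC_opp; ring.
    rewrite Cexp_plus; ring.
  rewrite !Cmod_mult Cmod_R Rabs_pos_eq //; apply: Rmult_le_compat_l => //.
  rewrite Cmod_Cexp.
  have -> : Re (- s * v)%C = - tau * v + - (e * v) by rewrite /e /Re /=; ring.
  rewrite exp_plus Rmult_assoc.
  have Ev : exp (- tau * v) <= exp (- tau * u).
    have : - tau * v <= - tau * u by nra.
    by case=> [/exp_increasing|->]; lra.
  apply: Rmult_le_compat; [exact: Rlt_le (exp_pos _)| |exact: Ev|].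
    by apply: Rmult_le_pos; [exact: Rlt_le (exp_pos _)|exact: Cmod_ge_0].
  have B1 : Cmod (h * Cexp (RtoC (- h * v)) + s * (Cexp (RtoC (- h * v)) - 1)) <= h + Cmod s * (h * v).
    apply: Rle_trans (Cmod_triangle _ _) _; rewrite !Cmod_mult Cmod_R Rabs_pos_eq //.
    have X : - h * v <= 0 by nra.
    have X2 : exp (- h * v) <= 1 by rewrite -exp_0; case: X => [/exp_increasing|->]; lra.
    apply: Rplus_le_compat.
      by rewrite Cexp_RtoC Cmod_R Rabs_pos_eq; [nra|exact: Rlt_le (exp_pos _)].
    apply: Rmult_le_compat_l; first exact: Cmod_ge_0.
    rewrite Cexp_RtoC -RtoC_minus Cmod_R Rabs_left1; last lra.
    have := exp_ineq1_le (- h * v); lra.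
  have E1 : exp (- (e * v)) * (1 + e * v) <= 1.
    have := exp_ineq1_le (e * v) => H; have P := exp_pos (- (e * v)).
    have : exp (- (e * v)) * exp (e * v) = 1 by rewrite -exp_plus Rplus_opp_l exp_0.
    nra.
  have Pe := exp_pos (- (e * v)).
  apply: Rle_trans (Rmult_le_compat_l _ _ _ (Rlt_le _ _ Pe) B1) _.
  have ev : 0 <= e * v by nra.
  have E2 : exp (- (e * v)) <= 1 by nra.
  have E3 : exp (- (e * v)) * v <= / e.
    have : (exp (- (e * v)) * v) * e <= 1 by nra.
    by move=> H; apply: (Rmult_le_reg_r e) => //; rewrite Rinv_l; lra.
  have Cs := Cmod_ge_0 s.
  have : Cmod s * h * (exp (- (e * v)) * v) <= Cmod s * h * / e.
    by apply: Rmult_le_compat_l => //; nra.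
  rewrite /Rdiv; nra.
apply: Rle_trans Q _.
rewrite Rminus_0_r Rmult_1_l Rpower_minus_1 // /Rpower -/u -/e.
have D : 0 <= h * (1 + Cmod s / e).
  apply: Rmult_le_pos => //.
  have : 0 <= Cmod s / e by apply: Rdiv_le_0_compat => //; exact: Cmod_ge_0.
  lra.
set D' := h * _ in D *; have P := exp_pos (- tau * u).
have : L * (exp (- tau * u) * D') <= / INR (S n) * (exp (- tau * u) * D').
  by apply: Rmult_le_compat_r => //; nra.
lra.
Qed.

(** Fix [Lam] so large that [A / Lam < x], then take n with [Lam * I n] small compared
    with x. *)
Lemma eq0_of_small (x A : R) (I : nat -> R) : 0 <= x -> is_lim_seq I 0 ->
  (forall n Lam, 0 < Lam -> x <= (Lam * I n + A / Lam) / 2) -> x = 0.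
Proof.
move=> Hx HI H; case: Hx => // Hx; exfalso.
set Lam := (Rabs A + 1) / x.
have HA := Rabs_pos A.
have HL : 0 < Lam by apply: Rdiv_lt_0_compat; lra.
have He : 0 < x / (2 * Lam) by apply: Rdiv_lt_0_compat; lra.
have [N HN] := proj2 (is_lim_seq_spec _ _) HI (mkposreal _ He).
have := HN N (le_n _); rewrite /= Rminus_0_r => H1.
have H2 : Lam * I N <= x / 2.
  have -> : x / 2 = Lam * (x / (2 * Lam)) by field; lra.
  by apply: Rmult_le_compat_l; [lra|have := Rle_abs (I N); lra].
have H3 : A / Lam <= x.
  apply/Rle_div_l => //; have -> : x * Lam = Rabs A + 1 by rewrite /Lam; field; lra.
  by have := Rle_abs A; lra.
have := H N Lam HL; lra.
Qed.

(** At a zero, [tail_limit] with [tail_sum_bound] gives [2^(1-s) = 1]. Then for [0 < h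
    <= 1] the difference of the tails at [s+h] and [s] is [(1 - 2^(-h)) (zeta(s+h)
    M(s+h) - 1)], with M the Dirichlet polynomial of mu, and is [O(h)] times a
    quantity that vanishes with the integral. Dividing by h and letting h tend to 0
    contradicts [zeta(s) = 0]. *)
Theorem zeta_nonzero_right zeta s : is_riemann_zeta zeta ->
  is_lim_seq (fun n => tail_integral n) 0 ->
  1 / 2 < Re s -> s <> 1%C -> zeta s <> 0%C.
Proof.
move=> Hz HI Hs Hs1 Hzero.
have HI2 : is_lim_seq (fun a => tail_integral (S (S a))) 0.
  apply: is_lim_seq_ext (proj1 (is_lim_seq_incr_n tail_integral 2 0) HI) => n.
  by congr tail_integral; lia.
have Heta : eta s = 0%C by rewrite (eta_zeta zeta) // ?Hzero; [ring|lra].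
(* the factor [1 - 2^(1-s)] of eta vanishes as well *)
have Hq : (1 - 2 * npow 2 s)%C = 0%C.
  apply: Cmod_eq_0.
  apply: (eq0_of_small _ (2 * Cmod s ^ 2 / (2 * Re s - 1)) _ (Cmod_ge_0 _) HI2) => a Lam HL.
  have := tail_limit a s ltac:(lra).
  rewrite Heta => Hlim; rewrite -Cmod_opp.
  have -> : (- (1 - 2 * npow 2 s) = 0 * mobius_part (S (S a)) s - (1 - 2 * npow 2 s))%C by ring.
  apply: Ccvg_le Hlim _ => J.
  apply: (tail_sum_bound a (npow_step s) (Cmod s) (Re s)) => //; first exact: Cmod_ge_0.
  by move=> m; apply: npow_diff_bound; lra.
set tau := (Re s + 1 / 2) / 2.
have Htau : 1 / 2 < tau < Re s by rewrite /tau; lra.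
set c := 1 + Cmod s / (Re s - tau).
have Hc : 0 <= c.
  have : 0 <= Cmod s / (Re s - tau) by apply: Rdiv_le_0_compat; [exact: Cmod_ge_0|lra].
  rewrite /c; lra.
set A := 2 * c ^ 2 / (2 * tau - 1).
(* the parameter of [tail_sum_bound] is [lam h], which makes both of its terms linear in h *)
have key a h lam : 0 < lam -> 0 < h <= 1 ->
  Cmod (zeta (s + RtoC h)%C * mobius_part (S (S a)) (s + RtoC h) - 1) <=
    2 * (lam * tail_integral (S (S a)) + A / lam).
  move=> Hlam Hh.
  have Hsh : Re (s + RtoC h)%C = Re s + h by rewrite /Re /=; ring.
  have Hne : (s + RtoC h)%C <> 1%C.
    move=> E; have Es : s = RtoC (1 - h) by rewrite RtoC_minus -E; ring.
    move: Hq; rewrite Es npow_real -RtoC_mult -RtoC_minus => /RtoC_inj.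
    have -> : 2 * Rpower (INR 2) (- (1 - h)) = Rpower 2 h.
      rewrite -{1}(Rpower_1 2); last lra.
      rewrite -Rpower_plus; congr Rpower; ring.
    have : 1 < Rpower 2 h by rewrite -(Rpower_O 2); [apply: Rpower_lt; lra|lra].
    lra.
  have L1 := tail_limit a (s + RtoC h)%C ltac:(lra).
  have L0 := tail_limit a s ltac:(lra).
  have L := Ccvg_minus _ _ _ _ L1 L0.
  set q := (1 - npow 2 (RtoC h))%C.
  have Eq : (1 - 2 * npow 2 (s + RtoC h))%C = q.
    rewrite /q npow_plus.
    replace (1 - 2 * (npow 2 s * npow 2 (RtoC h)))%C with
      (1 - npow 2 (RtoC h) + (1 - 2 * npow 2 s) * npow 2 (RtoC h))%C by ring.
    rewrite Hq; ring.
  have Elim : (eta (s + RtoC h) * mobius_part (S (S a)) (s + RtoC h) - (1 - 2 * npow 2 (s + RtoC h))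
      - (eta s * mobius_part (S (S a)) s - (1 - 2 * npow 2 s)) =
      q * (zeta (s + RtoC h) * mobius_part (S (S a)) (s + RtoC h) - 1))%C.
    rewrite Heta Hq (eta_zeta zeta) // ?Eq; [ring|lra].
  rewrite Elim in L.

  have {}B : Cmod (q * (zeta (s + RtoC h)%C * mobius_part (S (S a)) (s + RtoC h) - 1)) <=
     (lam * h * tail_integral (S (S a)) + 2 * (h * c) ^ 2 / (2 * tau - 1) / (lam * h)) / 2.
    apply: Ccvg_le L _ => J.
    set K := (2 * (S J * fact (S (S a))) - S (S a))%nat.
    have := tail_sum_bound a (fun m => npow_step (s + RtoC h) m - npow_step s m)%C (h * c) tau (lam * h) K.
    have -> : Csum (fun i => step_value (S (S a)) (S (S a) + i) *
        (npow_step (s + RtoC h) (S (S a) + i) - npow_step s (S (S a) + i)))%C K =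
      (Csum (fun i => step_value (S (S a)) (S (S a) + i) * npow_step (s + RtoC h) (S (S a) + i)) K -
       Csum (fun i => step_value (S (S a)) (S (S a) + i) * npow_step s (S (S a) + i)) K)%C.
      by elim: K => [|K IH]; cbn [Csum]; [ring|rewrite IH; ring].
    apply; try nra.
    by move=> m; apply: npow_step_shift_bound; lra.
  rewrite Cmod_mult in B.
  have Hqh : h / 4 <= Cmod q.
    rewrite /q npow_real -RtoC_minus Cmod_R.
    apply: Rle_trans (Rle_abs _); rewrite /Rpower.
    have -> : INR 2 = 2 by rewrite /=; ring.
    have l2 := ln_lt_2.
    have l2' : ln 2 <= 1 by have := exp_ineq1_le (ln 2); rewrite exp_ln; lra.
    set x := h * ln 2; have -> : - h * ln 2 = - x by rewrite /x; ring.
    have Hx : 0 < x <= 1 by rewrite /x; nra.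
    have E1 : 1 + x <= exp x by apply: exp_ineq1_le.
    have E2 : exp (- x) * exp x = 1 by rewrite -exp_plus Rplus_opp_l exp_0.
    have P := exp_pos (- x).
    have : exp (- x) * (1 + x) <= 1 by nra.
    have : x * 2 >= h by rewrite /x; nra.
    nra.
  set W := Cmod (zeta (s + RtoC h)%C * _ - 1) in B *.
  have HW : 0 <= W by apply: Cmod_ge_0.
  have E : (lam * h * tail_integral (S (S a)) + 2 * (h * c) ^ 2 / (2 * tau - 1) / (lam * h)) / 2 =
     h / 4 * (2 * (lam * tail_integral (S (S a)) + A / lam)).
    by rewrite /A; field; lra.
  rewrite E in B.
  have : h / 4 * W <= h / 4 * (2 * (lam * tail_integral (S (S a)) + A / lam)) by nra.
  by apply: Rmult_le_reg_l; lra.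
have key0 a lam : 0 < lam -> 1 <= (lam * (4 * tail_integral (S (S a))) + 4 * A / lam) / 2.
  move=> Hlam; apply: Rnot_lt_le => Hlt.
  set b := 2 * (lam * tail_integral (S (S a)) + A / lam).
  have Hb : b < 1 by rewrite /b; move: Hlt; rewrite /Rdiv; lra.
  have Hcont : cont_at (fun z => zeta z * mobius_part (S (S a)) z)%C s.
    apply: holo_cont; apply: holo_mult; last exact: holo_mobius_part.
    by apply: ex_derive_holo_at; apply: (proj2 Hz).
  have [d [Hd Hdd]] := Hcont (1 - b) ltac:(lra).
  set h := Rmin 1 (d / 2).
  have Hh : 0 < h <= 1 by split; [apply: Rmin_pos; lra|apply: Rmin_l].
  have Hhd : h < d by apply: Rle_lt_trans (Rmin_r _ _) _; lra.
  have := Hdd (s + RtoC h)%C.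
  have -> : (s + RtoC h - s = RtoC h)%C by ring.
  rewrite Cmod_R Rabs_pos_eq; last lra.
  move=> /(_ Hhd); rewrite Hzero.
  have -> : (zeta (s + RtoC h)%C * mobius_part (S (S a)) (s + RtoC h) - 0 * mobius_part (S (S a)) s =
    zeta (s + RtoC h)%C * mobius_part (S (S a)) (s + RtoC h))%C by ring.
  have := key a h lam Hlam Hh; rewrite -/b.
  set w := (zeta (s + RtoC h)%C * _)%C.
  have := Cmod_le_sub 1%C w; rewrite Cmod_1 Cmod_sub_sym; lra.
have HI4 : is_lim_seq (fun a => 4 * tail_integral (S (S a))) 0.
  by have := is_lim_seq_scal_l _ 4 _ HI2; rewrite /= Rmult_0_r.
by have := eq0_of_small 1 (4 * A) _ Rle_0_1 HI4 key0; lra.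
Qed.

(** * Sums with the periodic weights 0, 1, -2, 1 *)

(** Four consecutive terms weighted by 0, 1, -2, 1. Grouping them makes the series
    below converge absolutely for monotone [f]. *)
Definition block (f : nat -> R) (q : nat) : R :=
  f (4 * q + 1)%nat - 2 * f (4 * q + 2)%nat + f (4 * q + 3)%nat.

Lemma block_scal c f q : block (fun n => c * f n) q = c * block f q.
Proof. rewrite /block; ring. Qed.

Lemma block_ext f g q : (forall k, (4 * q < k < 4 * q + 4)%nat -> f k = g k) -> block f q = block g q.
Proof. by move=> H; rewrite /block !H //; lia. Qed.

Lemma block_lim (u : nat -> nat -> R) (l : nat -> R) q :
  (forall k, (4 * q < k < 4 * q + 4)%nat -> is_lim_seq (fun p => u p k) (l k)) ->
  is_lim_seq (fun p => block (u p) q) (block l q).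
Proof.
move=> H.
apply: is_lim_seq_plus'; last by apply: H; lia.
apply: is_lim_seq_minus'; first by apply: H; lia.
by apply: lim_scal; apply: H; lia.
Qed.

Lemma block_Rsum (c : nat -> nat -> R) q J :
  block (fun k => Rsum (fun j => c j k) J) q = Rsum (fun j => block (c j) q) J.
Proof.
elim: J => [|J IH]; first by rewrite /block /=; ring.
by cbn [Rsum]; rewrite -IH /block; cbn [Rsum]; ring.
Qed.

Definition decreasing_pos (u : nat -> R) : Prop :=
  forall n, (1 <= n)%nat -> 0 <= u (S n) <= u n.

(** [u1 - 2 u2 + u3] is the difference of two consecutive decrements, hence at most
    [u1 - u5] in absolute value, which telescopes. *)
Lemma block_partial_bound u a k : decreasing_pos u ->
  Rabs (Rsum (block u) (a + k) - Rsum (block u) a) <= u (4 * a + 1)%nat - u (4 * (a + k) + 1)%nat.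
Proof.
move=> H; elim: k => [|k IH].
  by rewrite Nat.add_0_r !Rminus_diag Rabs_R0; lra.
rewrite -plus_n_Sm; cbn [Rsum].
set q := (a + k)%nat in IH *.
have -> : (4 * S q + 1 = S (S (S (S (4 * q + 1)))))%nat by lia.
have E2 : (4 * q + 2 = S (4 * q + 1))%nat by lia.
have E3 : (4 * q + 3 = S (S (4 * q + 1)))%nat by lia.
have H1 := H (4 * q + 1)%nat ltac:(lia).
have H2 := H (S (4 * q + 1)) ltac:(lia).
have H3 := H (S (S (4 * q + 1))) ltac:(lia).
have H4 := H (S (S (S (4 * q + 1)))) ltac:(lia).
have HB : Rabs (block u q) <= u (4 * q + 1)%nat - u (S (S (S (S (4 * q + 1))))).
  by rewrite /block E2 E3; apply: Rabs_le; lra.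
have -> : Rsum (block u) q + block u q - Rsum (block u) a =
   (Rsum (block u) q - Rsum (block u) a) + block u q by ring.
apply: Rle_trans (Rabs_triang _ _) _; lra.
Qed.

Lemma decreasing_pos_ge_0 u n : decreasing_pos u -> (1 <= n)%nat -> 0 <= u n.
Proof. by move=> H Hn; have := H n Hn; lra. Qed.

Lemma block_tail u l Q : decreasing_pos u -> is_lim_seq (Rsum (block u)) (Finite l) ->
  Rabs (l - Rsum (block u) Q) <= u (4 * Q + 1)%nat.
Proof.
move=> H Hl.
have L : is_lim_seq (fun k => Rabs (Rsum (block u) (k + Q) - Rsum (block u) Q)) (Rabs (l - Rsum (block u) Q)).
  apply: (is_lim_seq_abs _ (l - Rsum (block u) Q)).
  apply: is_lim_seq_minus'; last exact: is_lim_seq_const.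
  exact (proj1 (is_lim_seq_incr_n (Rsum (block u)) Q l) Hl).
suff : Rbar_le (Rabs (l - Rsum (block u) Q)) (u (4 * Q + 1)%nat) by [].
apply: is_lim_seq_le L (is_lim_seq_const _) => k.
have := block_partial_bound u Q k H; rewrite Nat.add_comm.
have := decreasing_pos_ge_0 u (4 * (k + Q) + 1) H ltac:(lia); lra.
Qed.

Lemma block_ex_lim u : decreasing_pos u -> is_lim_seq u 0 ->
  exists l, is_lim_seq (Rsum (block u)) (Finite l).
Proof.
move=> H H0.
exists (real (Lim_seq (Rsum (block u)))).
apply: (Cauchy_lim _ (fun n => u (4 * n + 1)%nat)).
  apply: (is_lim_seq_subseq u _ (fun n => (4 * n + 1)%nat)) => //.
  by move=> P [N HN]; exists N => n Hn; apply: HN; lia.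
move=> n m Hnm; have -> : m = (n + (m - n))%nat by lia.
have := block_partial_bound u n (m - n) H.
have := decreasing_pos_ge_0 u (4 * (n + (m - n)) + 1) H ltac:(lia); lra.
Qed.

(** Passage to the limit under the sum. Monotonicity replaces a dominating series: the
    tail beyond Q is at most the first omitted term, and this term converges to [v (4
    Q + 1)]. *)
Lemma Tannery_block (u : nat -> nat -> R) (v : nat -> R) (X : nat -> R) (T : R) :
  (forall p, decreasing_pos (u p)) ->
  (forall n, (1 <= n)%nat -> is_lim_seq (fun p => u p n) (v n)) ->
  is_lim_seq v 0 ->
  (forall p, is_lim_seq (Rsum (block (u p))) (X p)) ->
  is_lim_seq (Rsum (block v)) T ->
  is_lim_seq X T.
Proof.
move=> Hu Hv Hv0 HS HT.
have Hvd : decreasing_pos v.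
  move=> n Hn; split.
    suff : Rbar_le 0 (v (S n)) by [].
    apply: is_lim_seq_le (is_lim_seq_const 0) (Hv (S n) ltac:(lia)) => p.
    by have := Hu p n Hn; lra.
  suff : Rbar_le (v (S n)) (v n) by [].
  apply: is_lim_seq_le (Hv (S n) ltac:(lia)) (Hv n Hn) => p.
  by have := Hu p n Hn; lra.
apply/is_lim_seq_spec => eps; have He := cond_pos eps.
have He4 : 0 < eps / 4 by lra.
have [Q HQ] : exists Q, v (4 * Q + 1)%nat < eps / 4.
  have [N HN] := proj2 (is_lim_seq_spec _ _) Hv0 (mkposreal _ He4).
  exists N; have := HN (4 * N + 1)%nat ltac:(lia); rewrite /= Rminus_0_r => H.
  by apply: Rle_lt_trans (Rle_abs _) H.
have L1 : is_lim_seq (fun p => Rsum (block (u p)) Q) (Rsum (block v) Q).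
  by apply: (is_lim_Rsum (fun p => block (u p))) => i Hi; apply: block_lim => k Hk; apply: Hv; lia.
have [N1 HN1] := proj2 (is_lim_seq_spec _ _) L1 (mkposreal _ He4).
have [N2 HN2] := proj2 (is_lim_seq_spec _ _) (Hv (4 * Q + 1)%nat ltac:(lia)) (mkposreal _ He4).
exists (N1 + N2)%nat => p Hp.
have A1 := HN1 p ltac:(lia); have A2 := HN2 p ltac:(lia).
rewrite [pos _]/= in A1; rewrite [pos _]/= in A2.
have B1 := block_tail _ _ Q (Hu p) (HS p); have B2 := block_tail _ _ Q Hvd HT.
have {}A2 := Rabs_def2 _ _ A2; have {}A1 := Rabs_def2 _ _ A1.
move: B1 => /Rabs_le_between B1; move: B2 => /Rabs_le_between B2.
by apply: Rabs_def1; lra.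
Qed.

(** * Discrete Fourier transform of the weights *)

(** Multiplied by [2 sin (x/2)] the sum of cosines telescopes. *)
Lemma sum_cos_progression x b N :
  2 * sin (x / 2) * Rsum (fun q => cos (INR q * x + b)) N =
  sin ((INR N - 1 / 2) * x + b) - sin (b - x / 2).
Proof.
elim: N => [|N IH]; cbn [Rsum].
  rewrite /= Rmult_0_r; have -> : (0 - 1 / 2) * x + b = b - x / 2 by field.
  ring.
rewrite Rmult_plus_distr_l IH S_INR.
have -> : (INR N + 1 - 1 / 2) * x + b = (INR N * x + b) + x / 2 by field.
have -> : (INR N - 1 / 2) * x + b = (INR N * x + b) - x / 2 by field.
rewrite sin_plus sin_minus; ring.
Qed.

Lemma sum_cos_roots_zero N j b : (1 <= N)%nat -> ~ Nat.divide N j ->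
  Rsum (fun q => cos (INR q * (2 * PI * INR j / INR N) + b)) N = 0.
Proof.
move=> HN Hj.
have Np : 0 < INR N by apply: lt_0_INR.
set x := 2 * PI * INR j / INR N.
have Hs : sin (x / 2) <> 0.
  move=> /sin_eq_0_0 [k Hk]; apply: Hj.
  have Pi := PI_RGT_0.
  have E : INR j = IZR k * INR N.
    have : x / 2 * INR N = IZR k * PI * INR N by rewrite Hk.
    have -> : x / 2 * INR N = INR j * PI by rewrite /x; field; lra.
    move=> H; apply: (Rmult_eq_reg_r PI); lra.
  rewrite !INR_IZR_INZ -mult_IZR in E; have {}E := eq_IZR _ _ E.
  by exists (Z.to_nat k); nia.
have := sum_cos_progression x b N.
have -> : (INR N - 1 / 2) * x + b = (b - x / 2) + 2 * INR j * PI by rewrite /x; field; lra.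
rewrite sin_period Rminus_diag => H.
have H2 : 2 * sin (x / 2) <> 0 by lra.
by case: (Rmult_integral _ _ H).
Qed.

Lemma block_cos_not_multiple N j : (1 <= N)%nat -> ~ Nat.divide N j ->
  Rsum (block (fun k => cos (INR j * (PI * INR k / (2 * INR N))))) N = 0.
Proof.
move=> HN Hj.
have Np : 0 < INR N by apply: lt_0_INR.
rewrite /block.
have E (t : nat) : Rsum (fun q => cos (INR j * (PI * INR (4 * q + t) / (2 * INR N)))) N = 0.
  rewrite -(sum_cos_roots_zero N j (INR j * (PI * INR t / (2 * INR N))) HN Hj).
  apply: Rsum_ext => q _; congr cos; rewrite plus_INR mult_INR /=; field; lra.
rewrite Rsum_plus E Rplus_0_r.
rewrite (Rsum_ext _ (fun q => cos (INR j * (PI * INR (4 * q + 1) / (2 * INR N))) +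
   -2 * cos (INR j * (PI * INR (4 * q + 2) / (2 * INR N))))); last by move=> i _; ring.
by rewrite Rsum_plus Rsum_scal !E; ring.
Qed.

(** The weights of [block] as a function mod 4. Its Dirichlet series is [(1 - 2^(-s))
    eta s]; it is even, has mean 0 and vanishes at 0, which is why the frequency 0 and
    the term n = 0 are absent from the identities below. *)
Definition chi (n : nat) : R :=
  match Nat.modulo n 4 with 1%nat | 3%nat => 1 | 2%nat => -2 | _ => 0 end.

Lemma chi_mod q t : (t < 4)%nat -> chi (4 * q + t) = chi t.
Proof.
move=> Ht; rewrite /chi; have -> : (4 * q + t = t + q * 4)%nat by lia.
by rewrite Nat.Div0.mod_add.
Qed.

Lemma block_chi f Q : Rsum (block f) Q = Rsum (fun n => chi n * f n) (4 * Q).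
Proof.
elim: Q => [//|Q IH].
have -> : (4 * S Q = 4 * Q + 4)%nat by lia.
rewrite Rsum_app -IH; cbn [Rsum]; rewrite !chi_mod; try lia.
by rewrite /block /chi /= ; ring.
Qed.

(** The weights are an eigenvector of the Fourier transform mod 4. *)
Lemma chi_fourier n :
  cos (INR n * (PI * 1 / 2)) - 2 * cos (INR n * (PI * 2 / 2)) + cos (INR n * (PI * 3 / 2)) = 2 * chi n.
Proof.
have E := Nat.div_mod_eq n 4; set q := (n / 4)%nat in E.
have Hr : (n mod 4 < 4)%nat by apply: Nat.mod_upper_bound.
rewrite E chi_mod //; set t := (n mod 4)%nat in Hr *.
have C (m : nat) : INR (4 * q + t) * (PI * INR m / 2) = INR t * (PI * INR m / 2) + 2 * INR (q * m) * PI.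
  by rewrite plus_INR !mult_INR /=; field.
have -> : PI * 1 / 2 = PI * INR 1 / 2 by [].
have -> : PI * 2 / 2 = PI * INR 2 / 2 by rewrite /=; field.
have -> : PI * 3 / 2 = PI * INR 3 / 2 by rewrite /=; field.
rewrite !C !cos_period /chi.
have c1 : cos (PI / 2) = 0 := cos_PI2.
have c2 : cos PI = -1 := cos_PI.
have c3 : cos (PI + PI / 2) = 0.
  by rewrite cos_plus cos_PI2 sin_PI; ring.
have c4 : cos (2 * PI) = 1 := cos_2PI.
have c6 : cos (PI + 2 * INR 1 * PI) = -1 by rewrite cos_period.
have c8 : cos (PI / 2 + 2 * INR 2 * PI) = 0 by rewrite cos_period.
clear C E; clearbody t.
case: t Hr => [|[|[|[|t]]]] Hr; try lia.
- rewrite [INR 0]/= !Rmult_0_l cos_0 /=; ring.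
- have -> : INR 1 * (PI * INR 1 / 2) = PI / 2 by rewrite /=; field.
  have -> : INR 1 * (PI * INR 2 / 2) = PI by rewrite /=; field.
  have -> : INR 1 * (PI * INR 3 / 2) = PI + PI / 2 by rewrite /=; field.
  rewrite c1 c2 c3 /=; ring.
- have -> : INR 2 * (PI * INR 1 / 2) = PI by rewrite /=; field.
  have -> : INR 2 * (PI * INR 2 / 2) = 2 * PI by rewrite /=; field.
  have -> : INR 2 * (PI * INR 3 / 2) = PI + 2 * INR 1 * PI by rewrite /=; field.
  rewrite c2 c4 c6 /=; ring.
- have -> : INR 3 * (PI * INR 1 / 2) = PI + PI / 2 by rewrite /=; field.
  have -> : INR 3 * (PI * INR 2 / 2) = PI + 2 * INR 1 * PI by rewrite /=; field.
  have -> : INR 3 * (PI * INR 3 / 2) = PI / 2 + 2 * INR 2 * PI by rewrite /=; field.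
  rewrite c3 c6 c8 /=; ring.
Qed.

Lemma block_cos_multiple N n : (1 <= N)%nat ->
  Rsum (block (fun k => cos (INR (n * N) * (PI * INR k / (2 * INR N))))) N = 2 * INR N * chi n.
Proof.
move=> HN; have Np : 0 < INR N by apply: lt_0_INR.
rewrite (Rsum_ext _ (fun _ => 2 * chi n)).
  elim: {HN Np}N => [|M IH]; cbn [Rsum]; first by rewrite /=; ring.
  rewrite IH S_INR; ring.
move=> q _; rewrite -chi_fourier /block.
have E (t : nat) (x : R) : x = INR t -> cos (INR (n * N) * (PI * INR (4 * q + t) / (2 * INR N))) = cos (INR n * (PI * x / 2)).
  move=> ->; rewrite -(cos_period (INR n * (PI * INR t / 2)) (n * q)); congr cos.
  by rewrite plus_INR !mult_INR /=; field; lra.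
rewrite (E 1%nat 1) // (E 2%nat 2); last by rewrite /=; ring.
rewrite (E 3%nat 3) //; by rewrite /=; ring.
Qed.

(** * The binomial series on the unit disk *)

(** Coefficients of [(1-z)^(-s)]; [bincoef s N * N^(1-s)] tends to [1 / Gamma(s)]. *)
Fixpoint bincoef (s : R) (j : nat) : R :=
  match j with 0%nat => 1 | S i => bincoef s i * (s + INR i) / INR (S i) end.

Lemma bincoef_S s j : INR (S j) * bincoef s (S j) = (s + INR j) * bincoef s j.
Proof. cbn [bincoef]; field; have := INR_S_pos j; lra. Qed.

Lemma bincoef_pos s j : 0 < s -> 0 < bincoef s j.
Proof.
move=> Hs; elim: j => [|j IH]; cbn [bincoef]; first lra.
apply: Rdiv_lt_0_compat; last exact: INR_S_pos.
by apply: Rmult_lt_0_compat => //; have := pos_INR j; lra.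
Qed.

Lemma bincoef_decr s j : 0 < s <= 1 -> bincoef s (S j) <= bincoef s j.
Proof.
move=> Hs; have P := bincoef_pos s j ltac:(lra); have Q := INR_S_pos j.
cbn [bincoef]; apply/Rle_div_l => //; apply: Rmult_le_compat_l; first lra.
by rewrite S_INR; lra.
Qed.

Lemma bincoef_mono s j k : 0 < s <= 1 -> bincoef s (j + k) <= bincoef s j.
Proof.
move=> Hs; elim: k => [|k IH]; first by rewrite Nat.add_0_r; lra.
by rewrite -plus_n_Sm; apply: Rle_trans (bincoef_decr _ _ Hs) IH.
Qed.

Lemma bincoef_le_1 s j : 0 < s <= 1 -> bincoef s j <= 1.
Proof. by move=> Hs; have := bincoef_mono s 0 j Hs. Qed.

(** Let [m = x ln (1+u)] and average the tangent inequality [exp y >= exp m (1 + y -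
    m)] at [y = ln (1+u)] and [y = 0] with the weights x and 1-x. *)
Lemma bernoulli_concave u x : 0 < u -> 0 < x < 1 -> Rpower (1 + u) x <= 1 + x * u.
Proof.
move=> Hu Hx; rewrite /Rpower; set L := ln (1 + u); set m := x * L.
have E : exp L = 1 + u by rewrite exp_ln //; lra.
have M := exp_pos m.
have A1 : exp m * (1 + (L - m)) <= 1 + u.
  have := exp_ineq1_le (L - m) => H.
  have : exp m * exp (L - m) = 1 + u by rewrite -exp_plus -E; congr exp; ring.
  nra.
have A2 : exp m * (1 - m) <= 1.
  have := exp_ineq1_le (- m) => H.
  have : exp m * exp (- m) = 1 by rewrite -exp_plus Rplus_opp_r exp_0.
  nra.
have : exp m = x * (exp m * (1 + (L - m))) + (1 - x) * (exp m * (1 - m)).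
  by rewrite /m; ring.
nra.
Qed.

Section BinomialSeries.
Variables (s th : R).
Hypothesis Hs : 0 < s <= 1.
Let alpha (j : nat) : R := bincoef s j * cos (INR j * th).
Let beta (j : nat) : R := bincoef s j * sin (INR j * th).

Lemma CV_radius_ge_1 (a : nat -> R) : (forall j, Rabs (a j) <= 1) -> Rbar_le 1 (CV_radius a).
Proof.
move=> H; have [U _] := CV_radius_bounded a; apply: U.
by exists 1 => n; rewrite pow1 Rmult_1_r.
Qed.

Lemma alpha_radius : Rbar_le 1 (CV_radius alpha).
Proof.
apply: CV_radius_ge_1 => j; rewrite /alpha Rabs_mult.
have P := bincoef_pos s j ltac:(lra); have Q := bincoef_le_1 s j Hs.
rewrite Rabs_pos_eq; last lra.
have : Rabs (cos (INR j * th)) <= 1 by apply: Rabs_le; exact: COS_bound.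
by move: (Rabs_pos (cos (INR j * th))); nra.
Qed.

Lemma beta_radius : Rbar_le 1 (CV_radius beta).
Proof.
apply: CV_radius_ge_1 => j; rewrite /beta Rabs_mult.
have P := bincoef_pos s j ltac:(lra); have Q := bincoef_le_1 s j Hs.
rewrite Rabs_pos_eq; last lra.
have : Rabs (sin (INR j * th)) <= 1 by apply: Rabs_le; exact: SIN_bound.
by move: (Rabs_pos (sin (INR j * th))); nra.
Qed.

Let u := PSeries alpha.
Let v := PSeries beta.
Let du := PSeries (PS_derive alpha).
Let dv := PSeries (PS_derive beta).

Lemma inside (a : nat -> R) x : Rbar_le 1 (CV_radius a) -> Rabs x < 1 -> Rbar_lt (Rabs x) (CV_radius a).
Proof. by move=> H Hx; apply: Rbar_lt_le_trans H. Qed.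

Lemma u_derive x : Rabs x < 1 -> is_derive u x (du x).
Proof. by move=> Hx; apply: is_derive_PSeries; apply: inside => //; exact: alpha_radius. Qed.

Lemma v_derive x : Rabs x < 1 -> is_derive v x (dv x).
Proof. by move=> Hx; apply: is_derive_PSeries; apply: inside => //; exact: beta_radius. Qed.

Lemma ex_in (a : nat -> R) x : Rbar_le 1 (CV_radius a) -> Rabs x < 1 -> ex_pseries a x.
Proof. by move=> H Hx; apply: CV_radius_inside; apply: inside. Qed.

Lemma ex_in_derive (a : nat -> R) x : Rbar_le 1 (CV_radius a) -> Rabs x < 1 ->
  ex_pseries (PS_incr_1 (PS_derive a)) x.
Proof.
by move=> H Hx; apply: ex_pseries_incr_1; apply: ex_in => //; rewrite CV_radius_derive.
Qed.

Lemma PS_incr_derive (a : nat -> R) n : PS_incr_1 (PS_derive a) n = INR n * a n.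
Proof. by case: n => [|n]; rewrite /PS_incr_1 /PS_derive; [rewrite Rmult_0_l|]. Qed.

Lemma PSeries_comb (a b : nat -> R) (p q x : R) : ex_pseries a x -> ex_pseries b x ->
  PSeries (fun n => p * a n + q * b n) x = p * PSeries a x + q * PSeries b x.
Proof.
move=> Ha Hb.
rewrite -(PSeries_scal p a) -(PSeries_scal q b) -PSeries_plus; first by apply: PSeries_ext.
  by apply: ex_pseries_scal => //; exact: Rmult_comm.
by apply: ex_pseries_scal => //; exact: Rmult_comm.
Qed.

Lemma ex_pseries_comb (a b : nat -> R) (p q x : R) : ex_pseries a x -> ex_pseries b x ->
  ex_pseries (fun n => p * a n + q * b n) x.
Proof.
move=> Ha Hb.
have A := ex_pseries_scal (V := R_NormedModule) p a x (Rmult_comm _ _) Ha.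
have B := ex_pseries_scal (V := R_NormedModule) q b x (Rmult_comm _ _) Hb.
exact: (ex_pseries_plus _ _ _ A B).
Qed.

(** [f' = e^(i th) (s f + x f')] for [f(x) = sum a_j e^(i j th) x^j], in real and
    imaginary parts. *)
Lemma PS_recurrence x : Rabs x < 1 ->
  du x = cos th * (s * u x + x * du x) - sin th * (s * v x + x * dv x) /\
  dv x = cos th * (s * v x + x * dv x) + sin th * (s * u x + x * du x).
Proof.
move=> Hx.
have Ea := ex_in _ _ alpha_radius Hx; have Eb := ex_in _ _ beta_radius Hx.
have Eda := ex_in_derive _ _ alpha_radius Hx; have Edb := ex_in_derive _ _ beta_radius Hx.
have Ia : x * du x = PSeries (PS_incr_1 (PS_derive alpha)) x by rewrite PSeries_incr_1.
have Ib : x * dv x = PSeries (PS_incr_1 (PS_derive beta)) x by rewrite PSeries_incr_1.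
pose A n := s * alpha n + 1 * PS_incr_1 (PS_derive alpha) n.
pose B n := s * beta n + 1 * PS_incr_1 (PS_derive beta) n.
have EA : ex_pseries A x by apply: ex_pseries_comb.
have EB : ex_pseries B x by apply: ex_pseries_comb.
have PA : PSeries A x = s * u x + x * du x by rewrite PSeries_comb // Ia /u; ring.
have PB : PSeries B x = s * v x + x * dv x by rewrite PSeries_comb // Ib /v; ring.
split.
  rewrite -PA -PB.
  have -> : cos th * PSeries A x - sin th * PSeries B x =
     cos th * PSeries A x + (- sin th) * PSeries B x by ring.
  rewrite -PSeries_comb //; apply: PSeries_ext => n.
  rewrite /A /B !PS_incr_derive /PS_derive /alpha /beta.
  rewrite -Rmult_assoc bincoef_S S_INR.
  have -> : (INR n + 1) * th = INR n * th + th by ring.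
  rewrite cos_plus; ring.
rewrite -PA -PB -PSeries_comb //; apply: PSeries_ext => n.
rewrite /A /B !PS_incr_derive /PS_derive /alpha /beta.
rewrite -Rmult_assoc bincoef_S S_INR.
have -> : (INR n + 1) * th = INR n * th + th by ring.
rewrite sin_plus; ring.
Qed.

Let P x := 1 - 2 * x * cos th + x ^ 2.
Let phi x := atan (x * sin th / (1 - x * cos th)).

Lemma P_pos x : -1 < x < 1 -> 0 < P x /\ 0 < 1 - x * cos th.
Proof.
move=> Hx; have := COS_bound th => Hc; have S := sin2_cos2 th.
have H1 : 0 < 1 - x * cos th by case: (Rle_lt_dec 0 x) => ?; nra.
split=> //; rewrite /P.
have E : 1 - 2 * x * cos th + x ^ 2 = (1 - x * cos th) ^ 2 + (x * sin th) ^ 2.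
  rewrite /Rsqr in S.
  have -> : (x * sin th) ^ 2 = x ^ 2 * (sin th * sin th) by ring.
  have -> : sin th * sin th = 1 - cos th * cos th by lra.
  ring.
rewrite E; have := pow2_ge_0 (x * sin th); nra.
Qed.

(** The recurrence solved for the derivatives, with [P x = |1 - x e^(i th)|^2]. *)
Lemma PS_ode x : -1 < x < 1 ->
  du x = s * ((cos th - x) * u x - sin th * v x) / P x /\
  dv x = s * ((cos th - x) * v x + sin th * u x) / P x.
Proof.
move=> Hx; have [HP H1] := P_pos x Hx.
have [E1 E2] := PS_recurrence x ltac:(apply: Rabs_def1; lra).
have S := sin2_cos2 th; rewrite /Rsqr in S.
set c := cos th in E1 E2 S H1 *; set d := sin th in E1 E2 S *.
have R1 : (1 - x * c) * du x + x * d * dv x = s * (c * u x - d * v x) by lra.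
have R2 : (1 - x * c) * dv x - x * d * du x = s * (c * v x + d * u x) by lra.
have EP : P x = (1 - x * c) * (1 - x * c) + x * d * (x * d).
  rewrite /P -/c; have -> : x * d * (x * d) = x * x * (d * d) by ring.
  have -> : d * d = 1 - c * c by lra.
  ring.
have Ecc : c * c = 1 - d * d by lra.
split; apply: (Rmult_eq_reg_r (P x)); try lra.
  have -> : s * ((c - x) * u x - d * v x) / P x * P x = s * ((c - x) * u x - d * v x) by field; lra.
  transitivity ((1 - x * c) * (s * (c * u x - d * v x)) - x * d * (s * (c * v x + d * u x))).
    rewrite -R1 -R2 EP; ring.
  transitivity (s * (c * u x - d * v x) - s * x * u x * (c * c + d * d)); first by ring.
  by rewrite Ecc; ring.
have -> : s * ((c - x) * v x + d * u x) / P x * P x = s * ((c - x) * v x + d * u x) by field; lra.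
transitivity ((1 - x * c) * (s * (c * v x + d * u x)) + x * d * (s * (c * u x - d * v x))).
  rewrite -R1 -R2 EP; ring.
transitivity (s * (c * v x + d * u x) - s * x * v x * (c * c + d * d)); first by ring.
by rewrite Ecc; ring.
Qed.

Let E x := exp (s / 2 * ln (P x)).

Lemma is_derive_exp_ln (f : R -> R) (k x df : R) : 0 < f x -> is_derive f x df ->
  is_derive (fun y => exp (k * ln (f y))) x (exp (k * ln (f x)) * (k * df / f x)).
Proof.
move=> Hf Hd; have Ef : ex_derive f x by exists df.
auto_derive; first by repeat split.
rewrite [Derive (fun y => f y) x](is_derive_unique _ _ _ Hd); field; lra.
Qed.

Lemma E_derive x : -1 < x < 1 -> is_derive E x (E x * (s * (x - cos th) / P x)).
Proof.
move=> Hx; have [HP H1] := P_pos x Hx.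
have -> : s * (x - cos th) / P x = s / 2 * (2 * (x - cos th)) / P x by field; lra.
apply: is_derive_exp_ln => //.
by rewrite /P; auto_derive => //; ring.
Qed.

Lemma phi_derive x : -1 < x < 1 -> is_derive phi x (sin th / P x).
Proof.
move=> Hx; have [HP H1] := P_pos x Hx; rewrite /phi /P in HP *.
have S := sin2_cos2 th; rewrite /Rsqr in S.
auto_derive; first lra.
have EP : 1 - 2 * x * cos th + x ^ 2 = (1 - x * cos th) ^ 2 + (x * sin th) ^ 2.
  have -> : (x * sin th) ^ 2 = x ^ 2 * (1 - cos th * cos th) by (have -> : 1 - cos th * cos th = sin th * sin th by lra); ring.
  ring.
rewrite EP in HP *; field.
by split; lra.
Qed.

(** [f] and [(1 - x e^(i th))^(-s)] satisfy the same linear equation, so their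
    quotient is constant. [P] is the squared modulus of [1 - x e^(i th)] and [phi] the
    opposite of its argument; [G1] and [G2] are the real and imaginary parts of the
    quotient. *)
Lemma binomial_closed_form x : 0 <= x < 1 ->
  u x = exp (- (s / 2) * ln (P x)) * cos (s * phi x).
Proof.
move=> Hx0.
pose G1 x := E x * (u x * cos (s * phi x) + v x * sin (s * phi x)).
pose G2 x := E x * (v x * cos (s * phi x) - u x * sin (s * phi x)).
have D y : -1 < y < 1 -> is_derive G1 y 0 /\ is_derive G2 y 0.
  move=> Hy; have [HP H1] := P_pos y Hy.
  have [O1 O2] := PS_ode y Hy.
  have Hay : Rabs y < 1 by apply: Rabs_def1; lra.
  have DE := E_derive y Hy; have Dp := phi_derive y Hy.
  have Du := u_derive y Hay; have Dv := v_derive y Hay.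
  rewrite O1 in Du; rewrite O2 in Dv.
  have XE : ex_derive E y by eexists; exact: DE.
  have Xp : ex_derive phi y by eexists; exact: Dp.
  have Xu : ex_derive u y by eexists; exact: Du.
  have Xv : ex_derive v y by eexists; exact: Dv.
  have UE := is_derive_unique _ _ _ DE; have Up := is_derive_unique _ _ _ Dp.
  have Uu := is_derive_unique _ _ _ Du; have Uv := is_derive_unique _ _ _ Dv.
  split.
    rewrite /G1; auto_derive; first by repeat split.
    rewrite [Derive (fun x => E x) y]UE [Derive (fun x => phi x) y]Up [Derive (fun x => u x) y]Uu [Derive (fun x => v x) y]Uv.
    field; lra.
  rewrite /G2; auto_derive; first by repeat split.
  rewrite [Derive (fun x => E x) y]UE [Derive (fun x => phi x) y]Up [Derive (fun x => u x) y]Uu [Derive (fun x => v x) y]Uv.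
  field; lra.
have P0 : P 0 = 1 by rewrite /P; ring.
have phi0 : phi 0 = 0 by rewrite /phi Rmult_0_l /Rdiv Rmult_0_l atan_0.
have E0 : E 0 = 1 by rewrite /E P0 ln_1 Rmult_0_r exp_0.
have u0 : u 0 = 1 by rewrite /u PSeries_0 /alpha /= Rmult_0_l cos_0; ring.
have v0 : v 0 = 0 by rewrite /v PSeries_0 /beta /= Rmult_0_l sin_0; ring.
have K1 : G1 x = 1.
  have -> : 1 = G1 0 by rewrite /G1 E0 u0 v0 phi0 Rmult_0_r cos_0 sin_0; ring.
  case: (Req_dec x 0) => [->//|Hne]; symmetry; apply: (eq_is_derive G1 0 x); last lra.
  by move=> t Ht; apply: (proj1 (D t _)); lra.
have K2 : G2 x = 0.
  have -> : 0 = G2 0 by rewrite /G2 E0 u0 v0 phi0 Rmult_0_r cos_0 sin_0; ring.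
  case: (Req_dec x 0) => [->//|Hne]; symmetry; apply: (eq_is_derive G2 0 x); last lra.
  by move=> t Ht; apply: (proj2 (D t _)); lra.
have EE : exp (- (s / 2) * ln (P x)) * E x = 1.
  rewrite /E -exp_plus; have -> : - (s / 2) * ln (P x) + s / 2 * ln (P x) = 0 by ring.
  exact: exp_0.
have S := sin2_cos2 (s * phi x); rewrite /Rsqr in S.
have H : E x * u x = cos (s * phi x).
  transitivity (G1 x * cos (s * phi x) - G2 x * sin (s * phi x)); last by rewrite K1 K2; ring.
  transitivity (E x * u x * (sin (s * phi x) * sin (s * phi x) + cos (s * phi x) * cos (s * phi x))).
    by rewrite S; ring.
  rewrite /G1 /G2; ring.
by rewrite -H -Rmult_assoc EE; ring.
Qed.

End BinomialSeries.

(** * The functional equation on the real interval (0, 1) *)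

(** Real part of [(1 - x e^(i th))^(-s)]. *)
Definition boundary (s x th : R) : R :=
  exp (- (s / 2) * ln (1 - 2 * x * cos th + x ^ 2)) *
  cos (s * atan (x * sin th / (1 - x * cos th))).

Lemma PSeries_lim (a : nat -> R) x : ex_pseries a x ->
  is_lim_seq (Rsum (fun j => a j * x ^ j)) (PSeries a x).
Proof.
move=> /ex_pseries_R /Series_correct H; apply/is_lim_seq_incr_1.
apply: (is_lim_seq_ext (sum_n (fun k => a k * x ^ k))); last exact: H.
elim=> [|n IH]; first by rewrite sum_O; cbn [Rsum]; ring.
by rewrite sum_Sn IH.
Qed.

Section RealFE.
Variable s : R.
Hypothesis Hs : 0 < s < 1.

(** Summing the binomial series over the frequencies [2 pi k/4N] with the weights
    selects the exponents that are multiples of N, with the same weights. *)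
Lemma inner_identity N x : (1 <= N)%nat -> 0 <= x < 1 ->
  is_lim_seq (Rsum (block (fun n => bincoef s (n * N) * x ^ (n * N))))
   (Rsum (block (fun k => boundary s x (PI * INR k / (2 * INR N)))) N / (2 * INR N)).
Proof.
move=> HN Hx; have Np : 0 < INR N by apply: lt_0_INR.
have H1 : 0 < s <= 1 by lra.
pose th k := PI * INR k / (2 * INR N).
pose PS J k := Rsum (fun j => bincoef s j * cos (INR j * th k) * x ^ j) J.
have L k : is_lim_seq (fun J => PS J k) (boundary s x (th k)).
  rewrite /boundary -(binomial_closed_form s (th k) H1 x Hx); apply: PSeries_lim.
  by apply: ex_in; [exact: alpha_radius|apply: Rabs_def1; lra].
have L2 : is_lim_seq (fun J => Rsum (block (PS J)) N) (Rsum (block (fun k => boundary s x (th k))) N).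
  by apply: (is_lim_Rsum (fun J => block (PS J))) => q _; apply: block_lim => k _; apply: L.
have L3 := is_lim_seq_subseq _ _ (fun Q => (4 * Q * N)%nat) _ L2.
have {}L3 := L3 ltac:(by move=> P [M HM]; exists M => n Hn; apply: HM; nia).
rewrite /Rdiv Rmult_comm; apply: is_lim_seq_ext (lim_scal _ _ _ L3) => Q.
pose c j := Rsum (block (fun k => cos (INR j * th k))) N.
have -> : Rsum (block (PS (4 * Q * N)%nat)) N =
  Rsum (fun j => bincoef s j * x ^ j * c j) (4 * Q * N).
  rewrite (Rsum_ext _ (fun q => Rsum (fun j => block (fun k => bincoef s j * cos (INR j * th k) * x ^ j) q) (4 * Q * N))).
    rewrite Rsum_swap; apply: Rsum_ext => j _; rewrite /c -Rsum_scal; apply: Rsum_ext => q _.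
    rewrite /block; ring.
  by move=> q _; rewrite -block_Rsum.
rewrite Rsum_multiples //; last first.
  by move=> j Hj; rewrite /c block_cos_not_multiple //; ring.
rewrite block_chi -Rsum_scal; apply: Rsum_ext => n _.
rewrite /c block_cos_multiple //; field; lra.
Qed.

(** [boundary s 1 th] in closed form, from [1 - e^(i th) = 2 sin (th/2) e^(-i (pi -
    th)/2)]. *)
Definition boundary_value (th : R) : R := Rpower (2 * sin (th / 2)) (- s) * cos (s * (PI / 2 - th / 2)).

Lemma boundary_1 th : 0 < th < 2 * PI -> boundary s 1 th = boundary_value th.
Proof.
move=> Hth; have Hsin : 0 < sin (th / 2) by apply: sin_gt_0; lra.
have C : cos th = 1 - 2 * (sin (th / 2) * sin (th / 2)).
  have {1}-> : th = 2 * (th / 2) by field.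
  rewrite cos_2a_sin; ring.
have S : sin th = 2 * sin (th / 2) * cos (th / 2).
  have {1}-> : th = 2 * (th / 2) by field.
  exact: sin_2a.
rewrite /boundary /boundary_value; congr Rmult.
  have -> : 1 - 2 * 1 * cos th + 1 ^ 2 = (2 * sin (th / 2)) * (2 * sin (th / 2)) by rewrite C; ring.
  rewrite ln_mult; try lra; rewrite /Rpower; congr exp; field.
congr cos; congr Rmult.
have -> : 1 * sin th / (1 - 1 * cos th) = tan (PI / 2 - th / 2).
  rewrite /tan sin_shift cos_shift C S; field; split; nra.
by apply: atan_tan; lra.
Qed.

Lemma boundary_continuous th : 0 < th < 2 * PI -> continuous (fun x => boundary s x th) 1.
Proof.
move=> Hth; have Hsin : 0 < sin (th / 2) by apply: sin_gt_0; lra.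
have C : cos th = 1 - 2 * (sin (th / 2) * sin (th / 2)).
  have {1}-> : th = 2 * (th / 2) by field.
  rewrite cos_2a_sin; ring.
apply: (ex_derive_continuous (V := R_NormedModule)).
rewrite /boundary; auto_derive; rewrite C.
by split; [nra|split; [nra|split => //; nra]] || (repeat split; nra).
Qed.

(** Abel limit [x -> 1] of [inner_identity], the infinite side being handled by
    [Tannery_block]. *)
Lemma boundary_identity N : (1 <= N)%nat -> is_lim_seq (bincoef s) 0 ->
  is_lim_seq (Rsum (block (fun n => bincoef s (n * N))))
   (Rsum (block (fun k => boundary_value (PI * INR k / (2 * INR N)))) N / (2 * INR N)).
Proof.
move=> HN Hb0; have Np : 0 < INR N by apply: lt_0_INR.
have Pi := PI_RGT_0.
(* any sequence in [0, 1) that tends to 1 *)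
pose x p := 1 - / (INR p + 2).
have Hx p : 0 <= x p < 1.
  have P := pos_INR p; rewrite /x.
  have : 0 < / (INR p + 2) by apply: Rinv_0_lt_compat; lra.
  have : / (INR p + 2) <= / 1 by apply: Rinv_le_contravar; lra.
  rewrite Rinv_1; lra.
have Lx : is_lim_seq x 1.
  have -> : Finite 1 = Finite (1 - 0) by congr Finite; ring.
  apply: is_lim_seq_minus'; first exact: is_lim_seq_const.
  have -> : Finite 0 = Rbar_inv p_infty by [].
  apply: is_lim_seq_inv => //.
  by apply: (is_lim_seq_plus _ _ p_infty 2) => //; [exact: is_lim_seq_INR|exact: is_lim_seq_const].
pose v n := bincoef s (n * N).
have dec (n : nat) : bincoef s (S n * N) <= bincoef s (n * N).
  by have -> : (S n * N = n * N + N)%nat; [lia|apply: bincoef_mono; lra].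
have Hv : decreasing_pos v.
  by move=> n _; split; [apply: Rlt_le; apply: bincoef_pos; lra|exact: dec].
have Hv0 : is_lim_seq v 0.
  apply: (is_lim_seq_subseq (bincoef s) _ (fun n => (n * N)%nat)) => //.
  by move=> P [M HM]; exists M => n Hn; apply: HM; nia.
have [T HT] := block_ex_lim v Hv Hv0.
have L := Tannery_block (fun p n => bincoef s (n * N) * x p ^ (n * N)) v _ T _ _ Hv0
  (fun p => inner_identity N (x p) HN (Hx p)) HT.
have L1 : is_lim_seq (fun p => Rsum (block (fun k => boundary s (x p) (PI * INR k / (2 * INR N)))) N / (2 * INR N)) T.
  apply: L.
    move=> p n Hn; have [X0 X1] := Hx p.
    have B := bincoef_pos s (S n * N) ltac:(lra); have B2 := bincoef_pos s (n * N) ltac:(lra).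
    split; first by apply: Rmult_le_pos; [lra|apply: pow_le].
    apply: Rmult_le_compat; [lra|by apply: pow_le|exact: dec|].
    have -> : (S n * N = n * N + N)%nat by lia.
    rewrite pow_add -{2}(Rmult_1_r (x p ^ (n * N))).
    apply: Rmult_le_compat_l; first exact: pow_le.
    by rewrite -(pow1 N); apply: pow_incr; lra.
  move=> n Hn; rewrite /v.
  have -> : Finite (bincoef s (n * N)) = Rbar_mult (bincoef s (n * N)) (1 ^ (n * N)) by rewrite /= pow1 Rmult_1_r.
  apply: is_lim_seq_scal_l.
  elim: (n * N)%nat => [|m IH]; first exact: is_lim_seq_const.
  exact: (is_lim_seq_mult' _ _ _ _ Lx IH).
have L2 : is_lim_seq (fun p => Rsum (block (fun k => boundary s (x p) (PI * INR k / (2 * INR N)))) N / (2 * INR N))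
  (Rsum (block (fun k => boundary_value (PI * INR k / (2 * INR N)))) N / (2 * INR N)).
  rewrite /Rdiv; apply: is_lim_seq_mult'; last exact: is_lim_seq_const.
  apply: (is_lim_Rsum (fun p => block (fun k => boundary s (x p) (PI * INR k * / (2 * INR N))))) => q Hq.
  apply: (block_lim (fun p k => boundary s (x p) (PI * INR k * / (2 * INR N)))) => k Hk.
  have Hk1 : 1 <= INR k by apply: (le_INR 1); lia.
  have Hk2 : INR k < 4 * INR N.
    by have := lt_INR k (4 * N) ltac:(lia); rewrite mult_INR /=; lra.
  have Hth : 0 < PI * INR k * / (2 * INR N) < 2 * PI.
    split; first by apply: Rdiv_lt_0_compat; nra.
    by apply/Rlt_div_l; nra.
  rewrite -boundary_1 //.
  exact: (filterlim_comp _ _ _ x (fun y => boundary s y _) _ _ _ Lx (boundary_continuous _ Hth)).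
rewrite /v in HT.
have E := is_lim_seq_unique _ _ L1; rewrite (is_lim_seq_unique _ _ L2) in E.
by case: E => ->.
Qed.

(** Complex conjugation exchanges the frequencies k and [8L - k], and the weights are
    even. *)
Lemma boundary_value_symmetric L q : (q < L)%nat ->
  let w := fun k => boundary_value (PI * INR k / (2 * INR (2 * L))) in
  block w (2 * L - 1 - q) = block w q.
Proof.
move=> Hq w; have Lp : 0 < INR L by apply: lt_0_INR; lia.
have E k k' : (k + k' = 8 * L)%nat -> w k = w k'.
  move=> H; rewrite /w /boundary_value.
  have Hk : INR k = 8 * INR L - INR k'.
    by have := f_equal INR H; rewrite plus_INR mult_INR /=; lra.
  have E2 : INR (2 * L) = 2 * INR L by rewrite mult_INR /=.
  have -> : PI * INR k / (2 * INR (2 * L)) / 2 = PI - PI * INR k' / (2 * INR (2 * L)) / 2.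
    by rewrite Hk E2; field; lra.
  rewrite sin_minus sin_PI cos_PI.
  set y := PI * INR k' / _ / 2.
  have -> : 0 * cos y - -1 * sin y = sin y by ring.
  congr Rmult; rewrite -cos_neg; congr cos; field.
rewrite /block (E (4 * (2 * L - 1 - q) + 1)%nat (4 * q + 3)%nat); last lia.
rewrite (E (4 * (2 * L - 1 - q) + 2)%nat (4 * q + 2)%nat); last lia.
rewrite (E (4 * (2 * L - 1 - q) + 3)%nat (4 * q + 1)%nat); last lia.
ring.
Qed.

(** Folding the sum by symmetry and multiplying by [N^(1-s)]. N is even so that the
    middle frequency [k = 2N] carries weight 0. *)
Lemma half_identity L : (1 <= L)%nat -> is_lim_seq (bincoef s) 0 ->
  let N := (2 * L)%nat in
  is_lim_seq (Rsum (block (fun n => Rpower (INR N) (1 - s) * bincoef s (n * N))))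
   (Rsum (block (fun k => Rpower (INR N) (- s) * boundary_value (PI * INR k / (2 * INR N)))) L).
Proof.
move=> HL Hb N; have Np : 0 < INR N by apply: lt_0_INR; rewrite /N; lia.
have H := lim_scal (Rpower (INR N) (1 - s)) _ _ (boundary_identity N ltac:(rewrite /N; lia) Hb).
set w := fun k => boundary_value (PI * INR k / (2 * INR N)) in H.
have E : Rsum (block w) N = 2 * Rsum (block w) L.
  rewrite {1}/N; have {1}-> : (2 * L = L + L)%nat by lia.
  rewrite Rsum_app -(Rsum_rev (fun i => block w (L + i)%nat)).
  rewrite (Rsum_ext _ (block w)); first ring.
  move=> i Hi; rewrite -[RHS](boundary_value_symmetric L i Hi); congr block; lia.
have E2 : Rsum (block (fun k => Rpower (INR N) (- s) * w k)) L = Rpower (INR N) (1 - s) * (Rsum (block w) N / (2 * INR N)).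
  rewrite E (Rsum_ext _ (fun q => Rpower (INR N) (- s) * block w q)); last by move=> q _; rewrite block_scal.
  rewrite Rsum_scal.
  have -> : Rpower (INR N) (1 - s) = INR N * Rpower (INR N) (- s).
    by rewrite Rpower_plus Rpower_1.
  by field; lra.
rewrite -E2 in H; rewrite -/w.
apply: is_lim_seq_ext H => Q; rewrite -Rsum_scal; apply: Rsum_ext => q _.
by rewrite block_scal.
Qed.

(** [k |-> (2N sin (pi k/4N))^(-s)] for [N = 2L], cut off at the middle so that it is
    monotone on all integers. *)
Definition sine_power (L k : nat) : R :=
  if Nat.ltb k (4 * L) then Rpower (2 * INR (2 * L) * sin (PI * INR k / (4 * INR (2 * L)))) (- s) else 0.

(** One minus the cosine factor of [boundary_value]. The product of a decreasing and
    an increasing factor is thereby written as a difference of two decreasing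
    sequences, to which [Tannery_block] applies. *)
Definition cosine_defect (L k : nat) : R := 1 - cos (s * (PI / 2 - PI * INR k / (4 * INR (2 * L)))).

Lemma angle_bounds L k : (1 <= L)%nat -> (1 <= k)%nat -> (k < 4 * L)%nat ->
  0 < PI * INR k / (4 * INR (2 * L)) < PI / 2.
Proof.
move=> HL Hk1 Hk2; have Pi := PI_RGT_0.
have Lp : 1 <= INR L by apply: (le_INR 1).
have kp : 1 <= INR k by apply: (le_INR 1).
have kL : INR k < 4 * INR L by have := lt_INR k (4 * L) Hk2; rewrite mult_INR /=; lra.
have E2 : INR (2 * L) = 2 * INR L by rewrite mult_INR /=.
rewrite E2; split; first by apply: Rdiv_lt_0_compat; nra.
by apply/Rlt_div_l; nra.
Qed.

Lemma angle_incr L k : (1 <= L)%nat ->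
  PI * INR k / (4 * INR (2 * L)) < PI * INR (S k) / (4 * INR (2 * L)).
Proof.
move=> HL; have Pi := PI_RGT_0.
have Lp : 0 < INR (2 * L) by apply: lt_0_INR; lia.
apply: Rmult_lt_compat_r; first by apply: Rinv_0_lt_compat; lra.
by rewrite S_INR; nra.
Qed.

Lemma sine_power_pos L k : 0 <= sine_power L k.
Proof. by rewrite /sine_power; case: Nat.ltb; [exact: Rlt_le (exp_pos _)|lra]. Qed.

Lemma sine_power_decr L : (1 <= L)%nat -> decreasing_pos (sine_power L).
Proof.
move=> HL n Hn; split; first exact: sine_power_pos.
case E : (Nat.ltb (S n) (4 * L)); last by rewrite {1}/sine_power E; exact: sine_power_pos.
have HS : (S n < 4 * L)%nat by apply/Nat.ltb_lt.
have E' : Nat.ltb n (4 * L) = true by apply/Nat.ltb_lt; lia.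
rewrite /sine_power E E'.
have A1 := angle_bounds L n HL Hn ltac:(lia); have A2 := angle_bounds L (S n) HL ltac:(lia) HS.
have A3 := angle_incr L n HL.
have Lp : 0 < INR (2 * L) by apply: lt_0_INR; lia.
apply: Rpower_incr_base; [|apply: Rmult_le_compat_l; first lra|lra].
  by apply: Rmult_lt_0_compat; [lra|apply: sin_gt_0; lra].
by apply: sin_incr_1; lra.
Qed.

Lemma cosine_defect_decr L n : (1 <= L)%nat -> (1 <= n)%nat -> (S n < 4 * L)%nat ->
  0 <= cosine_defect L (S n) <= cosine_defect L n.
Proof.
move=> HL Hn HS; rewrite /cosine_defect.
have A1 := angle_bounds L n HL Hn ltac:(lia); have A2 := angle_bounds L (S n) HL ltac:(lia) HS.
have A3 := angle_incr L n HL.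
move: A1 A2 A3; set y := PI * _ / _; set z := PI * _ / _ => A1 A2 A3.
split; first by have := COS_bound (s * (PI / 2 - z)); lra.
suff : cos (s * (PI / 2 - y)) <= cos (s * (PI / 2 - z)) by lra.
by apply: cos_decr_1; nra.
Qed.

Lemma sine_power_cosine_defect_decr L : (1 <= L)%nat -> decreasing_pos (fun k => sine_power L k * cosine_defect L k).
Proof.
move=> HL n Hn; have [H1 H2] := sine_power_decr L HL n Hn.
have C k : 0 <= cosine_defect L k by rewrite /cosine_defect; have := COS_bound (s * (PI / 2 - PI * INR k / (4 * INR (2 * L)))); lra.
split; first by apply: Rmult_le_pos.
case E : (Nat.ltb (S n) (4 * L)); last first.
  rewrite {1}/sine_power E Rmult_0_l; apply: Rmult_le_pos => //; exact: sine_power_pos.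
have HS : (S n < 4 * L)%nat by apply/Nat.ltb_lt.
have [H3 H4] := cosine_defect_decr L n HL Hn HS.
by apply: Rmult_le_compat.
Qed.

Lemma boundary_value_split L k : (1 <= L)%nat -> (1 <= k)%nat -> (k < 4 * L)%nat ->
  Rpower (INR (2 * L)) (- s) * boundary_value (PI * INR k / (2 * INR (2 * L))) =
  sine_power L k - sine_power L k * cosine_defect L k.
Proof.
move=> HL Hk Hk2; have A := angle_bounds L k HL Hk Hk2.
have Lp : 0 < INR (2 * L) by apply: lt_0_INR; lia.
have E : Nat.ltb k (4 * L) = true by apply/Nat.ltb_lt.
rewrite /sine_power E /cosine_defect /boundary_value.
have -> : PI * INR k / (2 * INR (2 * L)) / 2 = PI * INR k / (4 * INR (2 * L)) by field; lra.
set y := PI * _ / _ in A *.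
have Sy : 0 < sin y by apply: sin_gt_0; lra.
have -> : 2 * INR (2 * L) * sin y = INR (2 * L) * (2 * sin y) by ring.
rewrite -(Rpower_mult_distr (INR (2 * L)) (2 * sin y)); try lra.
Qed.

Lemma angle_lim k : is_lim_seq (fun p => PI * INR k / (4 * INR (2 * S p))) 0.
Proof.
apply: (is_lim_seq_ext (fun p => PI * INR k * / (4 * INR (2 * S p)))); first by [].
have -> : Finite 0 = Finite (PI * INR k * 0) by rewrite Rmult_0_r.
apply: lim_scal; have -> : Finite 0 = Rbar_inv p_infty by [].
apply: is_lim_seq_inv => //.
apply: (is_lim_seq_le_p_loc INR _); last exact: is_lim_seq_INR.
exists 0%nat => p _; rewrite mult_INR (S_INR p) [INR 2]/=; have := pos_INR p; lra.
Qed.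

Lemma sine_power_lim k : (1 <= k)%nat ->
  is_lim_seq (fun p => sine_power (S p) k) (Rpower (PI * INR k / 2) (- s)).
Proof.
move=> Hk; have kp : 1 <= INR k by apply: (le_INR 1).
have Pi := PI_RGT_0.
have Yp : 0 < PI * INR k / 2 by apply: Rdiv_lt_0_compat; nra.
have L1 : is_lim_seq (fun p => 2 * INR (2 * S p) * sin (PI * INR k / (4 * INR (2 * S p)))) (PI * INR k / 2).
  have Hp p : 0 < INR (2 * S p) by apply: lt_0_INR; lia.
  apply: (is_lim_seq_ext (fun p => PI * INR k / 2 * (sin (PI * INR k / (4 * INR (2 * S p))) / (PI * INR k / (4 * INR (2 * S p)))))).
    by move=> p; have := Hp p => Q; field; split; [lra|split; lra].
  rewrite -[Finite (PI * INR k / 2)]/(Finite (PI * INR k / 2)).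
  have E : Finite (PI * INR k / 2) = Rbar_mult (PI * INR k / 2) 1 by rewrite /= Rmult_1_r.
  rewrite {1}E; apply: is_lim_seq_scal_l.
  apply: (is_lim_comp_seq (fun y => sin y / y) _ 0 1 is_lim_sinc_0 _ (angle_lim k)).
  exists 0%nat => p _ [] H; have := Hp p => Q.
  have : 0 < PI * INR k / (4 * INR (2 * S p)) by apply: Rdiv_lt_0_compat; nra.
  by rewrite H; lra.
apply: (is_lim_seq_ext_loc (fun p => Rpower (2 * INR (2 * S p) * sin (PI * INR k / (4 * INR (2 * S p)))) (- s))).
  exists k => p Hp; rewrite /sine_power.
  by have -> : Nat.ltb k (4 * S p) = true by apply/Nat.ltb_lt; lia.
have Cc : continuous (fun y => Rpower y (- s)) (PI * INR k / 2).
  by apply: (ex_derive_continuous (V := R_NormedModule)); rewrite /Rpower; auto_derive.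
exact: (filterlim_comp _ _ _ _ (fun y => Rpower y (- s)) _ _ _ L1 Cc).
Qed.

Lemma cosine_defect_lim k : is_lim_seq (fun p => cosine_defect (S p) k) (1 - cos (PI * s / 2)).
Proof.
have Cc : continuous (fun y => 1 - cos (s * (PI / 2 - y))) 0.
  by apply: (ex_derive_continuous (V := R_NormedModule)); auto_derive.
have -> : 1 - cos (PI * s / 2) = 1 - cos (s * (PI / 2 - 0)) by congr (_ - cos _); field.
exact: (filterlim_comp _ _ _ _ (fun y => 1 - cos (s * (PI / 2 - y))) _ _ _ (angle_lim k) Cc).
Qed.

Lemma cut_lim (u : nat -> R) L : (forall k, (4 * L <= k)%nat -> u k = 0) ->
  is_lim_seq (Rsum (block u)) (Rsum (block u) L).
Proof.
move=> H; apply: (is_lim_seq_ext_loc (fun _ => Rsum (block u) L)); last exact: is_lim_seq_const.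
exists L => Q HQ; have -> : Q = (L + (Q - L))%nat by lia.
rewrite Rsum_app (Rsum_ext (fun i => block u (L + i)) (fun _ => 0)) ?Rsum_0; first ring.
by move=> i _; rewrite /block !H; try lia; ring.
Qed.

Lemma Rpower_lim_0' d : 0 < d -> is_lim_seq (fun n => Rpower (INR n) (- d)) 0.
Proof. by move=> Hd; apply/is_lim_seq_incr_1; exact: Rpower_lim_0. Qed.

(** Both sides of [half_identity] converge, by [Tannery_block] with [N = 2 (p+1)]: on
    the left [N^(1-s) a_(nN)] tends to [Ev n^(s-1)], on the right [N^(-s)
    boundary_value] tends to [(pi k/2)^(-s) cos (pi s/2)]. *)
Theorem real_functional_equation (Ev Ds D1 : R) :
  is_lim_seq (fun N => Rpower (INR N) (1 - s) * bincoef s N) Ev ->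
  is_lim_seq (Rsum (block (fun k => Rpower (INR k) (- s)))) Ds ->
  is_lim_seq (Rsum (block (fun k => Rpower (INR k) (- (1 - s))))) D1 ->
  Ev * D1 = Rpower (PI / 2) (- s) * cos (PI * s / 2) * Ds.
Proof.
move=> HE HDs HD1; have Pi := PI_RGT_0.
have Hb0 : is_lim_seq (bincoef s) 0.
  have H := is_lim_seq_mult' _ _ _ _ (Rpower_lim_0' (1 - s) ltac:(lra)) HE.
  rewrite Rmult_0_l in H; apply: is_lim_seq_ext H => n.
  rewrite -Rmult_assoc -Rpower_plus.
  have -> : - (1 - s) + (1 - s) = 0 by ring.
  by rewrite /Rpower Rmult_0_l exp_0; ring.
pose F p := Rsum (block (fun k => Rpower (INR (2 * S p)) (- s) *
    boundary_value (PI * INR k / (2 * INR (2 * S p))))) (S p).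
have LL : is_lim_seq F (Ev * D1).
  apply: (Tannery_block (fun p n => Rpower (INR (2 * S p)) (1 - s) * bincoef s (n * (2 * S p)))
     (fun n => Ev * Rpower (INR n) (- (1 - s)))).
  - move=> p n Hn; set N := (2 * _)%nat.
    have R0 : 0 < Rpower (INR N) (1 - s) by apply: exp_pos.
    have B := bincoef_pos s (S n * N) ltac:(lra).
    split; first by apply: Rmult_le_pos; lra.
    apply: Rmult_le_compat_l; first lra.
    have -> : (S n * N = n * N + N)%nat by lia.
    by apply: bincoef_mono; lra.
  - move=> n Hn.
    have np : 0 < INR n by apply: lt_0_INR.
    have H := is_lim_seq_subseq _ _ (fun p => (n * (2 * S p))%nat) _ HE.
    have {}H := H ltac:(by move=> P [M HM]; exists M => k Hk; apply: HM; nia).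
    rewrite Rmult_comm; apply: is_lim_seq_ext (lim_scal _ _ _ H) => p.
    have pp : 0 < INR (2 * S p) by apply: lt_0_INR; lia.
    rewrite mult_INR -Rpower_mult_distr // -!Rmult_assoc -Rpower_plus.
    have -> : - (1 - s) + (1 - s) = 0 by ring.
    by rewrite {1}/Rpower Rmult_0_l exp_0; ring.
  - have := lim_scal Ev _ _ (Rpower_lim_0' (1 - s) ltac:(lra)).
    by rewrite Rmult_0_r.
  - by move=> p; apply: half_identity => //; lia.
  - apply: is_lim_seq_ext (lim_scal Ev _ _ HD1) => Q; rewrite -Rsum_scal; apply: Rsum_ext => q _.
    by rewrite block_scal.
pose F1 p := Rsum (block (sine_power (S p))) (S p).
pose F2 p := Rsum (block (fun k => sine_power (S p) k * cosine_defect (S p) k)) (S p).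
have ES p : F p = F1 p - F2 p.
  rewrite /F /F1 /F2 /Rminus.
  have -> : - Rsum (block (fun k => sine_power (S p) k * cosine_defect (S p) k)) (S p) =
    -1 * Rsum (block (fun k => sine_power (S p) k * cosine_defect (S p) k)) (S p) by ring.
  rewrite -Rsum_scal -Rsum_plus; apply: Rsum_ext => q Hq.
  rewrite (block_ext _ (fun k => sine_power (S p) k - sine_power (S p) k * cosine_defect (S p) k)).
    rewrite /block; ring.
  by move=> k Hk; apply: boundary_value_split; lia.
have cut p k : (4 * S p <= k)%nat -> sine_power (S p) k = 0.
  by move=> Hk; rewrite /sine_power; have -> : Nat.ltb k (4 * S p) = false by apply/Nat.ltb_ge.
have Ek k : (1 <= k)%nat -> Rpower (PI * INR k / 2) (- s) = Rpower (PI / 2) (- s) * Rpower (INR k) (- s).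
  move=> Hk; have kp : 0 < INR k by apply: lt_0_INR.
  rewrite Rpower_mult_distr //; last lra.
  by congr Rpower; field.
have lim_pow c : is_lim_seq (fun k => c * Rpower (INR k) (- s)) 0.
  have := lim_scal c _ _ (Rpower_lim_0' s ltac:(lra)).
  by rewrite Rmult_0_r.
have lim_sum c : is_lim_seq (Rsum (block (fun k => c * Rpower (INR k) (- s)))) (c * Ds).
  apply: is_lim_seq_ext (lim_scal c _ _ HDs) => Q; rewrite -Rsum_scal; apply: Rsum_ext => q _.
  by rewrite block_scal.
have L1 : is_lim_seq F1 (Rpower (PI / 2) (- s) * Ds).
  apply: (Tannery_block (fun p => sine_power (S p)) (fun k => Rpower (PI / 2) (- s) * Rpower (INR k) (- s))) => //.
  - by move=> p; apply: sine_power_decr; lia.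
  - by move=> n Hn; rewrite -Ek //; exact: sine_power_lim.
  - by move=> p; apply: cut_lim => k; exact: cut.
have L2 : is_lim_seq F2 (Rpower (PI / 2) (- s) * (1 - cos (PI * s / 2)) * Ds).
  apply: (Tannery_block (fun p k => sine_power (S p) k * cosine_defect (S p) k)
    (fun k => Rpower (PI / 2) (- s) * (1 - cos (PI * s / 2)) * Rpower (INR k) (- s))) => //.
  - by move=> p; apply: sine_power_cosine_defect_decr; lia.
  - move=> n Hn.
    have -> : Rpower (PI / 2) (- s) * (1 - cos (PI * s / 2)) * Rpower (INR n) (- s) =
      Rpower (PI * INR n / 2) (- s) * (1 - cos (PI * s / 2)) by rewrite Ek //; ring.
    by apply: is_lim_seq_mult'; [exact: sine_power_lim|exact: cosine_defect_lim].
  - by move=> p; apply: cut_lim => k Hk; rewrite cut //; ring.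
have L := is_lim_seq_minus' _ _ _ _ L1 L2.
have {}L : is_lim_seq F (Rpower (PI / 2) (- s) * Ds - Rpower (PI / 2) (- s) * (1 - cos (PI * s / 2)) * Ds).
  by apply: is_lim_seq_ext L => p; rewrite ES.
have E := is_lim_seq_unique _ _ LL; rewrite (is_lim_seq_unique _ _ L) in E.
by case: E => <-; ring.
Qed.

End RealFE.

(** * The reciprocal of the Gamma function *)

Fixpoint Cbincoef (w : C) (j : nat) : C :=
  match j with 0%nat => 1%C | S i => (Cbincoef w i * (w + RtoC (INR i)) / RtoC (INR (S i)))%C end.

(** Euler's product [w (w+1) ... (w+N-1) N^(1-w) / N!] with [N = n+1]. It converges to
    [1 / Gamma(w)]. *)
Definition rgamma_part (n : nat) (w : C) : C := (Cbincoef w (S n) * npow (S n) (w - 1))%C.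

Definition rgamma (w : C) : C := Clim (fun n => rgamma_part n w).

Lemma RtoC_INR_neq_0 n : RtoC (INR (S n)) <> 0%C.
Proof. by move=> /RtoC_inj; have := INR_S_pos n; lra. Qed.

Lemma Cbincoef_real x j : Cbincoef (RtoC x) j = RtoC (bincoef x j).
Proof.
elim: j => [//|j IH]; cbn [Cbincoef bincoef].
rewrite IH RtoC_div; last by have := INR_S_pos j; lra.
by rewrite RtoC_mult RtoC_plus.
Qed.

Lemma rgamma_part_real x n :
  rgamma_part n (RtoC x) = RtoC (Rpower (INR (S n)) (1 - x) * bincoef x (S n)).
Proof.
rewrite /rgamma_part Cbincoef_real -RtoC_minus npow_real RtoC_mult Cmult_comm.
by have -> : - (x - 1) = 1 - x by ring.
Qed.

Lemma holo_rgamma_part n w : holo_at (rgamma_part n) w.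
Proof.
apply: holo_mult.
  elim: (S n) => [|j IH]; first exact: holo_const.
  apply: holo_mult; last exact: holo_const.
  by apply: holo_mult => //; apply: holo_plus; [exact: holo_id|exact: holo_const].
apply: (holo_comp (npow (S n))); first exact: holo_npow.
by apply: holo_minus; [exact: holo_id|exact: holo_const].
Qed.

Definition ratio_const (Z : R) : R := 6 * Z ^ 2 * exp Z + 2 * Z.

Lemma ratio_const_ge_0 Z : 0 <= Z -> 0 <= ratio_const Z.
Proof. move=> HZ; rewrite /ratio_const; have := exp_pos Z; have := pow2_ge_0 Z; nra. Qed.

(** The first order terms of [1 - z x] and [exp (z t)] cancel because [t - x =
    O(x^2)]. *)
Lemma second_order_cancel (z : C) (x t Z : R) : Cmod z <= Z -> 0 < x <= 1 / 2 ->
  x <= t -> t <= 2 * x -> t - x <= 2 * x ^ 2 ->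
  Cmod ((1 - z * x) * Cexp (z * t) - 1) <= ratio_const Z * x ^ 2.
Proof.
move=> HZ Hx Hxt Ht Htx; have z0 := Cmod_ge_0 z.
have -> : ((1 - z * x) * Cexp (z * t) - 1 =
  (Cexp (z * t) - 1 - z * t) + (z * RtoC (t - x) - z * x * (Cexp (z * t) - 1)))%C.
  rewrite RtoC_minus; ring.
apply: Rle_trans (Cmod_triangle _ _) _.
have T2 := Cexp_taylor2 (z * t)%C; have T1 := Cexp_taylor1 (z * t)%C.
have B := Cmod_sub_le (z * RtoC (t - x)) (z * x * (Cexp (z * t) - 1)).
rewrite !Cmod_mult !Cmod_R in B T1 T2.
rewrite (Rabs_pos_eq t) in T1 T2; last lra.
rewrite (Rabs_pos_eq (t - x)) in B; last lra.
rewrite (Rabs_pos_eq x) in B; last lra.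
set c := Cmod z in z0 HZ B T1 T2.
have E : exp (c * t) <= exp Z.
  have : c * t <= Z by nra.
  by case=> [/exp_increasing|->]; lra.
have e0 := exp_pos (c * t).
have A1 : (c * t) ^ 2 * exp (c * t) <= 4 * Z ^ 2 * x ^ 2 * exp Z.
  apply: Rmult_le_compat => //; [exact: pow2_ge_0|lra|].
  have -> : 4 * Z ^ 2 * x ^ 2 = (Z * (2 * x)) ^ 2 by ring.
  by apply: pow_incr; split; [nra|apply: Rmult_le_compat; lra].
have A2 : c * t * exp (c * t) <= Z * (2 * x) * exp Z.
  by apply: Rmult_le_compat => //; [nra|lra|apply: Rmult_le_compat; lra].
have A3 : c * x * Cmod (Cexp (z * t) - 1) <= Z * x * (Z * (2 * x) * exp Z).
  apply: Rmult_le_compat; [nra|exact: Cmod_ge_0|nra|lra].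
have A4 : c * (t - x) <= Z * (2 * x ^ 2) by apply: Rmult_le_compat; lra.
rewrite /ratio_const; lra.
Qed.

(** Consecutive Euler products differ by the factor [(1 - z x) exp (z t)] with [z = 1
    - w], [x = 1/(N+1)], [t = ln ((N+1)/N)]. *)
Lemma rgamma_ratio n w Z : Cmod (1 - w) <= Z ->
  Cmod (rgamma_part (S n) w - rgamma_part n w) <=
    ratio_const Z * (/ INR (S (S n))) ^ 2 * Cmod (rgamma_part n w).
Proof.
move=> HZ; have [HL1 HL2] := ln_succ_bounds n.
have Np := INR_S_pos n; have Np2 := INR_S_pos (S n).
have ES : INR (S (S n)) = INR (S n) + 1 by rewrite (S_INR (S n)).
have N1 : 1 <= INR (S n) by rewrite S_INR; move: (pos_INR n); lra.
set x := / INR (S (S n)) in HL1 *; set t := ln (INR (S (S n))) - ln (INR (S n)) in HL1 HL2.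
have EN : / INR (S n) = x + x * / INR (S n) by rewrite /x ES; field; lra.
have Hx0 : 0 < x by apply: Rinv_0_lt_compat.
have Hx1 : x <= 1 / 2.
  by rewrite /x ES /Rdiv Rmult_1_l; apply: Rinv_le_contravar; lra.
have HN2 : / INR (S n) <= 2 * x.
  have -> : 2 * x = / (INR (S (S n)) / 2) by rewrite /x; field; lra.
  by apply: Rinv_le_contravar; lra.
have E : rgamma_part (S n) w = (rgamma_part n w * ((1 - (1 - w) * x) * Cexp ((1 - w) * t)))%C.
  have Ec : Cbincoef w (S (S n)) = (Cbincoef w (S n) * (1 - (1 - w) * x))%C.
    rewrite -[Cbincoef w (S (S n))]/(Cbincoef w (S n) * (w + RtoC (INR (S n))) / RtoC (INR (S (S n))))%C.
    rewrite /x RtoC_inv; last lra.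
    have Q := RtoC_INR_neq_0 (S n).
    have -> : (w + RtoC (INR (S n)) = RtoC (INR (S (S n))) - (1 - w))%C.
      by rewrite ES RtoC_plus; ring.
    by field.
  have En : npow (S (S n)) (w - 1) = (npow (S n) (w - 1) * Cexp ((1 - w) * t))%C.
    rewrite /npow -Cexp_plus; congr Cexp; rewrite /t RtoC_minus; ring.
  by rewrite /rgamma_part Ec En; ring.
rewrite E.
replace (rgamma_part n w * ((1 - (1 - w) * x) * Cexp ((1 - w) * t)) - rgamma_part n w)%C
  with (((1 - (1 - w) * x) * Cexp ((1 - w) * t) - 1) * rgamma_part n w)%C by ring.
rewrite Cmod_mult; apply: Rmult_le_compat_r; first exact: Cmod_ge_0.
apply: second_order_cancel; try lra.
have : x * / INR (S n) <= x * (2 * x) by apply: Rmult_le_compat_l; lra.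
lra.
Qed.

Lemma inv_square_telescope n : (/ INR (S (S n))) ^ 2 <= / INR (S n) - / INR (S (S n)).
Proof.
have Np := INR_S_pos n; have ES : INR (S (S n)) = INR (S n) + 1 by rewrite (S_INR (S n)).
rewrite ES; have -> : / INR (S n) - / (INR (S n) + 1) = / (INR (S n) * (INR (S n) + 1)) by field; lra.
have -> : (/ (INR (S n) + 1)) ^ 2 = / ((INR (S n) + 1) * (INR (S n) + 1)) by field; lra.
by apply: Rinv_le_contravar; nra.
Qed.

(** [prod (1 + c/m^2)] is bounded by the exponential of a telescoping sum. *)
Lemma rgamma_part_bound n w Z : 0 <= Z -> Cmod (1 - w) <= Z ->
  Cmod (rgamma_part n w) <= Cmod w * exp (ratio_const Z * (1 - / INR (S n))).
Proof.
move=> Z0 HZ; have K := ratio_const_ge_0 Z Z0.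
elim: n => [|n IH].
  rewrite /= Rinv_1 Rminus_diag Rmult_0_r exp_0 Rmult_1_r /rgamma_part npow_1 /=; right; congr Cmod.
  field; exact: (RtoC_INR_neq_0 0).
have R := rgamma_ratio n w Z HZ; have T := inv_square_telescope n.
have A := Cmod_le_sub (rgamma_part (S n) w) (rgamma_part n w).
set q := (/ INR (S (S n))) ^ 2 in R T.
have q0 : 0 <= q by apply: pow2_ge_0.
have E : 1 + ratio_const Z * q <= exp (ratio_const Z * (/ INR (S n) - / INR (S (S n)))).
  apply: Rle_trans (exp_ineq1_le _) _.
  have : ratio_const Z * q <= ratio_const Z * (/ INR (S n) - / INR (S (S n))) by apply: Rmult_le_compat_l.
  by case=> [/exp_increasing|->]; lra.
have -> : ratio_const Z * (1 - / INR (S (S n))) =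
   ratio_const Z * (1 - / INR (S n)) + ratio_const Z * (/ INR (S n) - / INR (S (S n))) by ring.
rewrite exp_plus -Rmult_assoc.
apply: Rle_trans (_ : Cmod (rgamma_part n w) * (1 + ratio_const Z * q) <= _); first lra.
apply: Rmult_le_compat => //; first exact: Cmod_ge_0.
have := Rmult_le_pos _ _ K q0; lra.
Qed.

Lemma rgamma_Cauchy n m w Z : 0 <= Z -> Cmod (1 - w) <= Z -> (n <= m)%nat ->
  Cmod (rgamma_part m w - rgamma_part n w) <=
    ratio_const Z * (Cmod w * exp (ratio_const Z)) * / INR (S n).
Proof.
move=> Z0 HZ Hnm; have K := ratio_const_ge_0 Z Z0.
set B := Cmod w * exp (ratio_const Z).
have B0 : 0 <= B by apply: Rmult_le_pos; [exact: Cmod_ge_0|exact: Rlt_le (exp_pos _)].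
have HB k : Cmod (rgamma_part k w) <= B.
  apply: Rle_trans (rgamma_part_bound k w Z Z0 HZ) _.
  apply: Rmult_le_compat_l; first exact: Cmod_ge_0.
  have I : 0 < / INR (S k) by apply: Rinv_0_lt_compat; exact: INR_S_pos.
  have : ratio_const Z * (1 - / INR (S k)) <= ratio_const Z by nra.
  by case=> [/exp_increasing|->]; lra.
have -> : m = (n + (m - n))%nat by lia.
apply: Rle_trans (_ : ratio_const Z * B * (/ INR (S n) - / INR (S (n + (m - n)))) <= _).
  elim: (m - n)%nat => [|k IH].
    rewrite Nat.add_0_r Rminus_diag; replace (rgamma_part n w - rgamma_part n w)%C with (RtoC 0) by ring.
    by rewrite Cmod_0; lra.
  rewrite -plus_n_Sm; set j := (n + k)%nat in IH *.
  apply: Rle_trans (Cmod_triangle_sub _ (rgamma_part j w) _) _.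
  have R := rgamma_ratio j w Z HZ; have T := inv_square_telescope j.
  have : ratio_const Z * (/ INR (S (S j))) ^ 2 * Cmod (rgamma_part j w) <=
     ratio_const Z * (/ INR (S j) - / INR (S (S j))) * B.
    apply: Rmult_le_compat => //; [|exact: Cmod_ge_0|exact: Rmult_le_compat_l].
    by apply: Rmult_le_pos => //; exact: pow2_ge_0.
  lra.
apply: Rmult_le_compat_l; first exact: Rmult_le_pos.
have := Rinv_0_lt_compat _ (INR_S_pos (n + (m - n))); lra.
Qed.

Lemma rgamma_spec w Z : 0 <= Z -> Cmod (1 - w) <= Z ->
  Ccvg (fun n => rgamma_part n w) (rgamma w) /\
  forall n, Cmod (rgamma_part n w - rgamma w) <=
    ratio_const Z * (Cmod w * exp (ratio_const Z)) * / INR (S n).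
Proof.
move=> Z0 HZ; apply: Clim_Cauchy.
  by have := lim_scal (ratio_const Z * (Cmod w * exp (ratio_const Z))) _ _ inv_lim; rewrite Rmult_0_r.
by move=> n m; exact: rgamma_Cauchy.
Qed.

Lemma rgamma_unif R eps : 0 < eps -> exists n, forall w, Cmod w <= R ->
  Cmod (rgamma_part n w - rgamma w) <= eps.
Proof.
move=> He; set R' := Rabs R; have R0 : 0 <= R' by apply: Rabs_pos.
set K := ratio_const (R' + 1); have K0 : 0 <= K by apply: ratio_const_ge_0; lra.
have L := lim_scal (K * (R' * exp K)) _ _ inv_lim; rewrite Rmult_0_r in L.
have [n Hn] := proj2 (is_lim_seq_spec _ _) L (mkposreal _ He).
have {}Hn := Hn n (le_n _); rewrite /= Rminus_0_r in Hn.
exists n => w Hw; have Hw' : Cmod w <= R' by apply: Rle_trans Hw (Rle_abs _).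
have [_ H] := rgamma_spec w (R' + 1) ltac:(lra)
  ltac:(by apply: Rle_trans (Cmod_sub_le _ _) _; rewrite Cmod_1; lra).
apply: Rle_trans (H n) _; apply: Rle_trans (Rlt_le _ _ Hn).
apply: Rle_trans (Rle_abs _); apply: Rmult_le_compat_r.
  exact: Rlt_le (Rinv_0_lt_compat _ (INR_S_pos n)).
apply: Rmult_le_compat_l => //; apply: Rmult_le_compat_r => //; exact: Rlt_le (exp_pos _).
Qed.

Lemma rgamma_real x : rgamma (RtoC x) = RtoC (Re (rgamma (RtoC x))) /\
  is_lim_seq (fun N => Rpower (INR N) (1 - x) * bincoef x N) (Re (rgamma (RtoC x))).
Proof.
have [H _] := rgamma_spec (RtoC x) (Cmod (1 - RtoC x)) (Cmod_ge_0 _) (Rle_refl _).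
have := Ccvg_real (fun n => Rpower (INR (S n)) (1 - x) * bincoef x (S n)) (rgamma (RtoC x)).
case.
  by apply: Ccvg_ext H => n; rewrite rgamma_part_real.
by move=> H1 H2; split=> //; apply/is_lim_seq_incr_1.
Qed.

(** * The functional equation *)

(** The Dirichlet series of [chi]. *)
Definition chi_series (s : C) : C := ((1 - npow 2 s) * eta s)%C.

(** Since [chi(n) = (-1)^(n-1)] corrected by [- (-1)^(n/2-1)] at even n, the partial
    sums are those of eta minus [2^(-s)] times shorter ones. *)
Lemma chi_series_partial x Q : RtoC (Rsum (block (fun k => Rpower (INR k) (- x))) Q) =
  (eta_part (2 * Q) (RtoC x) - npow 2 (RtoC x) * eta_part Q (RtoC x))%C.
Proof.
elim: Q => [|Q IH]; first by rewrite /eta_part /=; ring.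
cbn [Rsum]; rewrite RtoC_plus IH.
have -> : (2 * S Q = S (S (2 * Q)))%nat by lia.
rewrite /eta_part; cbn [Csum].
have -> : (2 * (2 * Q) + 1 = 4 * Q + 1)%nat by lia.
have -> : (2 * (2 * Q) + 2 = 4 * Q + 2)%nat by lia.
have -> : (2 * S (2 * Q) + 1 = 4 * Q + 3)%nat by lia.
have -> : (2 * S (2 * Q) + 2 = 2 * (2 * Q + 2))%nat by lia.
have E : npow (4 * Q + 2) (RtoC x) = (npow 2 (RtoC x) * npow (2 * Q + 1) (RtoC x))%C.
  by rewrite -npow_mult; try lia; congr npow; lia.
rewrite (npow_mult 2 (2 * Q + 2)); try lia.
rewrite /block RtoC_plus RtoC_minus RtoC_mult -!npow_real RtoC_2.
have X : (npow 2 (RtoC x) * npow (2 * Q + 1) (RtoC x))%C = npow (4 * Q + 2) (RtoC x) by rewrite E.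
set a := npow (4 * Q + 1) _; set b := npow (4 * Q + 2) _ in X *; set c := npow (4 * Q + 3) _.
set d := npow (2 * Q + 1) _ in X *; set e := npow (2 * Q + 2) _; set t := npow 2 _ in X *.
set u := Csum _ _; set v := Csum _ _.
replace (u + (a - b) + (c - t * e) - t * (v + (d - e)))%C with
  (u + (a - b) + c - t * v - t * d)%C by ring.
by rewrite X; ring.
Qed.

Lemma chi_series_real x : 0 < x -> chi_series (RtoC x) = RtoC (Re (chi_series (RtoC x))) /\
  is_lim_seq (Rsum (block (fun k => Rpower (INR k) (- x)))) (Re (chi_series (RtoC x))).
Proof.
move=> Hx; apply: Ccvg_real.
apply: (Ccvg_ext (fun Q => eta_part (2 * Q) (RtoC x) - npow 2 (RtoC x) * eta_part Q (RtoC x))%C).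
  by move=> Q; rewrite chi_series_partial.
have [H _] := eta_spec (RtoC x) Hx.
have -> : chi_series (RtoC x) = (eta (RtoC x) - npow 2 (RtoC x) * eta (RtoC x))%C by rewrite /chi_series; ring.
apply: Ccvg_minus; last exact: Ccvg_scal.
by apply: (Ccvg_subseq _ _ (fun Q => 2 * Q)%nat) H => n; lia.
Qed.

Lemma functional_equation_chi_series x : 0 < x < 1 ->
  (rgamma (RtoC x) * chi_series (RtoC (1 - x)))%C =
  (RtoC (Rpower (PI / 2) (- x) * cos (PI * x / 2)) * chi_series (RtoC x))%C.
Proof.
move=> Hx; have [G1 G2] := rgamma_real x.
have [D1 D2] := chi_series_real x ltac:(lra); have [D3 D4] := chi_series_real (1 - x) ltac:(lra).
rewrite G1 D1 D3 -!RtoC_mult; congr RtoC.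
exact: (real_functional_equation x Hx _ _ _ G2 D2 D4).
Qed.

Section Zeta.
Variable zeta : C -> C.
Hypothesis Hz : is_riemann_zeta zeta.

(** [2 cos (pi w/2)]. *)
Definition two_cos (w : C) : C :=
  (Cexp (Ci * RtoC (PI / 2) * w) + Cexp (- (Ci * RtoC (PI / 2) * w)))%C.

Lemma two_cos_real x : two_cos (RtoC x) = RtoC (2 * cos (PI * x / 2)).
Proof.
rewrite /two_cos.
have -> : (Ci * RtoC (PI / 2) * RtoC x)%C = (0, PI * x / 2).
  by rewrite /Ci; apply: injective_projections => /=; field.
rewrite /Cexp /= Ropp_0 exp_0 cos_neg sin_neg.
by apply: injective_projections => /=; ring.
Qed.

(** With [a = 2^(-x)], the Euler factors [(1-a)(1-2a)] of [chi_series x] and [(1 -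
    1/(2a))(1 - 1/a)] of [chi_series (1-x)] have the ratio [2 a^2]. *)
Lemma functional_equation_real x : 0 < x < 1 ->
  (two_cos (RtoC x) * zeta (RtoC x))%C =
  (rgamma (RtoC x) * (Cexp (RtoC x * RtoC (ln (2 * PI))) * zeta (1 - RtoC x)))%C.
Proof.
move=> Hx; have Pi := PI_RGT_0; have FE := functional_equation_chi_series x Hx.
set a := Rpower 2 (- x).
have I2 : INR 2 = 2 by rewrite /=; ring.
have Na : npow 2 (RtoC x) = RtoC a by rewrite npow_real I2.
have a1 : a < 1.
  by rewrite /a -(Rpower_O 2); [apply: Rpower_lt; lra|lra].
have a2 : 1 / 2 < a.
  have -> : 1 / 2 = Rpower 2 (- (1)) by rewrite Rpower_Ropp Rpower_1; [field|lra].
  by rewrite /a; apply: Rpower_lt; lra.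
have Nb : npow 2 (RtoC (1 - x)) = RtoC (/ (2 * a)).
  rewrite npow_real I2; congr RtoC.
  have -> : - (1 - x) = - (- x + 1) by ring.
  rewrite Rpower_Ropp Rpower_plus Rpower_1 /a; last lra.
  by rewrite Rmult_comm.
have ne1 : RtoC x <> 1%C by move=> /RtoC_inj; lra.
have ne2 : RtoC (1 - x) <> 1%C by move=> /RtoC_inj; lra.
rewrite /chi_series !(eta_zeta zeta) // in FE; try (rewrite /Re /=; lra).
rewrite Na Nb in FE.
have E1 : ((1 - RtoC (/ (2 * a))) * ((1 - 2 * RtoC (/ (2 * a))) * zeta (RtoC (1 - x))))%C =
   (RtoC ((1 - a) * (1 - 2 * a) / (2 * a ^ 2)) * zeta (RtoC (1 - x)))%C.
  rewrite Cmult_assoc; congr Cmult.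
  rewrite -!(RtoC_mult, RtoC_minus); congr RtoC; field; lra.
have E2 : ((1 - RtoC a) * ((1 - 2 * RtoC a) * zeta (RtoC x)))%C =
   (RtoC ((1 - a) * (1 - 2 * a)) * zeta (RtoC x))%C.
  rewrite Cmult_assoc; congr Cmult.
  by rewrite -!(RtoC_mult, RtoC_minus).
rewrite E1 E2 in FE.
set P := Rpower (PI / 2) (- x) in FE.
have PP : 0 < P by apply: exp_pos.
have Ex : Cexp (RtoC x * RtoC (ln (2 * PI))) = RtoC (/ (a ^ 2 * P)).
  rewrite -RtoC_mult Cexp_RtoC; congr RtoC.
  have -> : exp (x * ln (2 * PI)) = / Rpower (2 * PI) (- x).
    by rewrite Rpower_Ropp Rinv_inv.
  congr Rinv; have -> : 2 * PI = 2 * 2 * (PI / 2) by field.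
  rewrite -(Rpower_mult_distr (2 * 2) (PI / 2)) -?(Rpower_mult_distr 2 2) -/a -/P; lra || ring.
have E1x : (1 - RtoC x = RtoC (1 - x))%C by rewrite RtoC_minus.
rewrite two_cos_real Ex E1x.
have K : RtoC ((1 - a) * (1 - 2 * a) / (2 * a ^ 2)) <> 0%C.
  move=> /RtoC_inj H.
  have : (1 - a) * (1 - 2 * a) = 0.
    have -> : (1 - a) * (1 - 2 * a) = (1 - a) * (1 - 2 * a) / (2 * a ^ 2) * (2 * a ^ 2) by field; lra.
    by rewrite H; ring.
  nra.
have FE' : (RtoC ((1 - a) * (1 - 2 * a) / (2 * a ^ 2)) * (rgamma (RtoC x) * zeta (RtoC (1 - x))))%C =
   (RtoC ((1 - a) * (1 - 2 * a) / (2 * a ^ 2)) * (RtoC (2 * a ^ 2 * P * cos (PI * x / 2)) * zeta (RtoC x)))%C.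
  transitivity (rgamma (RtoC x) * (RtoC ((1 - a) * (1 - 2 * a) / (2 * a ^ 2)) * zeta (RtoC (1 - x))))%C; first ring.
  rewrite FE !Cmult_assoc; congr Cmult.
  rewrite -!RtoC_mult; congr RtoC; field; lra.
have FE2 : (rgamma (RtoC x) * zeta (RtoC (1 - x)))%C = (RtoC (2 * a ^ 2 * P * cos (PI * x / 2)) * zeta (RtoC x))%C.
  exact: (Cmult_cancel_l _ _ _ K FE').
replace (rgamma (RtoC x) * (RtoC (/ (a ^ 2 * P)) * zeta (RtoC (1 - x))))%C with
  (RtoC (/ (a ^ 2 * P)) * (rgamma (RtoC x) * zeta (RtoC (1 - x))))%C by ring.
rewrite FE2 Cmult_assoc; congr Cmult; rewrite -RtoC_mult; congr RtoC; field; lra.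
Qed.

Lemma zeta_holo (s : C) : s <> 1%C -> holo_at zeta s.
Proof. by move=> Hs; apply: ex_derive_holo_at; apply: (proj2 Hz). Qed.

(** Both sides are approximable on the right half plane, where [1 - w] avoids the
    pole, and agree on (0, 1). *)
Lemma functional_equation (w : C) : 0 < Re w -> w <> 1%C ->
  (two_cos w * zeta w)%C = (rgamma w * (Cexp (w * RtoC (ln (2 * PI))) * zeta (1 - w)))%C.
Proof.
move=> Hw Hw1.
suff H : (two_cos w * zeta w - rgamma w * (Cexp (w * RtoC (ln (2 * PI))) * zeta (1 - w)))%C = 0%C.
  by rewrite -[RHS]Cplus_0_l -H; ring.
move: w Hw Hw1.
apply: (identity_from_interval (fun w => two_cos w * zeta w - rgamma w *
   (Cexp (w * RtoC (ln (2 * PI))) * zeta (1 - w)))%C).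
- apply: (approx_half_plane_minus_mult (fun w => two_cos w * zeta w)%C
    (fun w => Cexp (w * RtoC (ln (2 * PI))) * zeta (1 - w))%C rgamma rgamma_part).
  + move=> z _ Hz1; apply: holo_mult; last exact: zeta_holo.
    have L : holo_at (fun w => Ci * RtoC (PI / 2) * w)%C z.
      by apply: holo_mult; [exact: holo_const|exact: holo_id].
    apply: holo_plus; apply: (holo_comp Cexp); try exact: holo_Cexp; first exact: L.
    exact: holo_opp.
  + move=> z Hz0 _; apply: holo_mult.
      apply: (holo_comp Cexp); first exact: holo_Cexp.
      by apply: holo_mult; [exact: holo_id|exact: holo_const].
    apply: (holo_comp zeta); last by apply: holo_minus; [exact: holo_const|exact: holo_id].
    apply: zeta_holo => E; have : Re (1 - z)%C = 1 by rewrite E.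
    by rewrite /Re /= in Hz0 *; lra.
  + by move=> n z _; exact: holo_rgamma_part.
  + by move=> d R eps _ He; have [n Hn] := rgamma_unif R eps He; exists n => z _; exact: Hn.
- by move=> x Hx; rewrite functional_equation_real //; ring.
Qed.

(** * The value at 0 and the left half plane *)

(** At real x the first Euler product is [x], and the following ones increase because
    [(1 + 1/N)^x <= 1 + x/N]. *)
Lemma rgamma_lower x : 0 < x < 1 -> x <= Re (rgamma (RtoC x)).
Proof.
move=> Hx; have [_ H] := rgamma_real x.
suff : Rbar_le x (Re (rgamma (RtoC x))) by [].
apply: (is_lim_seq_le_loc (fun _ => x) _ _ _ _ (is_lim_seq_const x) H).
exists 1%nat => -[|n] Hn; first lia.
elim: n {Hn} => [|n IH].
  rewrite /= /Rpower ln_1 Rmult_0_r exp_0; have -> : 1 * (1 * (x + 0) / 1) = x by field.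
  lra.
apply: Rle_trans IH _.
have Np := INR_S_pos n; have Np2 := INR_S_pos (S n); have ES : INR (S (S n)) = INR (S n) + 1 by rewrite (S_INR (S n)).
have B := bincoef_pos x (S n) ltac:(lra).
have -> : bincoef x (S (S n)) = bincoef x (S n) * (x + INR (S n)) / INR (S (S n)) by [].
set y := INR (S n) in Np ES B *.
have -> : Rpower (INR (S (S n))) (1 - x) * (bincoef x (S n) * (x + y) / INR (S (S n))) =
  bincoef x (S n) * ((x + y) * (Rpower (INR (S (S n))) (1 - x) * / INR (S (S n)))) by rewrite /Rdiv; ring.
have -> : Rpower (INR (S (S n))) (1 - x) * / INR (S (S n)) = / Rpower (INR (S (S n))) x.
  have -> : 1 - x = - x + 1 by ring.
  rewrite Rpower_plus Rpower_1 // Rpower_Ropp; field.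
  by split; [apply: Rgt_not_eq; exact: exp_pos|lra].
have -> : Rpower y (1 - x) = y * / Rpower y x by rewrite Rpower_plus Rpower_1 // Rpower_Ropp.
rewrite Rmult_comm; apply: Rmult_le_compat_l; first lra.
have P1 : 0 < Rpower y x by apply: exp_pos.
have E : Rpower (INR (S (S n))) x = Rpower y x * Rpower (1 + / y) x.
  rewrite Rpower_mult_distr //; first by congr Rpower; rewrite ES; field; lra.
  by have := Rinv_0_lt_compat _ Np; lra.
have P2 : 0 < Rpower (1 + / y) x by apply: exp_pos.
rewrite E Rinv_mult.
have C := bernoulli_concave (/ y) x (Rinv_0_lt_compat _ Np) Hx.
have -> : y * / Rpower y x = (/ Rpower y x * / Rpower (1 + / y) x) * (y * Rpower (1 + / y) x) by field; lra.
rewrite (Rmult_comm (x + y)); apply: Rmult_le_compat_l.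
  by apply: Rmult_le_pos; apply: Rlt_le; apply: Rinv_0_lt_compat.
have -> : x + y = y * (1 + x * / y) by field; lra.
by apply: Rmult_le_compat_l; lra.
Qed.

Lemma eta_real_lower y : 0 < y -> 1 - Rpower 2 (- y) <= Cmod (eta (RtoC y)).
Proof.
move=> Hy; have [H _] := eta_spec (RtoC y) Hy.
pose u M := Rsum (fun j => Rpower (INR (2 * j + 1)) (- y) - Rpower (INR (2 * j + 2)) (- y)) M.
have E M : eta_part M (RtoC y) = RtoC (u M).
  rewrite /eta_part /u RtoC_Rsum; apply: Csum_ext => i _.
  by rewrite RtoC_minus !npow_real.
have [E1 E2] := Ccvg_real u (eta (RtoC y)) (Ccvg_ext _ _ _ E H).
rewrite E1 Cmod_R; apply: Rle_trans (Rle_abs _).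
suff : Rbar_le (1 - Rpower 2 (- y)) (Re (eta (RtoC y))) by [].
apply: (is_lim_seq_le_loc (fun _ => 1 - Rpower 2 (- y)) u _ _ _ (is_lim_seq_const _) E2).
exists 1%nat => -[|n] Hn; first lia.
elim: n {Hn} => [|n IH].
  rewrite /u; cbn [Rsum]; rewrite /= [Rpower 1 _]/Rpower ln_1 Rmult_0_r exp_0.
  have -> : 1 + 1 = 2 by []. lra.
apply: Rle_trans IH _.
have -> : u (S (S n)) = u (S n) + (Rpower (INR (2 * S n + 1)) (- y) - Rpower (INR (2 * S n + 2)) (- y)) by [].
have : Rpower (INR (2 * S n + 2)) (- y) <= Rpower (INR (2 * S n + 1)) (- y).
  by apply: Rpower_incr_base; [apply: lt_0_INR; lia|apply: le_INR; lia|lra].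
lra.
Qed.

(** In the functional equation at small x, the left side is at least a constant times
    x, while [chi_series x] contains the factor [1 - 2^(-x) <= x]; hence [zeta x]
    stays away from 0. *)
Lemma zeta_lower_near_0 x : 0 < x < 1 / 2 -> 1 / 16 <= Cmod (zeta (RtoC x)).
Proof.
move=> Hx; have Pi := PI_RGT_0.
have I2 : INR 2 = 2 by rewrite /=; ring.
have FE := f_equal Cmod (functional_equation_chi_series x ltac:(lra)).
rewrite (Cmod_mult (rgamma _)) (Cmod_mult (RtoC (_ * _))) in FE.
have [G1 _] := rgamma_real x; have GL := rgamma_lower x ltac:(lra).
have HG : x <= Cmod (rgamma (RtoC x)) by rewrite G1 Cmod_R; apply: Rle_trans (Rle_abs _).
have Q : Rpower 2 (- (1 - x)) <= 3 / 4.
  have H1 : Rpower 2 (- (1 - x)) < Rpower 2 (- / 2) by apply: Rpower_lt; lra.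
  have H2 : Rpower 2 (- / 2) * Rpower 2 (- / 2) = / 2.
    rewrite -Rpower_plus; have -> : - / 2 + - / 2 = - (1) by field.
    by rewrite Rpower_Ropp Rpower_1; lra.
  have H3 : 0 < Rpower 2 (- / 2) by apply: exp_pos.
  nra.
have HD : 1 / 16 <= Cmod (chi_series (RtoC (1 - x))).
  rewrite /chi_series Cmod_mult.
  have A1 : 1 / 4 <= Cmod (1 - npow 2 (RtoC (1 - x))).
    by rewrite npow_real I2 -RtoC_minus Cmod_R; apply: Rle_trans (Rle_abs _); lra.
  have A2 := eta_real_lower (1 - x) ltac:(lra).
  have -> : 1 / 16 = 1 / 4 * (1 / 4) by field.
  by apply: Rmult_le_compat; lra.
have HR : Cmod (RtoC (Rpower (PI / 2) (- x) * cos (PI * x / 2))) <= 1.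
  rewrite Cmod_R Rabs_mult.
  have B1 : Rabs (Rpower (PI / 2) (- x)) <= 1.
    rewrite Rabs_pos_eq; last exact: Rlt_le (exp_pos _).
    rewrite -[X in _ <= X](Rpower_O (PI / 2)); last lra.
    by apply: Rle_Rpower; have := PI2_1; lra.
  have B2 : Rabs (cos (PI * x / 2)) <= 1 by apply: Rabs_le; exact: COS_bound.
  by have := Rabs_pos (Rpower (PI / 2) (- x)); have := Rabs_pos (cos (PI * x / 2)); nra.
have HDx : Cmod (chi_series (RtoC x)) <= x * Cmod (zeta (RtoC x)).
  rewrite /chi_series (eta_zeta zeta) //; try (rewrite /Re /=; lra); last by move=> /RtoC_inj; lra.
  rewrite Cmult_assoc Cmod_mult; apply: Rmult_le_compat_r; first exact: Cmod_ge_0.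
  rewrite npow_real I2 Cmod_mult -!(RtoC_mult, RtoC_minus) !Cmod_R.
  set a := Rpower 2 (- x).
  have a1 : a < 1.
    by rewrite /a -(Rpower_O 2); [apply: Rpower_lt; lra|lra].
  have a2 : 1 / 2 < a.
    have -> : 1 / 2 = Rpower 2 (- (1)) by rewrite Rpower_Ropp Rpower_1; [field|lra].
    by rewrite /a; apply: Rpower_lt; lra.
  have a3 : 1 - x <= a.
    have l2 : ln 2 <= 1 by have := exp_ineq1_le (ln 2); rewrite exp_ln; lra.
    have l0 : 0 < ln 2 by have := ln_lt_2; lra.
    rewrite /a /Rpower; have := exp_ineq1_le (- x * ln 2); nra.
  rewrite (Rabs_pos_eq (1 - a)); last lra.
  rewrite (Rabs_left (1 - 2 * a)); nra.
have : x * (1 / 16) <= Cmod (rgamma (RtoC x)) * Cmod (chi_series (RtoC (1 - x))).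
  by apply: Rmult_le_compat; lra.
rewrite FE => H.
have D0 := Cmod_ge_0 (chi_series (RtoC x)).
have : Cmod (RtoC (Rpower (PI / 2) (- x) * cos (PI * x / 2))) * Cmod (chi_series (RtoC x)) <= Cmod (chi_series (RtoC x)) by nra.
move=> H2; apply: (Rmult_le_reg_l x); lra.
Qed.

Lemma zeta_0_neq_0 : zeta 0%C <> 0%C.
Proof.
move=> H0.
have Hc : cont_at zeta 0%C by apply: holo_cont; apply: zeta_holo => /RtoC_inj; lra.
have [d [Hd H]] := Hc (1 / 16) ltac:(lra).
set x := Rmin (1 / 4) (d / 2).
have Hx : 0 < x <= 1 / 4 by split; [apply: Rmin_pos; lra|apply: Rmin_l].
have Hxd : x < d by apply: Rle_lt_trans (Rmin_r _ _) _; lra.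
have := zeta_lower_near_0 x ltac:(lra).
have := H (RtoC x).
replace (RtoC x - 0)%C with (RtoC x) by ring.
rewrite H0 Cmod_R Rabs_pos_eq; last lra.
by move=> /(_ Hxd); replace (zeta (RtoC x) - 0)%C with (zeta (RtoC x)) by ring; lra.
Qed.

(** The two exponentials have moduli [exp (- pi Im w/2)] and [exp (pi Im w/2)], so a
    zero is real. *)
Lemma two_cos_zero w : two_cos w = 0%C -> exists k : Z, w = RtoC (2 * IZR k + 1).
Proof.
move=> H; have Pi := PI_RGT_0.
have Hi : Im w = 0.
  have E : Cexp (Ci * RtoC (PI / 2) * w) = (- Cexp (- (Ci * RtoC (PI / 2) * w)))%C.
    by rewrite -[RHS]Cplus_0_l -H /two_cos; ring.
  have := f_equal Cmod E; rewrite Cmod_opp !Cmod_Cexp => /exp_inv.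
  have -> : Re (Ci * RtoC (PI / 2) * w)%C = - (PI / 2) * Im w by rewrite /Re /Im /=; ring.
  have -> : Re (- (Ci * RtoC (PI / 2) * w))%C = PI / 2 * Im w by rewrite /Re /Im /=; ring.
  nra.
have Ew : w = RtoC (Re w) by apply: injective_projections.
rewrite Ew two_cos_real in H; move: H => /RtoC_inj H.
have [k Hk] := cos_eq_0_0 (PI * Re w / 2) ltac:(lra).
exists k; rewrite Ew; congr RtoC.
apply: (Rmult_eq_reg_l (PI / 2)); lra.
Qed.

(** With [w = 1 - s] the functional equation reads [2 cos (pi w/2) zeta(w) = 0], so w
    is an odd integer above 1/2, and it is not 1 because [zeta(0) <> 0]. *)
Lemma zeros_left_half_plane (s : C) : Re s < 1 / 2 -> zeta s = 0%C -> zeta (1 - s)%C <> 0%C ->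
  trivial_zero s.
Proof.
move=> Hs Hzero Hnz.
have s0 : s <> 0%C by move=> E; move: Hzero; rewrite E; exact: zeta_0_neq_0.
set w := (1 - s)%C in Hnz.
have Ew : (1 - w)%C = s by rewrite /w; ring.
have Rw : Re w = 1 - Re s by rewrite /w /Re /=; ring.
have Hw1 : w <> 1%C by move=> E; apply: s0; rewrite -Ew E; ring.
have FE := functional_equation w ltac:(lra) Hw1.
rewrite Ew Hzero !Cmult_0_r in FE.
have Hc : two_cos w = 0%C.
  have := f_equal (fun z => z * / zeta w)%C FE.
  by rewrite -Cmult_assoc Cinv_r // Cmult_1_r Cmult_0_l.
have [k Hk] := two_cos_zero w Hc.
have Rk : Re w = 2 * IZR k + 1 by rewrite Hk.
have k1 : (0 < k)%Z.
  case: (Z.lt_trichotomy 0 k) => [//|[K|K]].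
    by exfalso; apply: Hw1; rewrite Hk -K; congr RtoC; ring.
  have : IZR k <= -1 by apply: IZR_le; lia.
  lra.
exists (Z.to_nat (k - 1)).
have Ek : INR (S (Z.to_nat (k - 1))) = IZR k.
  by rewrite INR_IZR_INZ; congr IZR; lia.
rewrite Ek -Ew Hk -RtoC_minus; congr RtoC; ring.
Qed.

End Zeta.

Theorem theorem3p1 :
  is_lim_seq
    (fun n : nat =>
       RInt_gen
         (fun x : R =>
            Rabs (1 + sum_n_m (fun k : nat => mobius k * nu (x / INR k)) 1 n) ^ 2
            * / x ^ 2)
         (at_point (INR n)) (Rbar_locally p_infty))
    0 ->
  RiemannHypothesis.
Proof.
move=> Hlim zeta Hz s Hs1 Hzero Hnt.
have right_half w : 1 / 2 < Re w -> w <> 1%C -> zeta w <> 0%C.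
  by move=> Hw Hw1; exact: (zeta_nonzero_right zeta w Hz Hlim Hw Hw1).
case: (Rtotal_order (Re s) (1 / 2)) => [Hlt|[//|Hgt]]; exfalso; last exact: (right_half s).
apply: Hnt; apply: (zeros_left_half_plane zeta Hz s Hlt Hzero).
apply: right_half; first by rewrite /Re /= in Hlt *; lra.
move=> E; apply: (zeta_0_neq_0 zeta Hz).
move: Hzero; have -> : s = RtoC 0; last by [].
by replace s with (1 - (1 - s))%C by ring; rewrite E; ring.
Qed.
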